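(* Consider the sequence (indexed by $k$) of repeated-measures designs with random responses described in the context. Suppose that the following hold. (D1) For every $k$, $\Sigma$ is non-singular. (D2) $\limsup_{k\to\infty}\sigma(2\log p)^{1/2}=0$, where $\sigma=\lambda_{\max}^{1/2}\left[\sum_{i=1}^n(\Sigma^{-1/2}x_ix_i^T\Sigma^{-1/2})^2\right]$ and $x_1^T,\dots,x_n^T$ are the rows of $X$. (D3) $r\gg\log q$, i.e. $(\log q)/r\to0$ as $k\to\infty$. (D4) For every $k$, $\max_{1\le i\le q}|\tilde x_i^T\beta_*|<\ell$, where $\ell$ is a constant (independent of $k$) such that $\inf_{|\mu|<\ell}\bigl[G(\mu)\wedge(1-G(\mu))\bigr]>0$. Then there exists a constant $\rho<1$ (independent of $k$) such that, for any $\epsilon>0$, $$\lim_{k\to\infty}\tilde{\mathbb{P}}\left(\rho_*(\psi)>\rho+\epsilon\right)=0 .$$ The result continues to hold if $\rho_*(\psi)$ is replaced by $\rho_*^{\mathrm{TV}}$.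
   Context: Design. For each $k\ge1$, $X=X_{n(k)\times p(k)}$ is a deterministic real matrix, with $n(k),p(k)\to\infty$ as $k\to\infty$. $X$ has $q=q(k)$ distinct rows $\tilde x_1^T,\dots,\tilde x_q^T$; the $i$th distinct row is repeated $r_i$ times, each $r_i\ge r=r(k)$ with $r$ a positive integer, and $\sum_{i=1}^qr_i=n$. $G:\mathbb{R}\to(0,1)$ is a function independent of $k$, $\beta_*\in\mathbb{R}^{p}$ is the true coefficient (depending on $k$). Independently for $i=1,\dots,q$, $j=1,\dots,r_i$, $y_{ij}\sim\mathrm{Bernoulli}(G(\tilde x_i^T\beta_* ))$ is the response corresponding to the $j$th copy of $\tilde x_i^T$; $y\in\{0,1\}^n$ collects these. $\tilde{\mathbb{P}}$ is the probability over the random responses. For each $k$ a prior is given with parameters $v=v_k\in\mathbb{R}^p$ and $Q=Q_k$, a symmetric $p\times p$ matrix that is positive definite or zero. $\Sigma=X^TX+Q$. Albert–Chib chain for given $(X,y,Q,v)$ with $\Sigma$ nonsingular. $\Phi$ is the standard normal cdf; $x_i^T$ is the $i$th row of $X$ and $y_i$ its response. The posterior density is $\pi(\beta|X,y)\propto\prod_{i=1}^n\Phi(x_i^T\beta)^{y_i}(1-\Phi(x_i^T\beta))^{1-y_i}\exp[-\frac12(\beta-v)^TQ(\beta-v)]$, proper if the right side is integrable on $\mathbb{R}^p$; $\Pi$ is the corresponding probability measure. For $a\in\{0,1\}$, $\mathrm{TN}(\mu,1;a)$ is $\mathrm{N}(\mu,1)$ truncated to $(-\infty,0)$ if $a=0$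 and to $(0,\infty)$ if $a=1$. $K(\beta,\cdot)$ is the law of $\tilde\beta$ obtained by drawing independent $Z_i\sim\mathrm{TN}(x_i^T\beta,1;y_i)$, $Z=(Z_1,\dots,Z_n)^T$, then $\tilde\beta\sim\mathrm{N}(\Sigma^{-1}(X^TZ+Qv),\Sigma^{-1})$. $K_\beta^m$ is the $m$-step law from $\beta$. $\psi(\beta,\beta')=[(\beta-\beta')^T\Sigma(\beta-\beta')]^{1/2}$; $\mathrm{W}_\psi(\mu,\nu)$ is the infimum of $\int\psi\,d\upsilon$ over couplings $\upsilon$ of $\mu,\nu$. $\rho_*(\psi)\in[0,1]$ is the infimum of $\rho\in[0,1]$ for which there is $M:\mathbb{R}^p\to[0,\infty)$ with $\mathrm{W}_\psi(K_\beta^m,\Pi)\le M(\beta)\rho^m$ for all $m\ge1$, $\beta\in\mathbb{R}^p$ (equal to $1$ if there is no such $\rho$). $\rho_*^{\mathrm{TV}}$ is defined in the same way with the total variation distance (supremum of discrepancy over measurable sets) in place of $\mathrm{W}_\psi$. By convention these rates are set to $1$ when the posterior is improper. $\lambda_{\max}$ is the largest eigenvalue; $s\wedge t=\min\{s,t\}$. *)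

(* Defs.v *)
From HB Require Import structures.
From mathcomp Require Import all_boot all_order all_algebra.
From mathcomp Require Import all_classical all_reals all_analysis.

Set Implicit Arguments.
Unset Strict Implicit.
Unset Printing Implicit Defensive.

Import Order.TTheory GRing.Theory Num.Theory.
Import numFieldNormedType.Exports.

Local Open Scope classical_set_scope.
Local Open Scope ring_scope.

Section product_measure_on_tuples.
Context d (T : measurableType d) (R : realType).

Definition tcons n (z : (T * n.-tuple T)%type) : n.+1.-tuple T :=
  [tuple of z.1 :: z.2].

Lemma measurable_tcons n : measurable_fun setT (@tcons n).
Proof. exact: measurable_cons. Qed.

Section one_step.
Variables (n : nat) (m1 : {sigma_finite_measure set T -> \bar R}).
Variable m2 : {sigma_finite_measure set (n.-tuple T) -> \bar R}.

Definition tcons_measure : set (n.+1.-tuple T) -> \bar R :=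
  pushforward (m1 \x m2)%E (@tcons n).

Let push0 : tcons_measure set0 = 0%E.
Proof. by rewrite /tcons_measure /pushforward preimage_set0 measure0. Qed.

Let push_ge0 A : (0 <= tcons_measure A)%E.
Proof. exact: (measure_ge0 (m1 \x m2)%E). Qed.

Let push_sigma_additive : semi_sigma_additive tcons_measure.
Proof.
exact: (@measure_semi_sigma_additive _ _ _
  (measure_function_pushforward__canonical__measure_function_Measure
    (m1 \x m2)%E (@measurable_tcons n))).
Qed.

HB.instance Definition _ := isMeasure.Build _ _ _ tcons_measure
  push0 push_ge0 push_sigma_additive.

Let push_sigma_finite : sigma_finite setT tcons_measure.
Proof.
have /sigma_finiteP[F [TF ndF Foo]] := sigma_finiteT m1.
have /sigma_finiteP[G [TG ndG Goo]] := sigma_finiteT m2.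
pose u (t : n.+1.-tuple T) : (T * n.-tuple T)%type :=
  (thead t, [tuple of behead t]).
have mu : measurable_fun setT u.
  apply/measurable_fun_pairP; split; first exact: measurable_tnth.
  exact: measurable_behead.
have tconsK : u \o @tcons n = id.
  apply/funext => -[x t]; rewrite /u /tcons /= theadE; congr pair.
  exact/val_inj.
exists (fun k => u @^-1` (F k `*` G k)).
  rewrite -preimage_bigcup -[LHS](preimage_setT u); congr (_ @^-1` _).
  rewrite -setXTT TF TG predeqE => -[x y]; split.
    move=> [/= [i _ Fx] [j _ Gy]]; exists (maxn i j) => //; split.
    - by move: x Fx; exact/subsetPset/ndF/leq_maxl.
    - by move: y Gy; exact/subsetPset/ndG/leq_maxr.
  by move=> [i _ []/= ? ?]; split; exists i.
move=> k; have [? ?] := Foo k; have [? ?] := Goo k; split.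
  by rewrite -[X in measurable X]setTI; apply: mu => //; exact: measurableX.
rewrite /tcons_measure /pushforward -comp_preimage tconsK preimage_id.
by rewrite product_measure1E// lte_mul_pinfty// ge0_fin_numE.
Qed.

HB.instance Definition _ := Measure_isSigmaFinite.Build _ _ _ tcons_measure
  push_sigma_finite.

End one_step.

(* The product measure of [mu 0], ..., [mu n.-1]; see [prod_measure_box]. *)
Fixpoint prod_measure n :
    ('I_n -> {sigma_finite_measure set T -> \bar R}) ->
    {sigma_finite_measure set (n.-tuple T) -> \bar R} :=
  match n with
  | 0 => fun=> \d_[tuple]
  | n'.+1 => fun mu =>
      tcons_measure (mu ord0) (prod_measure (fun i => mu (lift ord0 i)))
  end.

Lemma prod_measure_box n (mu : 'I_n -> {sigma_finite_measure set T -> \bar R})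
    (A : 'I_n -> set T) : (forall i, measurable (A i)) ->
  prod_measure mu [set t | forall i, A i (tnth t i)] =
  (\prod_(i < n) mu i (A i))%E.
Proof.
elim: n mu A => [|n IHn] mu A mA.
  by rewrite big_ord0 /= diracE mem_set// => -[].
rewrite big_ord_recl -IHn// -product_measure1E//; last first.
  rewrite (_ : [set t | _] = \bigcap_(i in [set: 'I_n])
    ((@tnth _ T ^~ i) @^-1` A (lift ord0 i))); last first.
    by apply/seteqP; split=> t /= h i; [move=> _; exact: h|exact: h].
  apply: fin_bigcap_measurable; first exact: finite_finset.
  by move=> i _; rewrite -[X in measurable X]setTI; exact: measurable_tnth.
rewrite /= /tcons_measure /pushforward; congr product_measure1.
apply/seteqP; split=> -[x t] /=.
  move=> h; split; first exact: (h ord0).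
  by move=> i; have := h (lift ord0 i); rewrite tnthS.
by move=> [Ax At] i; case: (unliftP ord0 i) => [j|] ->; rewrite ?tnthS.
Qed.

End product_measure_on_tuples.

Section distances_and_rates.
Context d (T : measurableType d) (R : realType).
Implicit Types (mu nu : set T -> \bar R) (K : T -> set T -> \bar R).

Fixpoint kernel_iter K (m : nat) : T -> set T -> \bar R :=
  match m with
  | 0 => fun x => \d_x
  | m'.+1 => fun x A => (\int[K x]_z kernel_iter K m' z A)%E
  end.

Definition coupling mu nu (u : set (T * T) -> \bar R) : Prop :=
  forall A, measurable A -> u (A `*` setT) = mu A /\ u (setT `*` A) = nu A.

Definition wasserstein (psi : T -> T -> R) mu nu : \bar R :=
  ereal_inf [set (\int[u]_z (psi z.1 z.2)%:E)%E |
             u in [set u : probability (T * T)%type R | coupling mu nu u]].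

Definition total_variation mu nu : \bar R :=
  ereal_sup [set `|mu A - nu A|%E | A in measurable].

(* [D] is the distance between measures in which convergence is measured. *)
Definition geometric_rates (D : (set T -> \bar R) -> (set T -> \bar R) -> \bar R)
    K mu : set R :=
  [set rho | 0 <= rho <= 1 /\
     exists M : T -> R, (forall x, 0 <= M x) /\
       forall m x, (1 <= m)%N ->
         (D (kernel_iter K m x) mu <= (M x * rho ^+ m)%:E)%E].

Definition convergence_rate D K mu : R :=
  if `[< geometric_rates D K mu !=set0 >] then inf (geometric_rates D K mu)
  else 1.

End distances_and_rates.

Section linear_algebra.
Variable R : realType.

(* [R^n] as a measurable space is [n.-tuple (measurableTypeR R)], with the
   product of the Borel sigma-algebras; [colv] and [tupv] convert to and from
   column vectors. *)
Definition colv n (x : n.-tuple (measurableTypeR R)) : 'cV[R]_n :=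
  \col_i tnth x i.

Definition tupv n (u : 'cV[R]_n) : n.-tuple (measurableTypeR R) :=
  [tuple u i 0 | i < n].

Definition qform n (A : 'M[R]_n) (u : 'cV[R]_n) : R := (u^T *m A *m u) 0 0.

Definition posdefmx n (A : 'M[R]_n) : Prop :=
  A^T = A /\ forall u, u != 0 -> 0 < qform A u.

Definition possemidefmx n (A : 'M[R]_n) : Prop :=
  A^T = A /\ forall u, 0 <= qform A u.

(* The unique positive semidefinite square root of [A] when [A] is positive
   semidefinite; [0] otherwise. *)
Definition sqrtmx n (A : 'M[R]_n) : 'M[R]_n :=
  xget 0 [set B | possemidefmx B /\ B *m B = A].

Definition lambda_max n (A : 'M[R]_n) : R := sup [set a | eigenvalue A a].

End linear_algebra.

Section distributions.
Variable R : realType.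

Definition normal_cdf (t : R) : R := fine (normal_prob 0 1 `]-oo, t]).

Definition halfline (a : bool) : interval R :=
  if a then `]0, +oo[ else `]-oo, 0[.

(* The last argument of [mnormalize] is a default value for a total mass that is
   zero or infinite, which does not occur here. *)
Definition trunc_normal (mu : R) (a : bool) :=
  mnormalize (mrestr (normal_prob mu 1) (measurable_itv (halfline a)))
    (normal_prob mu 1).

(* [N(m, V)], for [V] positive semidefinite, as the law of [m + V^(1/2) w] with
   [w] a vector of independent standard normal variables. *)
Definition mvnormal p (m : 'cV[R]_p) (V : 'M[R]_p) :
    set (p.-tuple (measurableTypeR R)) -> \bar R :=
  pushforward (prod_measure (fun _ : 'I_p => normal_prob (0 : R) 1))
    (fun w => tupv (m + sqrtmx V *m colv w)).

Definition lebesgue_vect p :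
    {sigma_finite_measure set (p.-tuple (measurableTypeR R)) -> \bar R} :=
  prod_measure (fun _ : 'I_p => @lebesgue_measure R).

End distributions.

Section albert_chib.
Variables (R : realType) (n p : nat).
Variables (X : 'M[R]_(n, p)) (y : n.-tuple bool) (Q : 'M[R]_p) (v : 'cV[R]_p).
Local Notation state := (p.-tuple (measurableTypeR R)).

Definition precision : 'M[R]_p := X^T *m X + Q.

Definition linpred (b : state) (i : 'I_n) : R := (row i X *m colv b) 0 0.

Definition posterior_density (b : state) : R :=
  (\prod_(i < n) (normal_cdf (linpred b i) ^+ tnth y i *
                  (1 - normal_cdf (linpred b i)) ^+ (1 - tnth y i)%N)) *
  expR (- (2^-1 * qform Q (colv b - v))).

(* [posterior] is meaningful only under [posterior_proper]. *)
Definition posterior_proper : Prop :=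
  (lebesgue_vect R p).-integrable setT (EFin \o posterior_density).

Definition posterior (A : set state) : \bar R :=
  ((\int[lebesgue_vect R p]_(b in A) (posterior_density b)%:E) *
   ((fine (\int[lebesgue_vect R p]_b (posterior_density b)%:E))^-1)%:E)%E.

Definition latent_law (b : state) :=
  prod_measure (fun i => trunc_normal (linpred b i) (tnth y i)).

Definition albert_chib (b : state) (A : set state) : \bar R :=
  (\int[latent_law b]_z
     mvnormal (invmx precision *m (X^T *m colv z + Q *m v))
              (invmx precision) A)%E.

Definition psi_metric (b b' : state) : R :=
  Num.sqrt (qform precision (colv b - colv b')).

(* Both rates are [1] by convention when the posterior is improper. *)
Definition rate_psi : R :=
  if `[< posterior_proper >] then
    convergence_rate (wasserstein psi_metric) albert_chib posterior
  else 1.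

Definition rate_TV : R :=
  if `[< posterior_proper >] then
    convergence_rate (@total_variation _ state R) albert_chib posterior
  else 1.

End albert_chib.

Section design.
Variable R : realType.

(* [H] is [Sigma^(-1/2)]. *)
Definition sigma_design n p (X : 'M[R]_(n, p)) (Q : 'M[R]_p) : R :=
  let H := sqrtmx (invmx (precision X Q)) in
  Num.sqrt (lambda_max (\sum_(i < n)
    (let W := H *m (row i X)^T *m row i X *m H in W *m W))).

(* The distinct rows are the rows of [xt], and [lab j] is the index of the
   distinct row of which row [j] of [X] is a copy; hence the number [r_i] of
   repetitions is [nrep lab i], and the [r_i] sum to [n]. *)
Definition repeated_rows n p q (X : 'M[R]_(n, p)) (xt : 'M[R]_(q, p))
    (lab : 'I_n -> 'I_q) : Prop :=
  injective (fun i => row i xt) /\ forall j, row j X = row (lab j) xt.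

Definition nrep n q (lab : 'I_n -> 'I_q) (i : 'I_q) : nat :=
  #|[set j | lab j == i]%SET|.

Definition response_law n p q (G : R -> R) (xt : 'M[R]_(q, p))
    (lab : 'I_n -> 'I_q) (b : 'cV[R]_p) :=
  prod_measure (fun j : 'I_n =>
    bernoulli_prob (G ((row (lab j) xt *m b) 0 0))).

End design.

(* Main.v *)
Require Import Defs.
From HB Require Import structures.
From mathcomp Require Import all_boot all_order all_algebra.
From mathcomp Require Import all_classical all_reals all_analysis.
From mathcomp Require Import measurable_realfun.
From mathcomp Require Import ring lra.

Set Implicit Arguments.
Unset Strict Implicit.
Unset Printing Implicit Defensive.

Import Order.TTheory GRing.Theory Num.Theory.
Import numFieldNormedType.Exports.

Local Open Scope classical_set_scope.
Local Open Scope ring_scope.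

(** Two copies of the chain, started at [b] and [b'], are driven by the same
    noise. A variable with law TN(m, 1; a) is written as a function
    [trunc_map m a x] of a standard normal variable [x] whose slope in [m] lies in
    [0, 1]; this is the log-concavity of the normal distribution function
    ([normal_cdf_ratio], [trunc_slope01]). With [S] the square root of the inverse
    of [Sigma], [W_i = S x_i x_i^T S] and [w = S^-1 (b - b')], the distance
    between the two updated states is therefore the norm of
    [sum_i d_i W_i w], where the [d_i] are independent random slopes. Only one
    fixed vector [w] is involved, so that expanding the square, mean plus variance,
    bounds the second moment by [|sum_i (E d_i) W_i w|^2 + sum_i |W_i w|^2]
    ([second_moment]). The last sum is at most [sigma^2 |w|^2]; and if the mean
    slopes satisfy [sum_i (E d_i) W_i <= k sum_i W_i], the first term is at most
    [k^2 |w|^2], because [sum_i W_i <= 1] ([update_mean_contraction]). Hence each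
    step contracts [psi^2] in mean by [k^2 + sigma^2].

    A factor [k < 1] exists when every distinct row is observed at least a
    fraction [delta] of the time with each response. The mean slopes for the two
    responses at the same pair of linear predictors add up to at most [7 / 4]
    ([mean_slope_pair]): where [m] has the sign opposite to the response, the
    derivative of the mean of TN(m, 1; a) in [m], which is the variance of that
    law, is at most [3 / 4] by a Mills-type bound ([normal_mills],
    [inv_mills_steep]). This gives [k = 1 - delta / 4]
    ([balanced_both_responses]).

    The contraction becomes a rate once the posterior is known to be a stationary
    law with finite second moments. Its density decays exponentially, because of
    the prior or because both responses occur on each row ([posterior_tail]), and
    it is stationary because the joint density of coefficients and latent
    variables can be integrated in either order ([posterior_stationary]); the
    latter rests on the density of a multivariate normal law, obtained from the
    uniqueness of Lebesgue measure under translations ([lebesgue_vect_linear],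
    [mvnormal_density]). Iterating the coupling from [b] and the posterior gives
    the rate in Wasserstein distance ([wasserstein_geometric]). For total
    variation, the last step of the two chains is a Gaussian draw with a common
    covariance, and the distance between the two draws is controlled by the
    distance between their means ([mvnormal_shift], [total_variation_geometric]).

    It remains that all distinct rows receive a fraction [delta = eta / 4] of both
    responses with probability tending to one, where [eta] bounds the success and
    failure probabilities from below. A Chernoff bound for each row and a union
    bound give a failure probability of at most [2 q exp (- eta r / 4)]
    ([responses_failure]), which tends to zero under the growth assumption on [r]
    ([failure_cvg0]). Since [sigma] tends to zero, [k^2 + sigma^2] is eventually
    at most [(k + eps)^2]. *)

(** * Integration against product measures on tuples *)

Section transport.
Context d d' (T : measurableType d) (T' : measurableType d') (R : realType).

(** Image measures ([f = 1]) and measures with a density ([h = id]) are the two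
    extreme cases; both are stable under finite products for the same reason. *)
Definition transports (mu : set T -> \bar R) (nu : set T' -> \bar R)
    (h : T -> T') (f : T -> R) : Prop :=
  forall g : T' -> \bar R, measurable_fun setT g -> (forall x, 0 <= g x)%E ->
  (\int[nu]_x g x = \int[mu]_x (g (h x) * (f x)%:E))%E.

End transport.

Section product_integrals.
Context d (T : measurableType d) (R : realType).

Lemma tnth_tcons0 n (z : T * n.-tuple T) : tnth (tcons z) ord0 = z.1.
Proof. by []. Qed.

Lemma tnth_tconsS n (z : T * n.-tuple T) i :
  tnth (tcons z) (lift ord0 i) = tnth z.2 i.
Proof. by rewrite tnthS. Qed.

Lemma integral_tcons n (m1 : {sigma_finite_measure set T -> \bar R})
    (m2 : {sigma_finite_measure set (n.-tuple T) -> \bar R})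
    (g : n.+1.-tuple T -> \bar R) :
  measurable_fun setT g -> (forall x, 0 <= g x)%E ->
  (\int[tcons_measure m1 m2]_z g z =
   \int[m1]_x \int[m2]_t g (tcons (x, t)))%E.
Proof.
move=> mg g0; rewrite /tcons_measure.
rewrite (ge0_integral_pushforward (@measurable_tcons _ T n))//=.
rewrite preimage_setT (fubini_tonelli1 (g \o @tcons d T n))//.
  by apply: measurableT_comp => //; exact: measurable_tcons.
by move=> x; exact: g0.
Qed.

Lemma integral_tuple0 (mu : 'I_0 -> {sigma_finite_measure set T -> \bar R})
    (g : 0.-tuple T -> \bar R) : (forall x, 0 <= g x)%E ->
  (\int[prod_measure mu]_z g z = g [tuple])%E.
Proof.
move=> g0; rewrite (_ : g = cst (g [tuple])); last first.
  by apply/funext => t; rewrite (tuple0 t).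
rewrite /= integral_dirac//.
by rewrite diracT mul1e.
Qed.

Lemma measurable_prodr d1 (T1 : measurableType d1) (I : Type) (s : seq I)
    (f : I -> T1 -> R) : (forall i, measurable_fun setT (f i)) ->
  measurable_fun setT (fun x => \prod_(i <- s) f i x).
Proof.
move=> mf; elim: s => [|i s IHs].
  by under eq_fun do rewrite big_nil; exact: measurable_cst.
by under eq_fun do rewrite big_cons; exact: measurable_funM.
Qed.

Lemma measurable_sumr d1 (T1 : measurableType d1) (I : Type) (s : seq I)
    (f : I -> T1 -> R) : (forall i, measurable_fun setT (f i)) ->
  measurable_fun setT (fun x => \sum_(i <- s) f i x).
Proof.
move=> mf; elim: s => [|i s IHs].
  by under eq_fun do rewrite big_nil; exact: measurable_cst.
by under eq_fun do rewrite big_cons; exact: measurable_funD.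
Qed.

End product_integrals.

Section transports_prod.
Context d d' (T : measurableType d) (T' : measurableType d') (R : realType).

Lemma measurable_mapt n (h : 'I_n -> T -> T') :
  (forall i, measurable_fun setT (h i)) ->
  measurable_fun setT (fun t : n.-tuple T => [tuple h i (tnth t i) | i < n]).
Proof.
move=> mh; apply/measurable_fun_tnthP => i.
rewrite (_ : _ \o _ = h i \o (@tnth _ T ^~ i)); last first.
  by apply/funext => t /=; rewrite tnth_mktuple.
by apply: measurableT_comp => //; exact: measurable_tnth.
Qed.

Lemma transports_prod n (mu : 'I_n -> {sigma_finite_measure set T -> \bar R})
    (nu : 'I_n -> {sigma_finite_measure set T' -> \bar R})
    (h : 'I_n -> T -> T') (f : 'I_n -> T -> R) :
  (forall i, measurable_fun setT (h i)) ->
  (forall i, measurable_fun setT (f i)) -> (forall i x, 0 <= f i x) ->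
  (forall i, transports (mu i) (nu i) (h i) (f i)) ->
  transports (prod_measure mu) (prod_measure nu)
    (fun t => [tuple h i (tnth t i) | i < n])
    (fun t => \prod_(i < n) f i (tnth t i)).
Proof.
elim: n mu nu h f => [|n IHn] mu nu h f mh mf f0 munu g mg g0.
  rewrite !integral_tuple0//; first last.
    by move=> t; rewrite mule_ge0// lee_fin big_ord0.
  by rewrite big_ord0 mule1; congr g; rewrite [RHS]tuple0.
have mF : measurable_fun setT (fun t : n.+1.-tuple T =>
    \prod_(i < n.+1) f i (tnth t i)).
  by apply: measurable_prodr => i; apply: measurableT_comp => //;
    exact: measurable_tnth.
have F0 t : 0 <= \prod_(i < n.+1) f i (tnth t i) by apply: prodr_ge0.
have mgh : measurable_fun setT (fun t : n.+1.-tuple T =>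
    g [tuple h i (tnth t i) | i < n.+1] *
    (\prod_(i < n.+1) f i (tnth t i))%:E)%E.
  apply: emeasurable_funM; last exact/measurable_EFinP.
  by apply: measurableT_comp => //; exact: measurable_mapt.
rewrite !integral_tcons//; last by move=> t; rewrite mule_ge0// lee_fin.
pose f' i := f (lift ord0 i); pose h' i := h (lift ord0 i).
have mg' x : measurable_fun setT (fun t => g (tcons (x, t))).
  apply: (measurableT_comp mg); apply: (measurableT_comp (@measurable_tcons _ T' n)).
  exact: pair1_measurable.
rewrite (munu ord0); last by move=> x; apply: integral_ge0 => t _; exact: g0.
  apply: eq_integral => x _.
  have IH := IHn (fun i => mu (lift ord0 i)) (fun i => nu (lift ord0 i)) h' f'
    (fun i => mh _) (fun i => mf _) (fun i => f0 _) (fun i => munu _).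
  rewrite IH//.
  rewrite -ge0_integralZr//; first last.
  - by rewrite lee_fin.
  - move=> t _; rewrite mule_ge0// lee_fin.
    by apply: prodr_ge0 => i _; exact: f0.
  - apply: emeasurable_funM.
      apply: (measurableT_comp (mg' (h ord0 x))); apply: measurable_mapt => i.
      exact: mh.
    apply/measurable_EFinP; apply: measurable_prodr => i.
    by apply: measurableT_comp; [exact: mf|exact: measurable_tnth].
  apply: eq_integral => t _; rewrite big_ord_recl tnth_tcons0 mulrC EFinM muleA.
  congr (_ * _ * _)%E.
    congr g; apply/eq_from_tnth => i; rewrite tnth_mktuple.
    case: (unliftP ord0 i) => [j|] ->; first by rewrite !tnth_tconsS tnth_mktuple.
    by rewrite !tnth_tcons0.
  by congr EFin; apply: eq_bigr => i _; rewrite tnth_tconsS.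
apply: (measurable_fun_fubini_tonelli_F
  (m2 := prod_measure (fun i => nu (lift ord0 i))) (g \o @tcons _ T' n)) => //.
  by apply: measurableT_comp => //; exact: measurable_tcons.
by move=> x; exact: g0.
Qed.

End transports_prod.

Section transports_sets.
Context d d' (T : measurableType d) (T' : measurableType d') (R : realType).
Import HBNNSimple.

(** Sets suffice: a nonnegative measurable function is the limit of an
    increasing sequence of simple functions, and both sides respect such
    limits. *)
Lemma transports_sets (mu : {measure set T -> \bar R})
    (nu : {measure set T' -> \bar R}) (h : T -> T') (f : T -> R) :
  measurable_fun setT h -> measurable_fun setT f -> (forall x, 0 <= f x) ->
  (forall A, measurable A -> nu A = \int[mu]_x (\1_A (h x) * f x)%:E)%E ->
  transports mu nu h f.
Proof.
move=> mh mf f0 nuE g mg g0.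
pose g_ := nnsfun_approx measurableT mg.
have gE y : g y = limn (fun n => (g_ n y)%:E).
  by apply/esym/cvg_lim => //; exact: cvg_nnsfun_approx.
have nd_g y : {homo (fun n => (g_ n y)%:E) : m n / (m <= n)%N >-> (m <= n)%E}.
  by move=> m n mn; rewrite lee_fin; exact/lefP/nd_nnsfun_approx.
have mgh n : measurable_fun setT (fun x => (g_ n (h x) * f x)%:E).
  apply/measurable_EFinP/measurable_funM => //.
  by apply: measurableT_comp.
under eq_integral do rewrite gE.
rewrite monotone_convergence//; last 2 first.
- by move=> n; exact/measurable_EFinP.
- by move=> n y _; rewrite lee_fin.
rewrite [RHS](_ : _ = (\int[mu]_x limn (fun n => (g_ n (h x) * f x)%:E))%E);
    last first.
  apply: eq_integral => x _; apply/esym/cvg_lim => //.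
  under eq_fun do rewrite EFinM.
  by apply: cvgeZr => //; exact: cvg_nnsfun_approx.
rewrite monotone_convergence//; first last.
- move=> x _ m n mn; rewrite lee_fin ler_wpM2r// -lee_fin; exact: nd_g.
- by move=> n x _; rewrite lee_fin mulr_ge0.
congr (limn _); apply/funext => n.
have indic0 r y : 0 <= r * \1_(g_ n @^-1` [set r]) y.
  by rewrite -lee_fin nnfun_muleindic_ge0.
have mind r : measurable_fun setT (fun y => r * \1_(g_ n @^-1` [set r]) y).
  exact: measurable_funM.
transitivity (\int[nu]_y \sum_(r \in range (g_ n))
    (r * \1_(g_ n @^-1` [set r]) y)%:E)%E.
  by apply: eq_integral => y _; rewrite fimfunE fsumEFin.
rewrite ge0_integral_fsum//; last first.
- by move=> r y _; rewrite lee_fin.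
- by move=> r; exact/measurable_EFinP.
transitivity (\int[mu]_x \sum_(r \in range (g_ n))
    (r * \1_(g_ n @^-1` [set r]) (h x) * f x)%:E)%E; last first.
  apply: eq_integral => x _; rewrite [in RHS]fimfunE fsumEFin//; congr EFin.
  by rewrite mulr_fsuml.
rewrite ge0_integral_fsum//; last first.
- by move=> r x _; rewrite lee_fin mulr_ge0.
- move=> r; apply/measurable_EFinP/measurable_funM => //.
  by apply: (measurableT_comp (mind r)).
apply: eq_fsbigr => r /[!inE] -[y _ gnr].
have r0 : 0 <= r by rewrite -gnr.
have mA : measurable (g_ n @^-1` [set r]).
  by rewrite -[X in measurable X]setTI; exact: (measurable_funP (g_ n)).
under eq_integral do rewrite EFinM.
under [RHS]eq_integral do rewrite -mulrA EFinM.
rewrite (@ge0_integralZl_EFin _ _ _ nu)//; last exact/measurable_EFinP.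
rewrite (@ge0_integralZl_EFin _ _ _ mu)//; last 2 first.
- by move=> x _; rewrite lee_fin mulr_ge0.
- apply/measurable_EFinP/measurable_funM => //; exact: measurableT_comp.
by rewrite integral_indic// setIT nuE.
Qed.

Lemma transports_pushforward (mu : {measure set T -> \bar R})
    (nu : {measure set T' -> \bar R}) (h : T -> T') :
  measurable_fun setT h -> (forall A, measurable A -> nu A = mu (h @^-1` A)) ->
  transports mu nu h (fun _ => 1).
Proof.
move=> mh nuE; apply: transports_sets => // A mA.
have mhA : measurable (h @^-1` A) by rewrite -[X in measurable X]setTI; exact: mh.
under eq_integral do rewrite mulr1.
rewrite nuE// -[in LHS](setIT (h @^-1` A)) -integral_indic//.
Qed.

End transports_sets.

Lemma transports_sub d d' (T : measurableType d) (T' : measurableType d')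
    (R : realType) (mu : {measure set T -> \bar R})
    (nu : {measure set T' -> \bar R}) h f :
  transports mu nu h f -> forall A, measurable A ->
  nu A = (\int[mu]_x (\1_A (h x) * f x)%:E)%E.
Proof.
move=> muh A mA; rewrite -[in LHS](setIT A) -integral_indic//.
rewrite (muh (EFin \o \1_A))//; last by move=> x; rewrite /= lee_fin.
exact/measurable_EFinP.
Qed.

(** * Translations and reflections of Lebesgue measure *)

Section lebesgue_affine.
Variable R : realType.
Local Notation leb := (@lebesgue_measure R).
Implicit Types c x : R.

Lemma measurable_shift c : measurable_fun [set: R] (fun x : R => x + c).
Proof. exact: measurable_funD. Qed.

Lemma lebesgue_shift c : transports leb leb (fun x => x + c) (fun _ => 1).
Proof.
have ms : measurable_fun [set: measurableTypeR R]
  (fun x => x + c : measurableTypeR R) := measurable_shift c.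
apply: transports_pushforward => // A mA.
pose m := measure_function_pushforward__canonical__measure_function_Measure leb ms.
apply: (@lebesgue_measure_unique R m) => //= _ [[a b]] _ <-.
rewrite /pushforward (_ : _ @^-1` _ = `]a - c, b - c]%classic); last first.
  by apply/seteqP; split => x /=; rewrite !in_itv/= ltrBlDr lerBrDr.
rewrite !lebesgue_measure_itv/= !lte_fin ltrBlDr subrK.
by case: ifPn => // _; rewrite -!EFinB; congr EFin; ring.
Qed.

Lemma lebesgue_opp : transports leb leb (fun x => - x) (fun _ => 1).
Proof.
apply: transports_pushforward => [|A mA]; first exact: measurableT_comp.
by rewrite -[LHS]lebesgue_measureN.
Qed.

End lebesgue_affine.

(** * The standard normal distribution function *)

Section real_calculus.
Variable R : realType.
Implicit Types (f df : R -> R) (a b : R).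

Lemma mean_value f df a b : a <= b ->
  (forall x, a <= x <= b -> is_derive x 1 f (df x)) ->
  exists2 c, a <= c <= b & f b - f a = df c * (b - a).
Proof.
move=> ab fdf.
have [||c cab ->] := @MVT_segment R f df a b ab.
- by move=> x /[!in_itv]/= /andP[ax xb]; apply: fdf; rewrite !ltW.
- apply: derivable_within_continuous => x /[!in_itv]/= xab.
  by have := fdf x xab; case.
by exists c => //; move: cab; rewrite in_itv.
Qed.

End real_calculus.

Section normal_cdf_theory.
Variable R : realType.
Local Notation leb := (@lebesgue_measure R).
Local Notation phi := (@normal_pdf R 0 1).
Local Notation Phi := (@normal_cdf R).
Implicit Types x y t u : R.

Lemma normal_pdf01E x : phi x = normal_peak 1 * expR (- (x ^+ 2 / 2)).
Proof.
rewrite normal_pdfE ?oner_eq0// /normal_fun subr0 expr1n; congr (_ * expR _).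
by rewrite mulNr.
Qed.

Lemma normal_pdf01_gt0 x : 0 < phi x.
Proof. by rewrite normal_pdf01E mulr_gt0 ?expR_gt0// normal_peak_gt0 ?oner_eq0. Qed.

Lemma normal_pdf01N x : phi (- x) = phi x.
Proof. by rewrite !normal_pdf01E sqrrN. Qed.

Lemma normal_pdf_center (m x : R) : normal_pdf m 1 x = phi (x - m).
Proof. by rewrite !normal_pdfE ?oner_eq0// /normal_fun subr0. Qed.

Lemma is_derive_normal_pdf01 x : is_derive x 1 phi (- x * phi x).
Proof.
rewrite (_ : phi = fun x => normal_peak 1 * expR (- (x ^+ 2 / 2))); last first.
  by apply/funext => y; exact: normal_pdf01E.
have d2 : is_derive x 1 (fun y : R => - (y ^+ 2 / 2)) (- x).
  by apply: is_derive_eq; rewrite /GRing.scale/=; lra.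
apply: is_derive_eq; rewrite /GRing.scale/=.
ring.
Qed.

Lemma normal_cdfE t : (Phi t)%:E = normal_prob 0 1 `]-oo, t].
Proof. by rewrite fineK// fin_num_measure. Qed.

Lemma is_derive_normal_cdf t : is_derive t 1 Phi (phi t).
Proof.
have [||||dF F'] := @continuous_FTC1 R phi (BInfty R true) t (t + 1).
- by rewrite ltrDl.
- apply: (integrableS measurableT) => //; exact: integrable_normal_pdf.
- by rewrite ltNyr.
- exact: continuous_normal_pdf (oner_neq0 R) t.
have -> : Phi = fun x => \int[leb]_(t in [set` `]-oo, x]]) phi t.
  by apply/funext => x; rewrite /normal_cdf /normal_prob /Rintegral.
apply: DeriveDef; first exact: dF.
by rewrite -F' derive1E.
Qed.

Lemma normal_cdf_ge0 t : 0 <= Phi t.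
Proof. by rewrite -lee_fin normal_cdfE. Qed.

Lemma normal_cdf_le1 t : Phi t <= 1.
Proof. by rewrite -lee_fin normal_cdfE probability_le1. Qed.

Lemma normal_cdf_incr : {mono Phi : x y / x <= y}.
Proof.
apply: le_mono => x y xy.
have [z _] := mean_value (ltW xy) (fun x _ => is_derive_normal_cdf x).
move=> e; rewrite -subr_gt0 e mulr_gt0 ?normal_pdf01_gt0// subr_gt0//.
Qed.

Lemma normal_cdf_lt : {mono Phi : x y / x < y}.
Proof. exact: leW_mono normal_cdf_incr. Qed.

Lemma normal_cdf_gt0 t : 0 < Phi t.
Proof.
by rewrite (le_lt_trans (normal_cdf_ge0 (t - 1)))// normal_cdf_lt ltrBlDr ltrDl.
Qed.

Lemma normal_cdf_lt1 t : Phi t < 1.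
Proof.
by rewrite (lt_le_trans _ (normal_cdf_le1 (t + 1)))// normal_cdf_lt ltrDl.
Qed.

Let idR : measurableTypeR R -> R := idfun.

Let measurable_idR : measurable_fun setT idR.
Proof. exact: measurable_id. Qed.

Let idX : {RV (normal_prob 0 1 : probability (measurableTypeR R) R) >-> R} :=
  mfun_Sub (mem_set measurable_idR).

Lemma cvg_normal_cdf_y : Phi t @[t --> +oo] --> (1 : R).
Proof. by apply/fine_cvg; exact: (cvg_cdfy1 idX). Qed.

Lemma cvg_normal_cdf_Ny : Phi t @[t --> -oo] --> (0 : R).
Proof. by apply/fine_cvg; exact: (cvg_cdfNy0 idX). Qed.

Lemma continuous_normal_cdf : continuous Phi.
Proof.
move=> x; apply/differentiable_continuous/derivable1_diffP.
by case: (is_derive_normal_cdf x).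
Qed.

Lemma normal_cdfN t : Phi (- t) = 1 - Phi t.
Proof.
pose s x := Phi x + Phi (- x).
have dPhiN x : is_derive x 1 (Phi \o -%R) (- phi x).
  have := is_derive1_comp (is_derive_normal_cdf (- x)) (is_deriveNid x 1).
  by rewrite normal_pdf01N mulrN1.
have ds x : is_derive x 1 s 0.
  rewrite (_ : s = Phi + (Phi \o -%R))// -[0](subrr (phi x)).
  by apply: is_deriveD; exact: is_derive_normal_cdf.
have sE x : s x = s t.
  wlog xt : x / x <= t => [hw|].
    case: (leP x t) => [/hw//|/ltW tx].
    by have [c _] := mean_value tx (fun x _ => ds x); rewrite mul0r => /eqP; rewrite subr_eq0 => /eqP.
  by have [c _] := mean_value xt (fun x _ => ds x); rewrite mul0r => /eqP; rewrite subr_eq0 => /eqP.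
have s1 : s x @[x --> +oo] --> (1 : R).
  rewrite -[1]addr0; apply: cvgD; first exact: cvg_normal_cdf_y.
  by have := cvg_normal_cdf_Ny; rewrite cvgNy_compNP.
have st : s x @[x --> +oo] --> (s t : R).
  rewrite (_ : s = cst (s t)); first exact: cvg_cst.
  by apply/funext => x; rewrite sE.
have : s t = 1 by apply: (cvg_unique _ st s1).
by rewrite /s => <-; rewrite addrC addKr.
Qed.

Lemma normal_cdf_large u t : u < 1 -> exists2 s, t <= s & u < Phi s.
Proof.
move=> u1; near (pinfty_nbhs R) => s; exists s; near: s.
  by apply: nbhs_pinfty_ge; exact: num_real.
exact: (cvgr_gt _ cvg_normal_cdf_y).
Unshelve. all: by end_near. Qed.

(** The rational bound makes the derivative of the difference of the two sides
    equal to [- 2 * phi t / (t + 1) ^+ 3], so that the difference decreases to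
    its limit, which is zero. *)
Lemma normal_mills t : 0 <= t -> Phi (- t) <= phi t * ((t + 2) / (t + 1) ^+ 2).
Proof.
move=> t0; pose D x := phi x * ((x + 2) / (x + 1) ^+ 2) - (1 - Phi x).
have dD x : 0 <= x -> is_derive x 1 D (- 2 * phi x / (x + 1) ^+ 3).
  move=> x0; have x1 : x + 1 != 0 by rewrite gt_eqF// ltr_wpDl.
  have x2 : (x + 1) ^+ 2 != 0 by rewrite expf_neq0.
  have dp := is_derive_normal_pdf01 x; have dP := is_derive_normal_cdf x.
  apply: is_derive_eq; rewrite /GRing.scale/=.
  by field.
rewrite normal_cdfN -subr_ge0.
have Dge x : t <= x -> - (1 - Phi x) <= D t.
  move=> tx; have [c /andP[tc _] e] := mean_value tx
    (fun y ty => dD y (le_trans t0 (proj1 (andP ty)))).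
  have c0 := le_trans t0 tc; have x0 := le_trans t0 tx.
  rewrite (@le_trans _ _ (D x))//; last first.
    rewrite -subr_le0 e !mulNr oppr_le0 mulr_ge0// ?subr_ge0//.
    by rewrite divr_ge0 ?exprn_ge0 ?addr_ge0// mulr_ge0 ?normal_pdf_ge0.
  by rewrite lerDr mulr_ge0 ?normal_pdf_ge0// divr_ge0 ?exprn_ge0 ?addr_ge0.
apply/ler_addgt0Pr => e e0.
have [x tx ex] := @normal_cdf_large (1 - e) t (ltac:(by rewrite ltrBlDr ltrDl)).
have := Dge x tx; rewrite /D; lra.
Qed.

Lemma normal_pdf_cdf_ge0 x : 0 <= phi x + x * Phi x.
Proof.
have [x0|/ltW x0] := leP 0 x.
  by rewrite addr_ge0 ?normal_pdf_ge0// mulr_ge0// normal_cdf_ge0.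
have t0 : 0 <= - x by rewrite oppr_ge0.
have := normal_mills t0; rewrite opprK normal_pdf01N; move: t0.
set t := - x => t0; rewrite -[x]opprK -/t => /(ler_wpM2l t0) h.
rewrite mulNr subr_ge0 (le_trans h)// mulrCA ler_piMr ?normal_pdf_ge0//.
by rewrite mulrA ler_pdivrMr ?exprn_gt0 ?ltr_wpDl//; nra.
Qed.

(** The inverse Mills ratio: the mean of [Z - x] for [Z] distributed as
    [N(x, 1)] conditioned to be positive. *)
Definition inv_mills x := phi x / Phi x.

Lemma is_derive_inv_mills x :
  is_derive x 1 inv_mills (- (inv_mills x * (inv_mills x + x))).
Proof.
have P0 : Phi x != 0 by rewrite gt_eqF// normal_cdf_gt0.
have dp := is_derive_normal_pdf01 x; have dP := is_derive_normal_cdf x.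
rewrite /inv_mills.
by apply: is_derive_eq; rewrite /GRing.scale/=; field.
Qed.

Lemma inv_mills_ge0 x : 0 <= inv_mills x.
Proof. by rewrite divr_ge0 ?normal_pdf_ge0 ?normal_cdf_ge0. Qed.

Lemma inv_millsD_ge0 x : 0 <= inv_mills x + x.
Proof.
have P0 := normal_cdf_gt0 x.
rewrite -(pmulr_lge0 _ P0) mulrDl divfK ?gt_eqF//.
exact: normal_pdf_cdf_ge0.
Qed.

Lemma inv_mills_nincr x y : x <= y -> inv_mills y <= inv_mills x.
Proof.
move=> xy; have [c _ e] := mean_value xy (fun z _ => is_derive_inv_mills z).
rewrite -subr_le0 e mulNr oppr_le0 mulr_ge0 ?subr_ge0//.
by rewrite mulr_ge0 ?inv_mills_ge0 ?inv_millsD_ge0.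
Qed.

(** The derivative of [inv_mills] at [x <= 0] is minus one plus the variance of
    the normal law truncated to the half-line that it disfavours; this variance
    stays below [3 / 4], uniformly in [x]. *)
Lemma inv_mills_steep x y : x <= y -> y <= 0 ->
  (y - x) / 4 <= inv_mills x - inv_mills y.
Proof.
move=> xy y0; have [c cxy e] := mean_value xy (fun z _ => is_derive_inv_mills z).
have c0 : c <= 0 by rewrite (le_trans _ y0)//; case/andP: cxy.
rewrite -[leRHS]opprB e mulNr opprK mulrC ler_wpM2r ?subr_ge0//.
pose t := - c; have t0 : 0 <= t by rewrite oppr_ge0.
have P0 := normal_cdf_gt0 c.
have := normal_mills t0; rewrite opprK normal_pdf01N => h.
have m : (t + 1) ^+ 2 / (t + 2) <= inv_mills c.
  rewrite ler_pdivlMr//; apply: le_trans (ler_wpM2l _ h) _.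
    by rewrite divr_ge0 ?exprn_ge0 ?addr_ge0.
  rewrite mulrCA -/t (_ : _ / _ * _ = 1) ?mulr1 /t ?normal_pdf01N//.
  by field; rewrite !gt_eqF// ltr_wpDl.
have tc : (t + 2)^-1 <= inv_mills c + c.
  apply: le_trans (lerD m (lexx c)); rewrite -[c]opprK -/t.
  by rewrite le_eqVlt; apply/orP; left; apply/eqP; field; rewrite gt_eqF// ltr_wpDl.
apply: le_trans (ler_pM _ _ m tc); rewrite ?divr_ge0 ?invr_ge0 ?exprn_ge0 ?addr_ge0//.
rewrite -mulrA -invfM -expr2 ler_pdivlMr ?exprn_gt0 ?ltr_wpDl//.
by have := t0; nra.
Qed.

(** Log-concavity of the distribution function. *)
Lemma normal_cdf_ratio a b d : a <= b -> 0 <= d ->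
  Phi a * Phi (b + d) <= Phi (a + d) * Phi b.
Proof.
move=> ab d0; have P0 := normal_cdf_gt0.
pose q x := Phi (a + x) / Phi (b + x).
have ds c x : is_derive x 1 (fun x => Phi (c + x)) (phi (c + x)).
  have dc : is_derive x 1 (fun x => c + x) (1 : R).
    by apply: is_derive_eq; rewrite add0r mulr1.
  have := is_derive1_comp (is_derive_normal_cdf (c + x)) dc.
  by rewrite mulr1.
have dq x : is_derive x 1 q
    (Phi (a + x) / Phi (b + x) * (inv_mills (a + x) - inv_mills (b + x))).
  have da := ds a x; have db := ds b x; have Px : Phi (b + x) != 0 by rewrite gt_eqF.
  apply: is_derive_eq; rewrite /GRing.scale/= /inv_mills.
  by field; rewrite !gt_eqF.
have [c _] := mean_value d0 (fun x _ => dq x).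
rewrite subr0 => e.
have : q 0 <= q d.
  rewrite -subr_ge0 e !mulr_ge0 ?invr_ge0 ?normal_cdf_ge0// subr_ge0.
  by apply: inv_mills_nincr; rewrite lerD2r.
by rewrite /q !addr0 ler_pdivrMr// mulrAC ler_pdivlMr.
Qed.

(** * The normal quantile function *)

Definition normal_quantile u := xget 0 [set x | Phi x = u].
Local Notation Qf := normal_quantile.

Lemma normal_quantileK u : 0 < u < 1 -> Phi (Qf u) = u.
Proof.
move=> /andP[u0 u1]; rewrite /Qf; case: xgetP => [y _ //|H]; exfalso.
have [b _ ub] := normal_cdf_large 0 u1.
have [a ba ua] : exists2 a, - b <= a & 1 - u < Phi a.
  by apply: normal_cdf_large; rewrite ltrBlDr ltrDl.
have ab : - a <= b by rewrite lerNl.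
have aU : Phi (- a) < u by rewrite normal_cdfN ltrBlDr addrC -ltrBlDr.
have [||x _ /H//] := @IVT R Phi (- a) b u ab.
  by apply: continuous_subspaceT; exact: continuous_normal_cdf.
by rewrite ge_min le_max (ltW aU) (ltW ub) orbT.
Qed.

Lemma measurable_normal_cdf : measurable_fun [set: R] Phi.
Proof. by apply: continuous_measurable_fun; exact: continuous_normal_cdf. Qed.

Lemma measurable_normal_quantile : measurable_fun [set: R] Qf.
Proof.
apply: (measurability (@RGenInftyO.G R)); first exact: RGenInftyO.measurableE.
move=> /= _ [_] [z] -> <-; rewrite setTI.
have -> : Qf @^-1` `]-oo, z[ = (`]0, Phi z[%classic : set R) `|`
    (if 0 < z then ~` `]0, 1[ else set0).
  apply/seteqP; split => u; rewrite /= !in_itv/=.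
    have [u01|u01] := boolP (0 < u < 1).
      rewrite -normal_cdf_lt normal_quantileK// => uz; left.
      by rewrite uz andbT; case/andP: u01.
    rewrite /Qf; case: xgetP => [y _ /= e|_ z0]; last first.
      by right; rewrite z0 /= in_itv/=; apply/negP.
    by move: u01; rewrite -e normal_cdf_gt0 normal_cdf_lt1.
  move=> [/andP[u0 uz]|].
    rewrite -normal_cdf_lt normal_quantileK// u0/= (lt_le_trans uz)//.
    exact: normal_cdf_le1.
  case: ifPn => // z0 /=; rewrite in_itv/= => u01.
  rewrite /Qf; case: xgetP => // y _ /= e; exfalso; apply: u01.
  by rewrite -e normal_cdf_gt0 normal_cdf_lt1.
apply: measurableU => //; case: ifPn => // _; exact: measurableC.
Qed.

End normal_cdf_theory.

(** * A monotone coupling of truncated normal laws *)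

Section truncated_normal.
Variable R : realType.
Local Notation leb := (@lebesgue_measure R).
Local Notation phi := (@normal_pdf R 0 1).
Local Notation Phi := (@normal_cdf R).
Local Notation N01 := (normal_prob (0 : R) 1).
Local Notation Qf := (@normal_quantile R).
Implicit Types (m x c : R) (a : bool).

Lemma integral_indicE d (T : measurableType d) (mu : {measure set T -> \bar R})
    (A : set T) (f : T -> R) :
  (\int[mu]_(x in A) (f x)%:E = \int[mu]_x (\1_A x * f x)%:E)%E.
Proof.
rewrite integral_mkcond; apply: eq_integral => x _.
by rewrite patchE indicE; case: (x \in A); rewrite ?mul1r ?mul0r.
Qed.

Lemma normal_prob_density m :
  transports leb (normal_prob m 1) idfun (fun x => phi (x - m)).
Proof.
have mp : measurable_fun [set: R] (fun x => phi (x - m)).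
  by apply: measurableT_comp; [exact: measurable_normal_pdf|exact: measurable_funB].
apply: transports_sets => [||x|A mA]; first exact: measurable_id.
- exact: mp.
- exact: normal_pdf_ge0.
rewrite /= /normal_prob integral_indicE.
by under eq_integral do rewrite normal_pdf_center.
Qed.

Lemma normal_prob_shift m (A : set R) : measurable A ->
  normal_prob m 1 A = N01 [set x | A (x + m)].
Proof.
move=> mA; have mAm : measurable [set x | A (x + m)].
  by rewrite -[X in measurable X]setTI; exact: measurable_shift.
have mp : measurable_fun [set: R] (fun x => phi (x - m)).
  by apply: measurableT_comp; [exact: measurable_normal_pdf|exact: measurable_funB].
rewrite (transports_sub (normal_prob_density m) mA)/=.
rewrite (transports_sub (normal_prob_density 0) mAm)/=.
rewrite (lebesgue_shift m); first last.
- by move=> x; rewrite lee_fin mulr_ge0 ?normal_pdf_ge0.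
- by apply/measurable_EFinP; exact: measurable_funM.
apply: eq_integral => x _; rewrite mule1 addrK subr0; congr (_ * _)%:E.
Qed.

Lemma normal_prob_opp m (A : set R) : measurable A ->
  normal_prob m 1 A = normal_prob (- m) 1 [set x | A (- x)].
Proof.
move=> mA; have mAm : measurable [set x | A (- x)].
  by rewrite -[X in measurable X]setTI; exact: measurableT_comp.
have mp : measurable_fun [set: R] (fun x => phi (x - m)).
  by apply: measurableT_comp; [exact: measurable_normal_pdf|exact: measurable_funB].
rewrite (transports_sub (normal_prob_density m) mA)/=.
rewrite (transports_sub (normal_prob_density (- m)) mAm)/=.
rewrite (@lebesgue_opp R); first last.
- by move=> x; rewrite lee_fin mulr_ge0 ?normal_pdf_ge0.
- by apply/measurable_EFinP; exact: measurable_funM.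
apply: eq_integral => x _.
by rewrite mule1 opprK -(normal_pdf01N (x + m)) opprD; congr (_ * _)%:E.
Qed.

Lemma normal_prob_gt m c : normal_prob m 1 `]c, +oo[ = (Phi (m - c))%:E.
Proof.
rewrite normal_prob_shift// (_ : [set x | _] = ~` `]-oo, c - m]); last first.
  by apply/seteqP; split => x /=; rewrite !in_itv/= andbT => xc;
    [apply/negP; rewrite -ltNge ltrBlDr|move/negP: xc; rewrite -ltNge ltrBlDr].
transitivity (1 - N01 `]-oo, (c - m)%R])%E; first exact: probability_setC.
rewrite -normal_cdfE -EFinB.
by rewrite -normal_cdfN opprB.
Qed.

Lemma normal_prob_lt m c : normal_prob m 1 `]-oo, c[ = (Phi (c - m))%:E.
Proof.
rewrite normal_prob_opp// (_ : [set x | _] = `]- c, +oo[%classic); last first.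
  by apply/seteqP; split => x /=; rewrite !in_itv/= andbT ltrNl.
by rewrite normal_prob_gt opprK addrC.
Qed.

Definition bsign a : R := if a then 1 else -1.

Lemma normal_prob_halfline m a :
  normal_prob m 1 [set` halfline R a] = (Phi (bsign a * m))%:E.
Proof.
case: a => /=; first by rewrite normal_prob_gt subr0 mul1r.
by rewrite normal_prob_lt sub0r mulN1r.
Qed.

Lemma trunc_normalE m a (A : set R) :
  trunc_normal m a A =
  (normal_prob m 1 (A `&` [set` halfline R a]) * ((Phi (bsign a * m))^-1)%:E)%E.
Proof.
rewrite /trunc_normal /mnormalize /= /mrestr setTI normal_prob_halfline.
by rewrite eqe gt_eqF ?normal_cdf_gt0.
Qed.

Lemma trunc_normal_density m a : transports leb (trunc_normal m a) idfun
  (fun x => \1_[set` halfline R a] x * phi (x - m) / Phi (bsign a * m)).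
Proof.
have mp : measurable_fun [set: R] (fun x => phi (x - m)).
  by apply: measurableT_comp; [exact: measurable_normal_pdf|exact: measurable_funB].
have mh : measurable [set` halfline R a] by [].
apply: transports_sets => [||x|A mA]; first exact: measurable_id.
- by apply: measurable_funM => //; exact: measurable_funM.
- by rewrite divr_ge0 ?normal_cdf_ge0// mulr_ge0 ?normal_pdf_ge0.
rewrite [LHS]trunc_normalE (transports_sub (normal_prob_density m))//; last first.
  exact: measurableI.
rewrite -ge0_integralZr//; first last.
- by rewrite lee_fin invr_ge0 normal_cdf_ge0.
- by move=> x _; rewrite lee_fin mulr_ge0 ?normal_pdf_ge0.
- apply/measurable_EFinP/measurable_funM => //; apply: measurable_indic.
  exact: measurableI.
apply: eq_integral => x _; rewrite -EFinM; congr EFin => /=.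
by rewrite indicI/= !mulrA.
Qed.

(** [normal_tail m] carries the standard normal law to its restriction to
    [x < m]; the same source variable serves every [m], which couples these
    restrictions monotonically. *)
Definition normal_tail m x := Qf (Phi x * Phi m).
Local Notation g := normal_tail.

Lemma normal_cdf_tail m x : Phi (g m x) = Phi x * Phi m.
Proof.
rewrite normal_quantileK// mulr_gt0 ?normal_cdf_gt0//=.
by rewrite mulr_ilt1 ?normal_cdf_ge0 ?normal_cdf_lt1.
Qed.

Lemma normal_tail_lt m x : g m x < m.
Proof.
rewrite -normal_cdf_lt normal_cdf_tail gtr_pMl ?normal_cdf_gt0//.
exact: normal_cdf_lt1.
Qed.

Lemma normal_tail_homo m' m x : m' <= m -> g m' x <= g m x.
Proof.
move=> mm; rewrite -normal_cdf_incr !normal_cdf_tail ler_wpM2l ?normal_cdf_ge0//.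
by rewrite normal_cdf_incr.
Qed.

(** In terms of distribution functions this compares the ratios of [Phi] at
    two points before and after a common shift, which is [normal_cdf_ratio]. *)
Lemma normal_tail_lip m' m x : m' <= m -> g m x - g m' x <= m - m'.
Proof.
move=> mm; rewrite lerBlDl -normal_cdf_incr normal_cdf_tail.
have := normal_cdf_ratio (ltW (normal_tail_lt m' x)) (_ : 0 <= m - m').
rewrite subr_ge0 => /(_ mm).
rewrite normal_cdf_tail [m' + _]addrC subrK mulrAC ler_pM2r ?normal_cdf_gt0//.
Qed.

Lemma measurable_normal_tail d (T : measurableType d) (f h : T -> R) :
  measurable_fun setT f -> measurable_fun setT h ->
  measurable_fun setT (fun t => g (f t) (h t)).
Proof.
move=> mf mh; apply: (measurableT_comp (@measurable_normal_quantile R)).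
by apply: measurable_funM; apply: (measurableT_comp (@measurable_normal_cdf R)).
Qed.

(** If [t] has law N(0, 1) restricted to [t < m], then [m - t] has law N(m, 1)
    restricted to the positive half-line; the case [a = false] is its mirror
    image ([trunc_mapN]). *)
Definition trunc_map m a x := m - bsign a * g (bsign a * m) x.

Lemma measurable_trunc_map d (T : measurableType d) (f h : T -> R) a :
  measurable_fun setT f -> measurable_fun setT h ->
  measurable_fun setT (fun t => trunc_map (f t) a (h t)).
Proof.
move=> mf mh; apply: measurable_funB => //; apply: measurable_funM => //.
by apply: measurable_normal_tail => //; exact: measurable_funM.
Qed.

Lemma trunc_mapN m x : trunc_map m false x = - trunc_map (- m) true x.
Proof. by rewrite /trunc_map /bsign !mulN1r !mul1r; ring. Qed.

Lemma trunc_normalN m (A : set R) : measurable A ->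
  trunc_normal m false A = trunc_normal (- m) true [set x | A (- x)].
Proof.
move=> mA; rewrite (trunc_normalE m false A) (trunc_normalE (- m) true [set x | A (- x)]) /bsign mulN1r mul1r; congr (_ * _)%E.
rewrite normal_prob_opp; last exact: measurableI.
congr (normal_prob _ _ _); apply/seteqP; split => x /=;
  by rewrite !in_itv/= andbT oppr_lt0.
Qed.

(** The two laws agree on the half-lines above [c], because [c < m - g m x]
    unfolds to an upper bound on [Phi x]. *)
Lemma trunc_normal_true_law m (A : set R) : measurable A ->
  trunc_normal m true A = N01 (trunc_map m true @^-1` A).
Proof.
have mT : measurable_fun [set: measurableTypeR R]
    (fun x => trunc_map m true x : measurableTypeR R).
  exact: measurable_trunc_map.
pose law := measure_function_pushforward__canonical__measure_function_Measure
  N01 mT.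
move=> mA; apply: (@measure_unique _ R (measurableTypeR R) (@RGenOInfty.G R)
  (fun k => `](- k%:R), +oo[%classic) _ _ _ _ (trunc_normal m true) law).
- exact: RGenOInfty.measurableE.
- move=> _ _ [x ->] [y ->]; exists (Num.max x y).
  by apply/seteqP; split => z /=; rewrite !in_itv/= !andbT gt_max => /andP.
- by move=> k; exists (1 *- k).
- apply/seteqP; split => // x _; exists (Num.truncn `|x|).+1 => //=.
  rewrite in_itv/= andbT ltrNl (le_lt_trans _ (truncnS_gt _))//.
  by rewrite -normrN ler_norm.
- move=> _ [c ->]; rewrite [LHS]trunc_normalE mul1r [RHS]/=.
  have [c0|c0] := leP c 0.
    rewrite setIidr; last first.
      by move=> x /=; rewrite !in_itv/= !andbT; exact: le_lt_trans.
    rewrite normal_prob_gt subr0 -EFinM divff ?gt_eqF ?normal_cdf_gt0//.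
    rewrite /pushforward (_ : _ @^-1` _ = setT) ?probability_setT//.
    apply/seteqP; split => // x _ /=; rewrite in_itv/= andbT (le_lt_trans c0)//.
    by rewrite /trunc_map !mul1r subr_gt0 normal_tail_lt.
  have r01 : 0 < Phi (m - c) / Phi m < 1.
    rewrite divr_gt0 ?normal_cdf_gt0// ltr_pdivrMr ?normal_cdf_gt0// mul1r.
    by rewrite normal_cdf_lt ltrBlDr ltrDl.
  rewrite setIidl; last first.
    by move=> x /=; rewrite !in_itv/= !andbT; exact: lt_trans.
  rewrite normal_prob_gt /pushforward.
  rewrite (_ : _ @^-1` _ = `]-oo, Qf (Phi (m - c) / Phi m)[%classic); last first.
    have E x : (c < m - g m x) = (x < Qf (Phi (m - c) / Phi m)).
      have -> : (c < m - g m x) = (g m x < m - c) by apply/idP/idP; lra.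
      rewrite -[LHS]normal_cdf_lt normal_cdf_tail.
      by rewrite -[RHS]normal_cdf_lt normal_quantileK// ltr_pdivlMr ?normal_cdf_gt0.
    by apply/seteqP; split => x /=; rewrite !in_itv/= andbT /trunc_map !mul1r E.
  by rewrite normal_prob_lt subr0 normal_quantileK// -EFinM.
- by move=> k; rewrite (le_lt_trans (probability_le1 _ _))// ltry.
- exact: mA.
Qed.

Lemma trunc_normal_law m a :
  transports N01 (trunc_normal m a) (trunc_map m a) (fun _ => 1).
Proof.
apply: transports_pushforward => [|A mA].
  exact: measurable_trunc_map.
case: a => [|]; first exact: trunc_normal_true_law.
rewrite [LHS]trunc_normalN// [LHS]trunc_normal_true_law; last first.
  by rewrite -[X in measurable X]setTI; exact: measurableT_comp.
congr (normal_prob _ _ _); apply/seteqP; split => x /=;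
  by rewrite trunc_mapN.
Qed.

Lemma cvg_normal_pdf_y m : phi (x - m) @[x --> +oo] --> (0 : R).
Proof.
pose C : R := normal_peak 1 * expR (2^-1 + m).
apply: (@squeeze_cvgr _ _ _ _ (cst 0) (fun x => C * expR (- x))).
- near=> x; rewrite normal_pdf_ge0/= normal_pdf01E /C -[leRHS]mulrA.
  rewrite ler_wpM2l ?normal_peak_ge0// -expRD ler_expR.
  by have := sqr_ge0 (x - m - 1); rewrite !expr2; lra.
- exact: cvg_cst.
- rewrite -[X in _ --> X](mulr0 C); apply: cvgMr; exact: cvgr_expR.
Unshelve. all: by end_near. Qed.

(** The distance from [m] of the truncated normal variable integrates exactly,
    because [x * phi x] is the derivative of [- phi]. *)
Lemma mean_normal_tail m : m <= 0 ->
  (\int[N01]_x (- g m x)%:E)%E = (inv_mills m)%:E.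
Proof.
move=> m0; have P0 := normal_cdf_gt0 m.
have mk : measurable_fun [set: R] (fun z : R => (`|z - m|)%:E).
  by apply/measurable_EFinP; apply: measurableT_comp => //; exact: measurable_funB.
have k0 x : (0 <= `|x - m|%:E)%E by rewrite lee_fin.
have := trunc_normal_law m true mk k0.
rewrite (trunc_normal_density m true mk k0).
rewrite [X in _ = X -> _](_ : _ = (\int[N01]_x (- g m x)%:E)%E); last first.
  apply: eq_integral => x _; rewrite mule1 /trunc_map !mul1r addrAC subrr add0r.
  by rewrite ger0_norm// oppr_ge0 ltW// (lt_le_trans (normal_tail_lt _ _)).
move=> <-.
have dF x : is_derive x 1 (fun x => - phi (x - m)) ((x - m) * phi (x - m)).
  have ds : is_derive x 1 (fun x => x - m) (1 : R).
    by apply: is_derive_eq; rewrite subr0.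
  have dc := @is_derive1_comp R phi (fun x => x - m) x _ _
    (is_derive_normal_pdf01 (x - m)) ds.
  have -> : (x - m) * phi (x - m) = - (- (x - m) * phi (x - m) * 1) by ring.
  exact: is_deriveN.
have cF : continuous (fun x => - phi (x - m)).
  move=> x; apply/differentiable_continuous/derivable1_diffP.
  by case: (dF x).
have cf : continuous (fun x => (x - m) * phi (x - m)).
  move=> x; apply: cvgM; first by apply: cvgB; [exact: cvg_id|exact: cvg_cst].
  apply: (@continuous_comp _ _ _ (fun x => x - m) phi).
    by apply: cvgB; [exact: cvg_id|exact: cvg_cst].
  exact: continuous_normal_pdf (oner_neq0 R) _.
have I : (\int[leb]_(x in `[0%R, +oo[) ((x - m) * phi (x - m))%:E = (phi m)%:E)%E.
  rewrite (@ge0_continuous_FTC2y R _ (fun x => - phi (x - m)) 0 0).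
  - by rewrite sub0r normal_pdf01N sub0e -EFinN opprK.
  - move=> x x0; rewrite mulr_ge0 ?normal_pdf_ge0// subr_ge0.
    exact: le_trans x0.
  - exact: continuous_subspaceT.
  - by rewrite -[X in _ --> X]oppr0; apply: cvgN; exact: cvg_normal_pdf_y.
  - by move=> x _; case: (dF x).
  - by apply: cvg_at_right_filter; exact: cF.
  - by move=> x _; rewrite derive1E; case: (dF x).
have mI : measurable_fun (`]0%R, +oo[%classic : set (measurableTypeR R)) (fun x => ((x - m) * phi (x - m))%:E).
  apply/measurable_EFinP/measurable_funTS; exact: continuous_measurable_fun.
rewrite -integral_itv_obnd_cbnd// in I.
rewrite /inv_mills EFinM -I muleC -ge0_integralZl_EFin//; last 2 first.
- move=> x; rewrite /= in_itv/= andbT => x0.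
  by rewrite lee_fin mulr_ge0 ?normal_pdf_ge0// subr_ge0 (le_trans m0)// ltW.
- by rewrite invr_ge0 ltW.
under [RHS]eq_integral do rewrite -EFinM.
rewrite [RHS]integral_indicE; apply: eq_integral => x _ /=.
rewrite -EFinM mul1r indicE mem_setE in_itv/= andbT.
case: ltP => [x0|_]; last by rewrite !mul0r mulr0.
rewrite ger0_norm; last by rewrite subr_ge0 (le_trans m0)// ltW.
by congr EFin; rewrite !mul1r; ring.
Qed.

Definition normal_gap m' m := fine (\int[N01]_x (g m x - g m' x)%:E)%E.

Lemma normal_gapE m' m : m' <= m ->
  (\int[N01]_x (g m x - g m' x)%:E)%E = (normal_gap m' m)%:E.
Proof.
move=> mm; rewrite fineK// ge0_fin_numE; last first.
  by apply: integral_ge0 => x _; rewrite lee_fin subr_ge0 normal_tail_homo.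
apply: (@le_lt_trans _ _ (\int[N01]_x (cst (m - m')%:E x)))%E.
  apply: ge0_le_integral => //.
  - by move=> x _; rewrite lee_fin subr_ge0 normal_tail_homo.
  - apply/measurable_EFinP/measurable_funB; exact: measurable_normal_tail.
  - by move=> x _; rewrite lee_fin normal_tail_lip.
by rewrite integral_cst//= probability_setT mule1 ltry.
Qed.

Lemma normal_gap_ge0 m' m : m' <= m -> 0 <= normal_gap m' m.
Proof.
move=> mm; rewrite -lee_fin -[leRHS](normal_gapE mm).
by apply: integral_ge0 => x _; rewrite lee_fin subr_ge0 normal_tail_homo.
Qed.

Lemma le_normal_gap (s t s' t' : R) : s <= t -> s' <= s -> t <= t' ->
  normal_gap s t <= normal_gap s' t'.
Proof.
move=> ab ca be; have ce := le_trans ca (le_trans ab be).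
rewrite -lee_fin -[leLHS](normal_gapE ab) -[leRHS](normal_gapE ce).
apply: ge0_le_integral => //.
- by move=> x _; rewrite lee_fin subr_ge0 normal_tail_homo.
- apply/measurable_EFinP/measurable_funB; exact: measurable_normal_tail.
- apply/measurable_EFinP/measurable_funB; exact: measurable_normal_tail.
- by move=> x _; rewrite lee_fin lerB ?normal_tail_homo.
Qed.

(** For a nonpositive [m] the expected increase is a difference of inverse
    Mills ratios, which is steep there. *)
Lemma normal_gap_le0 m' m : m' <= m -> m <= 0 ->
  (m - m') / 4 <= normal_gap m' m.
Proof.
move=> mm m0; have m'0 := le_trans mm m0.
have mg c : measurable_fun [set: R] (fun x => (- g c x)%:E).
  by apply/measurable_EFinP/measurableT_comp => //; exact: measurable_normal_tail.
have gN c x : c <= 0 -> 0 <= - g c x.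
  by move=> c0; rewrite oppr_ge0 ltW// (lt_le_trans (normal_tail_lt _ _)).
suff -> : normal_gap m' m = inv_mills m' - inv_mills m by exact: inv_mills_steep.
apply/eqP; rewrite eq_sym subr_eq; apply/eqP/EFin_inj.
rewrite EFinD -[X in (X + _)%E](normal_gapE mm) -[X in (_ + X)%E](mean_normal_tail m0).
rewrite -[LHS](mean_normal_tail m'0) -ge0_integralD//; first last.
- exact: mg.
- by move=> x _; rewrite lee_fin gN.
- apply/measurable_EFinP/measurable_funB; exact: measurable_normal_tail.
- by move=> x _; rewrite lee_fin subr_ge0 normal_tail_homo.
by apply: eq_integral => x _; rewrite -EFinD; congr EFin; ring.
Qed.

Definition trunc_slope m m' a x :=
  (trunc_map m a x - trunc_map m' a x) / (m - m').

Lemma trunc_slopeE m m' a x :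
  trunc_map m a x - trunc_map m' a x = trunc_slope m m' a x * (m - m').
Proof.
have [->|mm'] := eqVneq m m'; first by rewrite !subrr mulr0.
by rewrite divfK// subr_eq0.
Qed.

Lemma trunc_slopeC m m' a x : trunc_slope m m' a x = trunc_slope m' m a x.
Proof. by rewrite /trunc_slope -(opprB m') invrN mulrN -mulNr opprB. Qed.

Lemma trunc_slope_gap m m' a x : m' < m -> trunc_slope m m' a x =
  1 - (if a then g m x - g m' x else g (- m') x - g (- m) x) / (m - m').
Proof.
move=> mm; have d0 : m - m' != 0 by rewrite subr_eq0 gt_eqF.
rewrite /trunc_slope /trunc_map /bsign; case: a; first by rewrite !mul1r; field.
by rewrite !mulN1r; field.
Qed.

Lemma trunc_slope01 m m' a x : 0 <= trunc_slope m m' a x <= 1.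
Proof.
wlog mm : m m' / m' < m => [hw|].
  have [/hw//|/hw|->] := ltgtP m' m; first by rewrite trunc_slopeC.
  by rewrite /trunc_slope !subrr mul0r lexx ler01.
have d0 : 0 < m - m' by rewrite subr_gt0.
rewrite trunc_slope_gap// subr_ge0 ler_pdivrMr// mul1r lerBlDr lerDl.
rewrite divr_ge0 ?(ltW d0)//; last first.
  by case: a; rewrite subr_ge0 normal_tail_homo// ?lerN2 ltW.
rewrite andbT; case: a; first by rewrite normal_tail_lip// ltW.
by apply: le_trans (normal_tail_lip _ _) _; rewrite ?lerN2 ?(ltW mm)//; lra.
Qed.

Lemma measurable_trunc_slope m m' a :
  measurable_fun [set: R] (trunc_slope m m' a).
Proof.
apply: measurable_funM => //.
by apply: measurable_funB; exact: measurable_trunc_map.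
Qed.

Definition mean_slope m m' a := fine (\int[N01]_x (trunc_slope m m' a x)%:E)%E.

Lemma mean_slopeE m m' a :
  (\int[N01]_x (trunc_slope m m' a x)%:E)%E = (mean_slope m m' a)%:E.
Proof.
rewrite fineK// ge0_fin_numE; last first.
  by apply: integral_ge0 => x _; rewrite lee_fin; case/andP: (trunc_slope01 m m' a x).
apply: (@le_lt_trans _ _ (\int[N01]_x (cst 1 x)))%E.
  apply: ge0_le_integral => //.
  - by move=> x _; rewrite lee_fin; case/andP: (trunc_slope01 m m' a x).
  - apply/measurable_EFinP; exact: measurable_trunc_slope.
  - by move=> x _; rewrite lee_fin; case/andP: (trunc_slope01 m m' a x).
by rewrite integral_cst//= probability_setT mule1 ltry.
Qed.

Lemma mean_slope01 m m' a : 0 <= mean_slope m m' a <= 1.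
Proof.
rewrite -!lee_fin; apply/andP; split.
  rewrite -[leRHS](mean_slopeE m m' a).
  by apply: integral_ge0 => x _; rewrite lee_fin; case/andP: (trunc_slope01 m m' a x).
rewrite -[leLHS](mean_slopeE m m' a).
apply: (@le_trans _ _ (\int[N01]_x (cst 1 x)))%E.
  apply: ge0_le_integral => //.
  - by move=> x _; rewrite lee_fin; case/andP: (trunc_slope01 m m' a x).
  - apply/measurable_EFinP; exact: measurable_trunc_slope.
  - by move=> x _; rewrite lee_fin; case/andP: (trunc_slope01 m m' a x).
by rewrite integral_cst//= probability_setT mule1.
Qed.

Lemma mean_slope_gap m m' a : m' < m -> mean_slope m m' a =
  1 - (if a then normal_gap m' m else normal_gap (- m) (- m')) / (m - m').
Proof.
move=> mm; have d0 : 0 < m - m' by rewrite subr_gt0.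
apply/eqP; rewrite eq_sym subr_eq; apply/eqP/EFin_inj.
rewrite EFinD -[X in (X + _)%E](mean_slopeE m m' a) EFinM muleC.
have -> : ((if a then normal_gap m' m else normal_gap (- m) (- m'))%:E =
   \int[N01]_x (if a then g m x - g m' x else g (- m') x - g (- m) x)%:E)%E.
  by case: a; rewrite normal_gapE// ?lerN2 ltW.
have mf : measurable_fun [set: R]
    (fun x => if a then g m x - g m' x else g (- m') x - g (- m) x).
  by case: a; apply: measurable_funB; exact: measurable_normal_tail.
have f0 x : 0 <= (if a then g m x - g m' x else g (- m') x - g (- m) x).
  by clear mf; case: a; rewrite subr_ge0 normal_tail_homo// ?lerN2 ltW.
rewrite -ge0_integralZl_EFin//; first last.
- by rewrite invr_ge0 ltW.
- exact/measurable_EFinP.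
- by move=> x _; rewrite lee_fin.
rewrite -ge0_integralD//; first last.
- by apply/measurable_EFinP; exact: measurable_funM.
- by move=> x _; rewrite -EFinM lee_fin mulr_ge0// invr_ge0 ltW.
- apply/measurable_EFinP; exact: measurable_trunc_slope.
- by move=> x _; rewrite lee_fin; case/andP: (trunc_slope01 m m' a x).
transitivity (\int[N01]_x (cst 1 x))%E.
  by rewrite integral_cst//= probability_setT mule1.
apply: eq_integral => x _; rewrite -EFinM -EFinD /=; congr EFin.
by rewrite trunc_slope_gap// mulrC subrK.
Qed.

Lemma slope_sum_le (s t e : R) : 0 < e -> e / 4 <= s + t ->
  1 - s / e + (1 - t / e) <= 7 / 4.
Proof.
move=> e0 st; have h : 1 / 4 <= s / e + t / e.
  by rewrite -mulrDl ler_pdivlMr// mulrC mulrA mulr1.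
rewrite addrACA -opprD; apply: le_trans (lerB (lexx _) h) _; lra.
Qed.

(** The mean slope averages the derivative in the linear predictor over the
    interval from [m'] to [m]; each point of this interval lies on the
    disfavoured side for one of the two responses, and there the derivative is
    at most [3 / 4]. An interval that contains [0] is split at [0]. *)
Lemma mean_slope_pair m m' :
  mean_slope m m' true + mean_slope m m' false <= 7 / 4.
Proof.
wlog mm : m m' / m' < m => [hw|].
  have [/hw//|/hw h|->] := ltgtP m' m.
    have E a : mean_slope m m' a = mean_slope m' m a.
      by congr fine; apply: eq_integral => x _; rewrite trunc_slopeC.
    by rewrite !E.
  have E a : mean_slope m m a = 0.
    apply: EFin_inj; rewrite -[LHS](mean_slopeE m m a) integral0_eq// => x _.
    by rewrite /trunc_slope !subrr mul0r.
  by rewrite !E addr0 divr_ge0.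
have d0 : 0 < m - m' by rewrite subr_gt0.
rewrite !mean_slope_gap//=.
have mN : - m <= - m' by rewrite lerN2 ltW.
suff h : (m - m') / 4 <= normal_gap m' m + normal_gap (- m) (- m').
  exact: slope_sum_le.
have [m0|/ltW m0] := leP m 0.
  apply: le_trans (normal_gap_le0 (ltW mm) m0) _.
  by rewrite lerDl; exact: normal_gap_ge0.
have mN0 : - m <= 0 by rewrite oppr_le0.
have [m'0|/ltW m'0] := leP 0 m'.
  have m'N0 : - m' <= 0 by rewrite oppr_le0.
  have := normal_gap_le0 mN m'N0; rewrite opprK addrC => h.
  by apply: le_trans h _; rewrite lerDr; apply: normal_gap_ge0; exact: ltW.
have -> : (m - m') / 4 = (0 - m') / 4 + (0 - - m) / 4 by field.
have m'N0 : 0 <= - m' by rewrite oppr_ge0.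
apply: lerD.
  by apply: le_trans (normal_gap_le0 m'0 (lexx 0)) _; exact: le_normal_gap.
by apply: le_trans (normal_gap_le0 mN0 (lexx 0)) _; exact: le_normal_gap.
Qed.

End truncated_normal.

(** * Symmetric matrices *)

Section symmetric_matrices.
Variable R : realType.

Definition bform n (A : 'M[R]_n) (u v : 'cV[R]_n) : R := (u^T *m A *m v) 0 0.
Definition nrm2 n (u : 'cV[R]_n) : R := \sum_i u i 0 ^+ 2.

Section fixed_dimension.
Variable n : nat.
Implicit Types (A B : 'M[R]_n) (u v w : 'cV[R]_n) (a : R).

Lemma qformE A u : qform A u = bform A u u. Proof. by []. Qed.

Lemma nrm2E u : nrm2 u = (u^T *m u) 0 0.
Proof. by rewrite mxE; apply: eq_bigr => i _; rewrite mxE expr2. Qed.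

Lemma nrm2_ge0 u : 0 <= nrm2 u.
Proof. by apply: sumr_ge0 => i _; exact: sqr_ge0. Qed.

Lemma nrm2_eq0 u : (nrm2 u == 0) = (u == 0).
Proof.
apply/eqP/eqP => [u0|->]; last by rewrite /nrm2 big1// => i _; rewrite mxE expr0n.
apply/matrixP => i j; rewrite ord1 mxE; apply/eqP; rewrite -sqrf_eq0.
by have /psumr_eq0P -> := u0 => // k _; exact: sqr_ge0.
Qed.

Lemma bform_sym A u v : A^T = A -> bform A u v = bform A v u.
Proof.
move=> AT; rewrite /bform -[in LHS](trmxK (u^T *m A *m v)) mxE.
by rewrite !trmx_mul AT trmxK mulmxA.
Qed.

Lemma bformDl A u v w : bform A (u + v) w = bform A u w + bform A v w.
Proof. by rewrite /bform linearD/= !mulmxDl mxE. Qed.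

Lemma bformDr A u v w : bform A w (u + v) = bform A w u + bform A w v.
Proof. by rewrite /bform mulmxDr mxE. Qed.

Lemma bformZl A a u w : bform A (a *: u) w = a * bform A u w.
Proof. by rewrite /bform linearZ/= -!scalemxAl mxE. Qed.

Lemma bformZr A a u w : bform A w (a *: u) = a * bform A w u.
Proof. by rewrite /bform -scalemxAr mxE. Qed.

Lemma bformDm A B u v : bform (A + B) u v = bform A u v + bform B u v.
Proof. by rewrite /bform mulmxDr mulmxDl mxE. Qed.

Lemma bformZm A a u v : bform (a *: A) u v = a * bform A u v.
Proof. by rewrite /bform -scalemxAr -scalemxAl mxE. Qed.

Lemma bform1 u : bform 1%:M u u = nrm2 u.
Proof. by rewrite nrm2E /bform mulmx1. Qed.

Lemma bform_mulr A B u v : bform (A *m B) u v = bform A u (B *m v).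
Proof. by rewrite /bform !mulmxA. Qed.

Lemma qformDZ A u v a : A^T = A ->
  qform A (u + a *: v) = qform A u + 2 * a * bform A u v + a ^+ 2 * qform A v.
Proof.
move=> AT; rewrite !qformE bformDl !bformDr !bformZl !bformZr.
by rewrite (bform_sym v u AT); ring.
Qed.

(** The discriminant argument; when [qform A v = 0] the form is affine along
    [v], and its positivity forces [bform A u v = 0]. *)
Lemma bform_CS A u v : possemidefmx A ->
  bform A u v ^+ 2 <= qform A u * qform A v.
Proof.
move=> [AT A0]; have := A0 v; rewrite le_eqVlt => /predU1P[qv|qv].
  have [->|b0] := eqVneq (bform A u v) 0.
    by rewrite expr0n mulr_ge0.
  have := A0 (u + (- (qform A u + 1) / (2 * bform A u v)) *: v).
  rewrite qformDZ// -qv mulr0 addr0.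
  have -> : 2 * (- (qform A u + 1) / (2 * bform A u v)) * bform A u v =
    - (qform A u + 1) by field.
  lra.
have := A0 (u + (- bform A u v / qform A v) *: v); rewrite qformDZ//.
have q0 : qform A v != 0 by rewrite gt_eqF.
have -> : qform A u + 2 * (- bform A u v / qform A v) * bform A u v +
  (- bform A u v / qform A v) ^+ 2 * qform A v =
  (qform A u * qform A v - bform A u v ^+ 2) / qform A v by field.
by rewrite pmulr_lge0 ?invr_gt0// subr_ge0.
Qed.

Lemma possemidef_ker A u : possemidefmx A -> qform A u = 0 -> A *m u = 0.
Proof.
move=> A0 qu; have [AT _] := A0.
apply/eqP; rewrite -nrm2_eq0 nrm2E.
have -> : ((A *m u)^T *m (A *m u)) 0 0 = bform A (A *m u) u.
  by rewrite /bform mulmxA.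
rewrite -sqrf_eq0 eq_le sqr_ge0 andbT.
by have := bform_CS (A *m u) u A0; rewrite qu mulr0.
Qed.

(** A contraction in the sense of quadratic forms is one in norm. *)
Lemma possemidef_le_nrm2 A c u : possemidefmx A -> 0 <= c ->
  (forall w, qform A w <= c * nrm2 w) -> nrm2 (A *m u) <= c ^+ 2 * nrm2 u.
Proof.
move=> A0 c0 Ac; have [AT Age] := A0.
have E : nrm2 (A *m u) = bform A (A *m u) u by rewrite nrm2E /bform mulmxA.
have := nrm2_ge0 (A *m u); rewrite le_eqVlt => /predU1P[<-|p].
  by rewrite mulr_ge0 ?nrm2_ge0 ?sqr_ge0.
rewrite -(ler_pM2l p) -expr2 [in leLHS]E.
apply: le_trans (bform_CS _ _ A0) _.
apply: le_trans (ler_pM (Age _) (Age _) (Ac _) (Ac _)) _.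
by rewrite le_eqVlt; apply/orP; left; apply/eqP; ring.
Qed.

End fixed_dimension.

Lemma continuous_sumr (T : topologicalType) (I : Type) (s : seq I)
    (f : I -> T -> R) : (forall i, continuous (f i)) ->
  continuous (fun x => \sum_(i <- s) f i x).
Proof.
move=> cf; elim: s => [|i s IHs] x.
  by under eq_fun do rewrite big_nil; exact: cvg_cst.
under eq_fun do rewrite big_cons.
by apply: cvgD; [exact: cf|exact: IHs].
Qed.

Lemma qform_continuous n (A : 'M[R]_n) :
  continuous (fun w : 'rV[R]_n => qform A w^T).
Proof.
have E : (fun w : 'rV[R]_n => qform A w^T) =
    (fun w => \sum_j \sum_i w 0 i * A i j * w 0 j).
  apply/funext => w; rewrite /qform trmxK mxE; apply: eq_bigr => j _.
  by rewrite !mxE mulr_suml; apply: eq_bigr => i _.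
rewrite E; apply: continuous_sumr => j; apply: continuous_sumr => i w.
have c1 k : continuous (fun w : 'rV[R]_n => w 0 k) by exact: coord_continuous.
exact: (cvgM (cvgM (c1 i w) (cvg_cst (A i j))) (c1 j w)).
Qed.

(** The Rayleigh quotient attains its maximum on the unit sphere, at an
    eigenvector. *)
Lemma rayleigh n (A : 'M[R]_n.+1) : A^T = A ->
  exists2 u : 'cV[R]_n.+1, nrm2 u = 1 &
    A *m u = qform A u *: u /\ forall w, qform A w <= qform A u * nrm2 w.
Proof.
move=> AT; pose S := [set w : 'rV[R]_n.+1 | qform 1%:M w^T = 1].
have S0 : S !=set0.
  exists (delta_mx 0 0); rewrite /S/= qformE bform1 /nrm2 (bigD1 0)//= big1.
    by rewrite !mxE eqxx addr0 expr1n.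
  by move=> i i0; rewrite !mxE (negbTE i0) andbF expr0n.
have cS : compact S.
  apply: bounded_closed_compact.
    exists 1; split; first exact: num_real.
    move=> M M1 w; rewrite /S/= qformE bform1 => Sw.
    rewrite [leLHS]mx_normrE; apply/bigmax_leP; split; first by rewrite ltW// (lt_trans _ M1).
    move=> [i j] _ /=; rewrite ord1 (le_trans _ (ltW M1))//.
    rewrite -(@expr_le1 _ 2)// -normrX ger0_norm ?sqr_ge0// -Sw /nrm2 (bigD1 j)//= mxE.
    by rewrite lerDl sumr_ge0// => k _; exact: sqr_ge0.
  rewrite (_ : S = (fun w : 'rV[R]_n.+1 => qform 1%:M w^T) @^-1` [set 1])//.
  apply: closed_comp; last exact: closed_eq.
  by move=> w _; exact: qform_continuous.
have [u] := EVT_max_rV S0 cS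
  (continuous_subspaceT (@qform_continuous _ A)).
rewrite inE /S/= qformE bform1 => u1 umax.
have max w : qform A w <= qform A u^T * nrm2 w.
  have [->|w0] := eqVneq w 0.
    by rewrite /qform mulmx0 mxE (eqP (_ : nrm2 0 == 0)) ?nrm2_eq0// mulr0.
  have N0 : 0 < nrm2 w by rewrite lt0r nrm2_eq0 w0 nrm2_ge0.
  pose c := (Num.sqrt (nrm2 w))^-1.
  have c2 : c ^+ 2 = (nrm2 w)^-1 by rewrite exprVn sqr_sqrtr// ltW.
  have cS1 : (c *: w)^T \in S.
    rewrite inE /S/= trmxK qformE bformZl bformZr bform1 mulrA -expr2 c2.
    by rewrite mulVf// gt_eqF.
  have := umax _ cS1; rewrite trmxK qformE bformZl bformZr mulrA -expr2 c2.
  by rewrite mulrC ler_pdivrMr.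
exists u^T => //; split=> //.
pose C := (qform A u^T)%:M - A.
have CE w : qform C w = qform A u^T * nrm2 w - qform A w.
  rewrite !qformE /C bformDm -scalemx1 bformZm bform1 -scaleN1r bformZm.
  by rewrite mulN1r.
have C0 : possemidefmx C.
  by split=> [|w]; [rewrite linearB/= tr_scalar_mx AT|rewrite CE subr_ge0].
have := possemidef_ker C0 (_ : qform C u^T = 0).
rewrite CE u1 mulr1 subrr => /(_ erefl).
by rewrite mulmxBl mul_scalar_mx => /eqP; rewrite subr_eq0 => /eqP.
Qed.

(** The maximum of the Rayleigh quotient is an eigenvalue, and it bounds every
    other eigenvalue; hence it is the supremum that defines [lambda_max]. *)
Lemma qform_le_lambda_max n (A : 'M[R]_n) w : A^T = A ->
  qform A w <= lambda_max A * nrm2 w.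
Proof.
case: n A w => [|n] A w AT.
  by rewrite /qform /nrm2 mxE !big_ord0 mulr0.
have [u u1 [Au Amax]] := rayleigh AT.
apply: le_trans (Amax w) _; rewrite ler_wpM2r ?nrm2_ge0//.
apply: ub_le_sup.
  exists (qform A u) => a /= /eigenvalueP[x xA x0].
  have := Amax x^T; rewrite /qform trmxK xA -scalemxAl mxE.
  have : 0 < nrm2 x^T by rewrite lt0r nrm2_ge0 nrm2_eq0 trmx_eq0 x0.
  by rewrite [nrm2 x^T]nrm2E trmxK => p; rewrite ler_pM2r.
rewrite /=; apply/eigenvalueP; exists u^T; last first.
  by rewrite trmx_eq0 -nrm2_eq0 u1 oner_eq0.
by rewrite -[in LHS]AT -trmx_mul Au linearZ.
Qed.

Lemma possemidef0 n : possemidefmx (0 : 'M[R]_n).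
Proof. by split=> [|u]; rewrite ?trmx0// /qform mulmx0 mul0mx mxE. Qed.

(** A square root by deflation: subtracting its top eigencomponent lowers the
    rank of the matrix and keeps it positive semidefinite. *)
Lemma sqrtmx_exists n (A : 'M[R]_n) : possemidefmx A ->
  exists B, possemidefmx B /\ B *m B = A.
Proof.
case: n A => [|n] A; first by move=> _; exists A; split;
  [rewrite (flatmx0 A); exact: possemidef0|rewrite (flatmx0 A) mul0mx].
have [k] := ubnP (\rank A); elim: k A => // k IHk A rk A0.
have [AT Age] := A0.
have [u u1 [Au Amax]] := rayleigh AT; move: Au Amax.
set s := qform A u => Au Amax.
have s0 : 0 <= s := Age u.
have [s00|sn0] := eqVneq s 0.
  exists 0; split; first exact: possemidef0.
  rewrite mul0mx; apply/matrixP => i j; rewrite !mxE.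
  have Aj : A *m delta_mx j (0 : 'I_1) = 0.
    apply: (possemidef_ker A0); apply/eqP; rewrite eq_le Age andbT.
    by have := Amax (delta_mx j 0); rewrite s00 mul0r.
  by have /matrixP/(_ i 0) := Aj; rewrite -colE !mxE => ->.
have sgt0 : 0 < s by rewrite lt0r sn0.
have uTA : u^T *m A = s *: u^T by rewrite -[in LHS]AT -trmx_mul Au linearZ.
have uu : u^T *m u = 1%:M.
  by apply/matrixP => i j; rewrite !ord1 -nrm2E u1 mxE.
pose P := u *m u^T; pose A' := A - s *: P.
have PT : P^T = P by rewrite trmx_mul trmxK.
have A'T : A'^T = A' by rewrite linearB/= linearZ/= AT PT.
have PE w : qform P w = ((u^T *m w) 0 0) ^+ 2.
  rewrite /qform /P mulmxA -mulmxA mxE big_ord1 expr2; congr (_ * _).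
  by rewrite -[in LHS](trmxK u) -trmx_mul mxE.
have A'0 : possemidefmx A'.
  split=> // w; rewrite qformE /A' bformDm -scaleNr bformZm -!qformE PE.
  have := bform_CS u w A0; rewrite /bform uTA -scalemxAl mxE -/s.
  set t := (u^T *m w) 0 0 => h.
  have : s * (s * t ^+ 2) <= s * qform A w by rewrite mulrA -expr2 -exprMn.
  by rewrite ler_pM2l// mulNr subr_ge0.
have A'u : A' *m u = 0.
  by rewrite mulmxBl Au -scalemxAl /P -mulmxA uu mulmx1 subrr.
have rk' : (\rank A' < k)%N.
  have A'E : A' = (1%:M - P) *m A.
    by rewrite mulmxBl mul1mx /P -mulmxA uTA -scalemxAr.
  have sub : (A' <= A)%MS by rewrite A'E submxMl.
  apply: (@leq_trans (\rank A)); last by rewrite -ltnS.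
  rewrite ltn_neqAle mxrankS// andbT.
  have [_ ->] := mxrank_leqif_sup sub.
  apply/negP => /submxP[D AE].
  have : u^T *m A *m u = 0 by rewrite AE mulmxA -mulmxA A'u mulmx0.
  rewrite uTA -scalemxAl uu => /matrixP/(_ 0 0); rewrite !mxE mulr1.
  by move/eqP; rewrite (negbTE sn0).
have [B [B0 BB]] := IHk A' rk' A'0.
have [BT Bge] := B0.
have Bu : B *m u = 0.
  apply/eqP; rewrite -nrm2_eq0 nrm2E trmx_mul BT -mulmxA (mulmxA B) BB A'u.
  by rewrite mulmx0 mxE.
have uB : u^T *m B = 0 by rewrite -BT -trmx_mul Bu trmx0.
exists (B + Num.sqrt s *: P); split.
  split=> [|w]; first by rewrite linearD/= linearZ/= BT PT.
  rewrite qformE bformDm bformZm -!qformE PE.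
  by rewrite addr_ge0// mulr_ge0 ?sqrtr_ge0 ?sqr_ge0.
rewrite mulmxDl !mulmxDr BB -!scalemxAl -!scalemxAr.
have -> : B *m P = 0 by rewrite /P mulmxA Bu mul0mx.
have -> : P *m B = 0 by rewrite /P -mulmxA uB mulmx0.
have -> : P *m P = P by rewrite /P mulmxA -(mulmxA u) uu mulmx1.
by rewrite !scaler0 addr0 add0r scalerA -expr2 sqr_sqrtr// subrK.
Qed.

Lemma sqrtmxP n (A : 'M[R]_n) : possemidefmx A ->
  possemidefmx (sqrtmx A) /\ sqrtmx A *m sqrtmx A = A.
Proof.
move=> A0; rewrite /sqrtmx; case: xgetP => [B _ //|H].
by have [B /H] := sqrtmx_exists A0.
Qed.

Lemma possemidef_inv n (A : 'M[R]_n) : possemidefmx A -> A \in unitmx ->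
  possemidefmx (invmx A).
Proof.
move=> [AT Age] uA; split=> [|w]; first by rewrite trmx_inv AT.
have -> : qform (invmx A) w = qform A (invmx A *m w).
  by rewrite /qform trmx_mul trmx_inv AT mulmxKV// mulmxA.
exact: Age.
Qed.

Lemma sqrtmx_unit n (A : 'M[R]_n) : possemidefmx A -> A \in unitmx ->
  sqrtmx A \in unitmx.
Proof.
move=> /sqrtmxP[_ e]; rewrite -[in X in X -> _]e !unitmxE det_mulmx.
by rewrite unitrM => /andP[].
Qed.

End symmetric_matrices.

(** * Lebesgue and Gaussian measure on vectors *)

Section vectors.
Variable R : realType.
Local Notation RM := (measurableTypeR R).

Lemma tupvK n : cancel (@tupv R n) (@colv R n).
Proof. by move=> u; apply/matrixP => i j; rewrite mxE tnth_mktuple ord1. Qed.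

Section measurable_vectors.
Context d (T : measurableType d).

Definition measurable_vec n (F : T -> 'cV[R]_n) :=
  forall i, measurable_fun setT (fun x => F x i 0).

Lemma measurable_vecD n (F G : T -> 'cV[R]_n) :
  measurable_vec F -> measurable_vec G -> measurable_vec (fun x => F x + G x).
Proof.
by move=> mF mG i; under eq_fun do rewrite mxE; exact: measurable_funD.
Qed.

Lemma measurable_vecN n (F : T -> 'cV[R]_n) :
  measurable_vec F -> measurable_vec (fun x => - F x).
Proof.
by move=> mF i; under eq_fun do rewrite mxE; exact: measurableT_comp.
Qed.

Lemma measurable_vec_mul m n (M : 'M[R]_(m, n)) (F : T -> 'cV[R]_n) :
  measurable_vec F -> measurable_vec (fun x => M *m F x).
Proof.
move=> mF i; under eq_fun do rewrite mxE.
by apply: measurable_sumr => j; exact: measurable_funM.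
Qed.

Lemma measurable_vec_cst n (u : 'cV[R]_n) : measurable_vec (fun _ => u).
Proof. by move=> i; exact: measurable_cst. Qed.

Lemma measurable_tupv n (F : T -> 'cV[R]_n) : measurable_vec F ->
  measurable_fun setT (fun x => tupv (F x)).
Proof.
move=> mF; apply/measurable_fun_tnthP => i.
rewrite (_ : _ \o _ = fun x => F x i 0); first exact: mF.
by apply/funext => x /=; rewrite tnth_mktuple.
Qed.

Lemma measurable_vec_colv n (F : T -> n.-tuple RM) : measurable_fun setT F ->
  measurable_vec (fun x => colv (F x)).
Proof.
move=> mF i; under eq_fun do rewrite mxE.
by apply: (measurableT_comp (measurable_tnth i)).
Qed.

Lemma measurable_qform n (A : 'M[R]_n) (F : T -> 'cV[R]_n) :
  measurable_vec F -> measurable_fun setT (fun x => qform A (F x)).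
Proof.
move=> mF; rewrite /qform; under eq_fun do rewrite -mulmxA mxE.
apply: measurable_sumr => j; apply: measurable_funM.
  by under eq_fun do rewrite mxE; exact: mF.
exact: measurable_vec_mul.
Qed.

Lemma measurable_nrm2 n (F : T -> 'cV[R]_n) :
  measurable_vec F -> measurable_fun setT (fun x => nrm2 (F x)).
Proof.
by move=> mF; apply: measurable_sumr => j; apply: measurable_funX.
Qed.

End measurable_vectors.

Lemma integral_prod_fun d (T : measurableType d) n
    (mu : 'I_n -> {sigma_finite_measure set T -> \bar R})
    (f : 'I_n -> T -> R) (c : 'I_n -> R) :
  (forall i, measurable_fun setT (f i)) -> (forall i x, 0 <= f i x) ->
  (forall i, \int[mu i]_x (f i x)%:E = (c i)%:E)%E ->
  (\int[prod_measure mu]_t (\prod_(i < n) f i (tnth t i))%:E =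
   (\prod_(i < n) c i)%:E)%E.
Proof.
elim: n mu f c => [|n IHn] mu f c mf f0 fc.
  rewrite integral_tuple0 ?big_ord0// => t.
  by rewrite big_ord0 lee_fin.
have m' : measurable_fun [set: n.-tuple T]
    (fun t => \prod_(i < n) f (lift ord0 i) (tnth t i)).
  by apply: measurable_prodr => i; apply: (measurableT_comp (mf _)); exact: measurable_tnth.
rewrite integral_tcons; first last.
- by move=> t; rewrite lee_fin prodr_ge0.
- apply/measurable_EFinP; apply: measurable_prodr => i.
  by apply: (measurableT_comp (mf i)); exact: measurable_tnth.
transitivity (\int[mu ord0]_x ((f ord0 x)%:E *
    (\prod_(i < n) c (lift ord0 i))%:E))%E.
  apply: eq_integral => x _.
  rewrite -(IHn (fun i => mu (lift ord0 i)) (fun i => f (lift ord0 i)))//.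
  rewrite -ge0_integralZl_EFin//; first last.
  - exact/measurable_EFinP.
  - by move=> t _; rewrite lee_fin prodr_ge0.
  apply: eq_integral => t _; rewrite big_ord_recl tnth_tcons0 EFinM.
  by congr (_ * _%:E)%E; apply: eq_bigr => i _; rewrite tnth_tconsS.
under eq_integral do rewrite muleC.
rewrite ge0_integralZl//; first last.
- rewrite lee_fin prodr_ge0// => i _; rewrite -lee_fin -fc.
  by apply: integral_ge0 => x _; rewrite lee_fin.
- by move=> x _; rewrite lee_fin.
- exact/measurable_EFinP.
by rewrite fc -EFinM mulrC big_ord_recl.
Qed.

Lemma integral_expR_abs (a : R) : 0 < a ->
  (\int[@lebesgue_measure R]_x (expR (- (a * `|x|)))%:E = (2 / a)%:E)%E.
Proof.
move=> a0.
have cf : continuous (fun x : R => expR (- (a * `|x|))).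
  move=> x; apply: continuous_comp; last exact: continuous_expR.
  apply: cvgN; apply: cvgMr; exact: norm_continuous.
rewrite ge0_symfun_integralT//; last by move=> x /=; rewrite normrN.
rewrite -set_itvcy.
transitivity (2%:E * \int[@lebesgue_measure R]_(x in `[0%R, +oo[)
    (expR (- (a * x)))%:E)%E.
  congr (_ * _)%E; apply: eq_integral => x; rewrite inE/= in_itv/= andbT => x0.
  by rewrite ger0_norm.
have a_neq0 : a != 0 by rewrite gt_eqF.
have dF (x : R) : is_derive x 1 (fun x : R => - (a^-1 * expR (- (a * x)))) (expR (- (a * x))).
  by apply: is_derive_eq; rewrite /GRing.scale/=; field.
have cF : continuous (fun x : R => - (a^-1 * expR (- (a * x)))).
  by move=> x; apply/differentiable_continuous/derivable1_diffP; case: (dF x).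
rewrite (@ge0_continuous_FTC2y R _ (fun x => - (a^-1 * expR (- (a * x)))) 0 0).
- by rewrite mulr0 oppr0 expR0 mulr1 sub0e -EFinN opprK -EFinM.
- by move=> x _; exact: expR_ge0.
- apply: continuous_subspaceT => x.
  apply: continuous_comp; last exact: continuous_expR.
  by apply: cvgN; apply: cvgMr; exact: cvg_id.
- rewrite -[X in _ --> X]oppr0; apply: cvgN; rewrite -[X in _ --> X](mulr0 a^-1).
  apply: cvgMr.
  apply: (@cvg_comp _ _ _ (fun x => a * x) (fun y => expR (- y)) _ (pinfty_nbhs R)); last exact: cvgr_expR.
  by apply: gt0_cvgMry => //; exact: cvg_id.
- by move=> x _; case: (dF x).
- by apply: cvg_at_right_filter; exact: cF.
- by move=> x _; rewrite derive1E; case: (dF x).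
Qed.

Section lebesgue_vectors.
Variable p : nat.
Local Notation T := (p.-tuple RM).
Local Notation lebp := (lebesgue_vect R p).
Local Notation phi := (@normal_pdf R 0 1).

Lemma lebesgue_vect_shift (a : 'cV[R]_p) :
  transports lebp lebp (fun t => tupv (colv t + a)) (fun _ => 1).
Proof.
have := @transports_prod _ _ RM RM R p (fun _ => @lebesgue_measure R)
  (fun _ => @lebesgue_measure R) (fun i x => x + a i 0) (fun _ _ => 1)
  (fun i => measurable_shift (a i 0)) (fun i => @measurable_cst _ _ _ _ _ _)
  (fun i _ => ler01) (fun i => lebesgue_shift (a i 0)).
move=> H g mg g0; rewrite (H g mg g0); apply: eq_integral => t _.
rewrite big1//; congr (g _ * _)%E; apply/eq_from_tnth => i.
by rewrite !tnth_mktuple !mxE.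
Qed.

Lemma lebesgue_vect_opp :
  transports lebp lebp (fun t => tupv (- colv t)) (fun _ => 1).
Proof.
have := @transports_prod _ _ RM RM R p (fun _ => @lebesgue_measure R)
  (fun _ => @lebesgue_measure R) (fun i x => - x) (fun _ _ => 1)
  (fun i => (ltac:(exact: measurableT_comp))) (fun i => @measurable_cst _ _ _ _ _ _)
  (fun i _ => ler01) (fun i => @lebesgue_opp R).
move=> H g mg g0; rewrite (H g mg g0); apply: eq_integral => t _.
rewrite big1//; congr (g _ * _)%E; apply/eq_from_tnth => i.
by rewrite !tnth_mktuple !mxE.
Qed.

Definition std_normal : {sigma_finite_measure set T -> \bar R} :=
  prod_measure (fun _ : 'I_p => normal_prob (0 : R) 1).

Definition std_density (u : 'cV[R]_p) : R :=
  normal_peak 1 ^+ p * expR (- (2^-1 * nrm2 u)).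

Lemma std_density_ge0 u : 0 <= std_density u.
Proof. by rewrite mulr_ge0 ?exprn_ge0 ?normal_peak_ge0 ?expR_ge0. Qed.

Lemma measurable_std_density d (T' : measurableType d) (F : T' -> 'cV[R]_p) :
  measurable_vec F -> measurable_fun setT (fun x => std_density (F x)).
Proof.
move=> mF; apply: measurable_funM => //; apply: measurableT_comp => //.
by apply: measurableT_comp => //; apply: measurable_funM => //; exact: measurable_nrm2.
Qed.

Lemma std_normal_density :
  transports lebp std_normal idfun (fun t => std_density (colv t)).
Proof.
have m1 (i : 'I_p) : measurable_fun [set: RM] (fun x : RM => phi (x - 0)).
  by under eq_fun do rewrite subr0; exact: measurable_normal_pdf.
have := @transports_prod _ _ RM RM R p (fun _ => @lebesgue_measure R)
  (fun _ => normal_prob (0 : R) 1) (fun _ => idfun) (fun _ x => phi (x - 0))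
  (fun i => @measurable_id _ _ _) m1
  (fun i x => normal_pdf_ge0 0 1 (x - 0)) (fun i => normal_prob_density 0).
move=> H g mg g0; rewrite (H g mg g0); apply: eq_integral => t _.
congr (g _ * _%:E)%E.
  by apply/eq_from_tnth => i; rewrite tnth_mktuple.
rewrite /std_density /nrm2 mulr_sumr -sumrN expR_sum.
have -> : normal_peak 1 ^+ p = \prod_(i < p) normal_peak (1 : R).
  by rewrite prodr_const card_ord.
rewrite -big_split/=.
by apply: eq_bigr => i _; rewrite subr0 normal_pdf01E mxE [_ / 2]mulrC.
Qed.

Lemma std_normalT : std_normal setT = 1%E.
Proof.
have := @prod_measure_box _ RM R p (fun _ => normal_prob (0 : R) 1) (fun _ => setT)
  (fun _ => measurableT).
rewrite big1; last by move=> i _; exact: (@probability_setT _ _ _ (normal_prob (0 : R) 1)).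
by move=> <-; congr (prod_measure _ _); apply/seteqP; split.
Qed.

Lemma integral_std_density : (\int[lebp]_t (std_density (colv t))%:E = 1)%E.
Proof.
transitivity (\int[std_normal]_t cst 1%E t)%E; last first.
  by rewrite integral_cst// mul1e; exact: std_normalT.
rewrite (std_normal_density (@measurable_cst _ _ _ _ setT (1%E : \bar R)))//.
by apply: eq_integral => t _; rewrite mul1e.
Qed.

(** Lebesgue measure on [R^p] is determined up to a factor by its invariance
    under translations: two applications of Tonelli exchange the roles of the
    image measure and of Lebesgue measure. *)
Lemma lebesgue_vect_linear (S : 'M[R]_p) : S \in unitmx ->
  exists c : \bar R, (0 <= c)%E /\ forall g : T -> \bar R,
    measurable_fun setT g -> (forall t, 0 <= g t)%E ->
    (\int[lebp]_t g (tupv (S *m colv t)) = c * \int[lebp]_t g t)%E.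
Proof.
move=> uS; pose h t := (std_density (colv t))%:E.
pose St t := tupv (S *m colv t).
have m_id : measurable_fun [set: T] idfun by exact: measurable_id.
have mcolv : measurable_vec (fun t : T => colv t) by exact: measurable_vec_colv.
have mh : measurable_fun setT h.
  by apply/measurable_EFinP; exact: measurable_std_density.
have h0 t : (0 <= h t)%E by rewrite lee_fin std_density_ge0.
have mS : measurable_fun setT St.
  by apply: measurable_tupv; exact: measurable_vec_mul.
have m1 : measurable_vec (fun z : T * T => colv z.1) by exact: measurable_vec_colv.
have m2 : measurable_vec (fun z : T * T => colv z.2) by exact: measurable_vec_colv.
exists (\int[lebp]_t h (St t))%E; split; first by apply: integral_ge0.
move=> g mg g0.
have refl t : (\int[lebp]_y g (tupv (S *m colv t - colv y)) = \int[lebp]_y g y)%E.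
  rewrite (lebesgue_vect_shift (S *m colv t) mg g0).
  under [RHS]eq_integral do rewrite mule1.
  rewrite [RHS]lebesgue_vect_opp//; last first.
    apply: (measurableT_comp mg); apply: measurable_tupv.
    by apply: measurable_vecD => //; exact: measurable_vec_cst.
  by apply: eq_integral => y _; rewrite mule1 tupvK addrC.
have step1 : (\int[lebp]_t g (St t) =
    \int[lebp]_t \int[lebp]_y (g (St t) * h (tupv (colv y + S *m colv t))))%E.
  apply: eq_integral => t _; rewrite ge0_integralZl//; last first.
    apply: (measurableT_comp mh); apply: measurable_tupv.
    by apply: measurable_vecD => //; exact: measurable_vec_cst.
  rewrite [X in (_ * X)%E](_ : _ = 1%E) ?mule1//.
  rewrite -[RHS]integral_std_density (lebesgue_vect_shift (S *m colv t) mh h0).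
  by apply: eq_integral => y _; rewrite mule1.
rewrite step1 (fubini_tonelli (fun z => g (St z.1) *
  h (tupv (colv z.2 + S *m colv z.1)))%E); first last.
- by move=> z; rewrite mule_ge0.
- apply: emeasurable_funM; first exact: (measurableT_comp mg (measurableT_comp mS measurable_fst)).
  apply: (measurableT_comp mh); apply: measurable_tupv.
  by apply: measurable_vecD => //; exact: measurable_vec_mul.
transitivity (\int[lebp]_y \int[lebp]_t
    (g (tupv (S *m colv t - colv y)) * h (St t)))%E.
  apply: eq_integral => y _ /=.
  rewrite [RHS](lebesgue_vect_shift (invmx S *m colv y)); first last.
  - by move=> t; rewrite mule_ge0.
  - apply: emeasurable_funM; last exact: (measurableT_comp mh).
    apply: (measurableT_comp mg); apply: measurable_tupv.
    apply: measurable_vecD; first exact: measurable_vec_mul.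
    exact: measurable_vec_cst.
  apply: eq_integral => t _; rewrite mule1 /St.
  have -> : S *m colv (tupv (colv t + invmx S *m colv y)) = S *m colv t + colv y.
    by rewrite tupvK mulmxDr mulKVmx.
  by rewrite addrK [colv y + _]addrC.
rewrite -(fubini_tonelli (fun z => g (tupv (S *m colv z.1 - colv z.2)) *
  h (St z.1))%E); first last.
- by move=> z; rewrite mule_ge0.
- apply: emeasurable_funM; last first.
    exact: (measurableT_comp mh (measurableT_comp mS measurable_fst)).
  apply: (measurableT_comp mg); apply: measurable_tupv.
  by apply: measurable_vecD; [exact: measurable_vec_mul|exact: measurable_vecN].
transitivity (\int[lebp]_t (h (St t) * \int[lebp]_y g y))%E; last first.
  rewrite ge0_integralZr//; first exact: (measurableT_comp mh).
  exact: integral_ge0.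
apply: eq_integral => t _ /=; rewrite -(refl t).
rewrite -[RHS](ge0_integralZl lebp measurableT)//; last first.
  apply: (measurableT_comp mg); apply: measurable_tupv.
  by apply: measurable_vecD; [exact: measurable_vec_cst|exact: measurable_vecN].
by apply: eq_integral => y _; rewrite muleC.
Qed.

End lebesgue_vectors.
End vectors.

Section gaussian_vectors.
Variables (R : realType) (p : nat).
Local Notation RM := (measurableTypeR R).
Local Notation T := (p.-tuple RM).
Local Notation lebp := (lebesgue_vect R p).
Local Notation stdn := (std_normal R p).
Local Notation stdd := (@std_density R p).

Lemma measurable_colv_id : measurable_vec (fun t : T => colv t).
Proof. by apply: measurable_vec_colv; exact: measurable_id. Qed.

Lemma measurable_affine (m : 'cV[R]_p) (S : 'M[R]_p) :
  measurable_fun [set: T] (fun w => tupv (m + S *m colv w)).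
Proof.
apply: measurable_tupv; apply: measurable_vecD; first exact: measurable_vec_cst.
by apply: measurable_vec_mul; exact: measurable_colv_id.
Qed.

Lemma integral_mvnormal (m : 'cV[R]_p) (V : 'M[R]_p) (g : T -> \bar R) :
  measurable_fun setT g -> (forall t, 0 <= g t)%E ->
  (\int[mvnormal m V]_t g t =
   \int[stdn]_w g (tupv (m + sqrtmx V *m colv w)))%E.
Proof.
by move=> mg g0; rewrite (ge0_integral_pushforward (measurable_affine m (sqrtmx V))).
Qed.

Lemma nrm2_sqrt_inv (V : 'M[R]_p) u : possemidefmx V -> V \in unitmx ->
  nrm2 (invmx (sqrtmx V) *m u) = qform (invmx V) u.
Proof.
move=> V0 uV; have [[ST _] SS] := sqrtmxP V0; have uS := sqrtmx_unit V0 uV.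
rewrite nrm2E trmx_mul trmx_inv ST.
have -> : invmx V = invmx (sqrtmx V) *m invmx (sqrtmx V).
  rewrite -[RHS](mulKmx uV) (_ : V *m _ = 1%:M) ?mulmx1//.
  by rewrite -[X in X *m _ = _]SS mulmxA mulmxK// mulmxV.
by rewrite /qform !mulmxA.
Qed.

(** Changing variables by the square root of [V] multiplies Lebesgue measure
    by an unknown constant, which the total mass one then shows to be positive
    and finite; no determinant has to be computed. *)
Lemma mvnormal_density (V : 'M[R]_p) : possemidefmx V -> V \in unitmx ->
  exists2 c : R, 0 < c & forall m, transports lebp (mvnormal m V) idfun
    (fun t => c * expR (- (2^-1 * qform (invmx V) (colv t - m)))).
Proof.
move=> V0 uV; have uS := sqrtmx_unit V0 uV; set S := sqrtmx V in uS *.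
have [c [c0 cS]] := lebesgue_vect_linear uS.
have mcol := measurable_colv_id.
pose E (t : T) (m : 'cV[R]_p) : R := expR (- (2^-1 * qform (invmx V) (colv t - m))).
have mE m : measurable_fun setT (E ^~ m).
  apply: measurableT_comp => //; apply: measurableT_comp => //.
  apply: measurable_funM => //; apply: measurable_qform.
  by apply: measurable_vecD => //; exact: measurable_vec_cst.
have E0 t m : 0 <= E t m by exact: expR_ge0.
pose k : R := normal_peak 1 ^+ p.
have k0 : 0 < k by rewrite exprn_gt0// normal_peak_gt0// oner_eq0.
have key m (g : T -> \bar R) : measurable_fun setT g -> (forall t, 0 <= g t)%E ->
    (\int[mvnormal m V]_t g t = c * \int[lebp]_t (g t * (k * E t m)%:E))%E.
  move=> mg g0.
  have mgm : measurable_fun setT (fun t : T => g (tupv (colv t + m))).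
    apply: (measurableT_comp mg); apply: measurable_tupv.
    by apply: measurable_vecD => //; exact: measurable_vec_cst.
  rewrite integral_mvnormal//.
  rewrite (@std_normal_density R p (fun w => g (tupv (m + S *m colv w))))//; last first.
    by apply: (measurableT_comp mg); exact: measurable_affine.
  have md : measurable_fun setT (fun t : T => stdd (invmx S *m colv t)).
    by apply: measurable_std_density; exact: measurable_vec_mul.
  rewrite [X in _ = (_ * X)%E](lebesgue_vect_shift m); first last.
  - by move=> t; rewrite mule_ge0// lee_fin mulr_ge0// ltW.
  - apply: emeasurable_funM => //; apply/measurable_EFinP.
    by apply: measurable_funM => //.
  rewrite -cS; first last.
  - by move=> t; rewrite mule1 mule_ge0// lee_fin mulr_ge0// ltW.
  - under eq_fun do rewrite mule1; apply: emeasurable_funM => //.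
    apply/measurable_EFinP; apply: measurable_funM => //.
    apply: (measurableT_comp (mE m)); apply: measurable_tupv.
    by apply: measurable_vecD => //; exact: measurable_vec_cst.
  apply: eq_integral => t _; rewrite mule1 /E !tupvK addrK [_ + m]addrC.
  congr (_ * (_ * expR (- (_ * _)))%:E)%E.
  by rewrite -nrm2_sqrt_inv// mulKmx.
have mv1 : (1 = c * \int[lebp]_t (k * E t 0)%:E)%E.
  have := key 0 (cst 1%E) (@measurable_cst _ _ _ _ _ _) (fun _ => lee01).
  rewrite integral_mvnormal// integral_cst// mul1e.
  under [in X in _ = X -> _]eq_integral do rewrite mul1e.
  by move=> <-; exact/esym/std_normalT.
have EX : (\int[lebp]_t (k * E t 0)%:E != 0)%E.
  apply/negP => /eqP e; move: mv1.
  by rewrite e mule0 => /eqP; rewrite onee_eq0.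
have c_fin : exists2 c' : R, 0 < c' & c = c'%:E.
  have I0 : (0 < \int[lebp]_t (k * E t 0)%:E)%E.
    rewrite lt_def EX/=; apply: integral_ge0 => t _.
    by rewrite lee_fin mulr_ge0// ltW.
  case: (c) c0 mv1 => [r r0 e| _ e|//].
    exists r => //; rewrite lt0r -lee_fin r0 andbT; apply/eqP => r00.
    by move: e => /eqP; rewrite r00 mul0e onee_eq0.
  by move: e; rewrite gt0_mulye.
have [c' c'0 cE] := c_fin.
exists (c' * k); first by rewrite mulr_gt0.
move=> m g mg g0; rewrite key// cE -ge0_integralZl_EFin//; last 3 first.
- by move=> t _; rewrite mule_ge0// lee_fin mulr_ge0// ltW.
- by apply: emeasurable_funM => //; apply/measurable_EFinP; exact: measurable_funM.
- exact: ltW.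
by apply: eq_integral => t _; rewrite muleCA -EFinM mulrA.
Qed.

(** * Moments and shifts of Gaussian vectors *)

Lemma integral_expR_sum (a : R) : 0 < a ->
  (\int[lebp]_t (expR (- (a * \sum_i `|colv t i 0|)))%:E = ((2 / a) ^+ p)%:E)%E.
Proof.
move=> a0.
have := @integral_prod_fun R _ RM p (fun _ => @lebesgue_measure R)
  (fun _ x => expR (- (a * `|x|))) (fun _ => 2 / a).
rewrite prodr_const card_ord => <-//.
- apply: eq_integral => t _; congr EFin.
  rewrite mulr_sumr -sumrN expR_sum; apply: eq_bigr => i _.
  by rewrite mxE.
- move=> i; apply: measurableT_comp => //; apply: measurableT_comp => //.
  by apply: measurable_funM => //; exact: measurableT_comp.
- by move=> i; exact: integral_expR_abs.
Qed.

Lemma std_normal_nrm2_lty : (\int[stdn]_w (nrm2 (colv w))%:E < +oo)%E.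
Proof.
have mn : measurable_fun setT (fun t : T => (nrm2 (colv t))%:E).
  by apply/measurable_EFinP; apply: measurable_nrm2; exact: measurable_colv_id.
have n0 (t : T) : (0 <= (nrm2 (colv t))%:E)%E by rewrite lee_fin nrm2_ge0.
rewrite (std_normal_density mn n0).
pose C : R := 4 * normal_peak 1 ^+ p * expR p%:R.
have C0 : 0 <= C by rewrite mulr_ge0 ?expR_ge0// mulr_ge0// exprn_ge0// normal_peak_ge0.
apply: (@le_lt_trans _ _ (\int[lebp]_t
    (C%:E * (expR (- (1 * \sum_i `|colv t i 0|)))%:E))%E).
  have me : measurable_fun setT (fun t : T => (expR (- (1 * \sum_i `|colv t i 0|)))%:E).
    apply/measurable_EFinP; apply: measurableT_comp => //; apply: measurableT_comp => //.
    apply: measurable_funM => //; apply: measurable_sumr => i.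
    by apply: measurableT_comp => //; exact: measurable_colv_id.
  apply: ge0_le_integral => //.
  - by move=> t _; rewrite mule_ge0// lee_fin std_density_ge0.
  - apply: emeasurable_funM => //; apply/measurable_EFinP.
    by apply: measurable_std_density; exact: measurable_colv_id.
  - by apply: emeasurable_funM.
  - move=> t _; rewrite -!EFinM lee_fin mul1r /C /std_density.
    set u := colv t; set N := nrm2 u.
    have N0 : 0 <= N := nrm2_ge0 u.
    have h1 : N * expR (- (4^-1 * N)) <= 4.
      have := expR_ge1Dx (4^-1 * N).
      have e0 := expR_gt0 (- (4^-1 * N)).
      rewrite -ler_pdivlMr// -expRN opprK; lra.
    have h2 : expR (- (4^-1 * N)) <= expR p%:R * expR (- \sum_i `|u i 0|).
      rewrite -expRD ler_expR /N /nrm2 mulr_sumr.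
      have -> : p%:R = \sum_(i < p) (1 : R) by rewrite sumr_const card_ord.
      rewrite -!sumrN -big_split/=; apply: ler_sum => i _.
      rewrite -real_normK ?num_real//.
      by have := sqr_ge0 (`|u i 0| - 2); rewrite !expr2; lra.
    have -> : expR (- (2^-1 * N)) = expR (- (4^-1 * N)) * expR (- (4^-1 * N)).
      by rewrite -expRD; congr expR; field.
    have := ler_pM (mulr_ge0 N0 (expR_ge0 _)) (expR_ge0 _) h1 h2.
    move/(ler_wpM2l (exprn_ge0 p (normal_peak_ge0 (1 : R)))).
    by congr (_ <= _); ring.
rewrite ge0_integralZl//; first last.
- apply/measurable_EFinP; apply: measurableT_comp => //; apply: measurableT_comp => //.
  apply: measurable_funM => //; apply: measurable_sumr => i.
  by apply: measurableT_comp => //; exact: measurable_colv_id.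
- by rewrite integral_expR_sum// -EFinM ltry.
Qed.

(** The ratio of the two densities is [expR (bform u th - nrm2 th / 2)]; the
    exponential is bounded below by its tangent, and the inner product by
    Cauchy-Schwarz and Young's inequality with weight [e]. *)
Lemma std_density_shift (u th : 'cV[R]_p) (e : R) : 0 < e <= 1 ->
  stdd u <= stdd (u - th) + stdd u * ((nrm2 u + 1) * (nrm2 th / e + e)).
Proof.
move=> /andP[e0 e1].
have Q1 : possemidefmx (1%:M : 'M[R]_p).
  by split=> [|w]; [exact: trmx1|rewrite qformE bform1 nrm2_ge0].
pose t := bform 1%:M u th.
have tCS : t ^+ 2 <= nrm2 u * nrm2 th by rewrite -!bform1; exact: bform_CS.
have nB : nrm2 (u - th) = nrm2 u - 2 * t + nrm2 th.
  rewrite -[- th]scaleN1r -!bform1 -!qformE qformDZ ?trmx1// /t.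
  by ring.
have -> : stdd (u - th) = stdd u * expR (t - 2^-1 * nrm2 th).
  rewrite /std_density nB -mulrA -expRD; congr (_ * expR _); by field.
rewrite -mulrDr -[leLHS]mulr1 ler_wpM2l ?std_density_ge0//.
have := expR_ge1Dx (t - 2^-1 * nrm2 th).
set x := nrm2 th / e.
have thE : nrm2 th = x * e by rewrite /x divfK// gt_eqF.
have x0 : 0 <= x by rewrite divr_ge0 ?nrm2_ge0// ltW.
have u0 := nrm2_ge0 u.
have th1 : nrm2 th <= x by rewrite thE ler_piMr.
have te : - t <= (nrm2 u * x + e) / 2.
  have : (t + e) ^+ 2 / e >= 0 by rewrite divr_ge0 ?sqr_ge0// ltW.
  have -> : (t + e) ^+ 2 / e = t ^+ 2 / e + 2 * t + e by field; rewrite gt_eqF.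
  have : t ^+ 2 / e <= nrm2 u * x by rewrite ler_pdivrMr// -mulrA -thE.
  lra.
have ue : 0 <= nrm2 u * e by rewrite mulr_ge0// ltW.
have ux : 0 <= nrm2 u * x by rewrite mulr_ge0.
nra.
Qed.

Definition shift_cst : R := fine (\int[stdn]_w (nrm2 (colv w) + 1)%:E)%E.

Lemma shift_cstE : (\int[stdn]_w (nrm2 (colv w) + 1)%:E = shift_cst%:E)%E.
Proof.
have mn : measurable_fun setT (fun t : T => (nrm2 (colv t))%:E).
  by apply/measurable_EFinP; apply: measurable_nrm2; exact: measurable_colv_id.
rewrite fineK// ge0_fin_numE; last first.
  by apply: integral_ge0 => w _; rewrite lee_fin addr_ge0// nrm2_ge0.
under eq_integral do rewrite EFinD.
rewrite ge0_integralD//; last by move=> w _; rewrite lee_fin nrm2_ge0.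
rewrite lte_add_pinfty ?std_normal_nrm2_lty// integral_cst// mul1e.
by rewrite (_ : _ setT = 1%E) ?ltry//; exact: std_normalT.
Qed.

Lemma shift_cst_ge0 : 0 <= shift_cst.
Proof.
by rewrite fine_ge0// integral_ge0// => w _; rewrite lee_fin addr_ge0// nrm2_ge0.
Qed.

Lemma measurable_set_shift (A : set T) th : measurable A ->
  measurable [set w : T | A (tupv (colv w + th))].
Proof.
move=> mA; rewrite -[X in measurable X]setTI.
apply: (measurable_tupv _ measurableT mA).
by apply: measurable_vecD; [exact: measurable_colv_id|exact: measurable_vec_cst].
Qed.

Lemma std_normal_shift (A : set T) (th : 'cV[R]_p) (e : R) :
  measurable A -> 0 < e <= 1 ->
  (stdn A <= stdn [set w | A (tupv (colv w + th))] +
             (shift_cst * (nrm2 th / e + e))%:E)%E.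
Proof.
move=> mA e01; have mcol := measurable_colv_id.
have mAt := measurable_set_shift th mA.
have md u : measurable_fun setT (fun t : T => stdd (colv t + u)).
  by apply: measurable_std_density; apply: measurable_vecD => //; exact: measurable_vec_cst.
have md0 : measurable_fun setT (fun t : T => stdd (colv t)) by exact: measurable_std_density.
have D0 := @std_density_ge0 R p.
set K := nrm2 th / e + e.
have K0 : 0 <= K.
  by case/andP: e01 => e0 _; rewrite addr_ge0 ?divr_ge0 ?nrm2_ge0// ltW.
rewrite (transports_sub (@std_normal_density R p) mA).
rewrite (transports_sub (@std_normal_density R p) mAt).
have -> : (\int[lebp]_x (\1_[set w | A (tupv (colv w + th))] (idfun x) *
    stdd (colv x))%:E = \int[lebp]_x (\1_A x * stdd (colv x - th))%:E)%E.
  rewrite [RHS](lebesgue_vect_shift th); first last.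
  - by move=> x; rewrite lee_fin mulr_ge0.
  - by apply/measurable_EFinP; apply: measurable_funM => //; exact: md.
  by apply: eq_integral => x _; rewrite mule1 tupvK addrK; congr (_ * _)%:E.
have mn : measurable_fun setT (fun t : T => (nrm2 (colv t) + 1)).
  by apply: measurable_funD => //; exact: measurable_nrm2.
have n0 (t : T) : 0 <= nrm2 (colv t) + 1 by rewrite addr_ge0// nrm2_ge0.
have mK : measurable_fun setT (fun t : T =>
    (K%:E * (nrm2 (colv t) + 1)%:E * (stdd (colv t))%:E)%E).
  apply: emeasurable_funM; last exact/measurable_EFinP.
  by apply: emeasurable_funM => //; exact/measurable_EFinP.
rewrite mulrC EFinM -shift_cstE -ge0_integralZl_EFin//; first last.
- exact/measurable_EFinP.
- by move=> t _; rewrite lee_fin.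
rewrite (@std_normal_density R p (fun t => (K%:E * (nrm2 (colv t) + 1)%:E)%E)); first last.
- by move=> t; rewrite -EFinM lee_fin mulr_ge0.
- by apply: emeasurable_funM => //; exact/measurable_EFinP.
rewrite -ge0_integralD//; first last.
- move=> t _; rewrite -!EFinM lee_fin; apply: mulr_ge0; last exact: D0.
  by apply: mulr_ge0 => //; exact: n0.
- by apply/measurable_EFinP; apply: measurable_funM => //; exact: md.
- by move=> t _; rewrite lee_fin mulr_ge0.
apply: ge0_le_integral => //.
- by move=> t _; rewrite lee_fin; apply: mulr_ge0 => //; exact: D0.
- by apply/measurable_EFinP => /=; apply: measurable_funM => //; exact: measurable_indic.
- apply: emeasurable_funD.
    by apply/measurable_EFinP; apply: measurable_funM => //; exact: md.
  exact: mK.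
move=> t _; rewrite -!EFinM -EFinD lee_fin.
have := std_density_shift (colv t) th e01; rewrite -/K => h.
rewrite indicE; case: (t \in A); rewrite ?mul1r ?mul0r ?add0r.
  by apply: le_trans h _; rewrite le_eqVlt; apply/orP; left; apply/eqP; ring.
by apply: mulr_ge0; [apply: mulr_ge0 => //; exact: n0|exact: D0].
Qed.

(** Total variation between two shifted normal laws, in a form that is linear
    in the squared distance of the means and can therefore be averaged over
    them; the weight [e] is chosen according to that distance in the end. *)
Lemma mvnormal_shift (V : 'M[R]_p) (A : set T) (m m' : 'cV[R]_p) (e : R) :
  possemidefmx V -> V \in unitmx -> measurable A -> 0 < e <= 1 ->
  (mvnormal m V A <= mvnormal m' V A +
     (shift_cst * (qform (invmx V) (m - m') / e + e))%:E)%E.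
Proof.
move=> V0 uV mA e01; have uS := sqrtmx_unit V0 uV.
set iS := invmx (sqrtmx V).
pose A' := [set w : T | A (tupv (m + sqrtmx V *m colv w))].
have mA' : measurable A'.
  by rewrite -[X in measurable X]setTI; exact: measurable_affine.
have := std_normal_shift (iS *m (m' - m)) mA' e01.
rewrite nrm2_sqrt_inv//.
have -> : qform (invmx V) (m' - m) = qform (invmx V) (m - m').
  have -> : m' - m = -1 *: (m - m') by rewrite scaleN1r opprB.
  by rewrite qformE bformZl bformZr mulrA mulrNN !mul1r.
suff -> : [set w : T | A' (tupv (colv w + iS *m (m' - m)))] =
    (fun w => tupv (m' + sqrtmx V *m colv w)) @^-1` A by [].
apply/seteqP; split => w; rewrite /A'/= tupvK mulmxDr mulKVmx//;
  by rewrite addrCA [m + _]addrC subrK [_ + m']addrC.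
Qed.

End gaussian_vectors.

(** * Markov chains driven by random maps *)

Section integral_of_sets.
Context d (T : measurableType d) (R : realType).
Import HBNNSimple.

(** The integral only depends on the values of the measure on measurable sets.
    This is how a kernel given as a bare set function is replaced by an image
    measure. *)
Lemma integral_eq_sets (mu nu : set T -> \bar R) (D : set T) (g : T -> \bar R) :
  (forall A, measurable A -> mu A = nu A) ->
  (\int[mu]_(x in D) g x = \int[nu]_(x in D) g x)%E.
Proof.
move=> munu; have E (h : {nnsfun T >-> R}) : sintegral mu h = sintegral nu h.
  rewrite /sintegral; apply: eq_fsbigr => r _; congr (_ * _)%E; apply: munu.
  by rewrite -[X in measurable X]setTI; exact: (measurable_funP h).
by rewrite /integral; congr (ereal_sup _ - ereal_sup _)%E;
  apply/seteqP; split => _ [h hg <-]; exists h => //.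
Qed.

End integral_of_sets.

Section image_probability.
Context d1 d2 (T1 : measurableType d1) (T2 : measurableType d2) (R : realType).
Variables (mu : {measure set T1 -> \bar R}) (f : T1 -> T2).
Hypotheses (mu1 : mu setT = 1%E) (mf : measurable_fun setT f).

Let image_law : set T2 -> \bar R := pushforward mu f.

Let image_law0 : image_law set0 = 0%E.
Proof. by rewrite /image_law /pushforward preimage_set0 measure0. Qed.

Let image_law_ge0 A : (0 <= image_law A)%E.
Proof. exact: (measure_ge0 mu). Qed.

Let image_law_sigma_additive : semi_sigma_additive image_law.
Proof.
exact: (@measure_semi_sigma_additive _ _ _
  (measure_function_pushforward__canonical__measure_function_Measure mu mf)).
Qed.

HB.instance Definition _ := isMeasure.Build _ _ _ image_law
  image_law0 image_law_ge0 image_law_sigma_additive.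

Let image_law1 : image_law setT = 1%E.
Proof. by rewrite /image_law /pushforward preimage_setT. Qed.

HB.instance Definition _ := Measure_isProbability.Build _ _ _ image_law image_law1.

Lemma image_probability : exists nu : probability T2 R,
  (forall A, nu A = mu (f @^-1` A)) /\
  forall g : T2 -> \bar R, measurable_fun setT g -> (forall x, 0 <= g x)%E ->
    (\int[nu]_x g x = \int[mu]_x g (f x))%E.
Proof.
exists image_law; split => // g mg g0.
by rewrite /image_law (ge0_integral_pushforward mf).
Qed.

End image_probability.

Section random_maps.
Context d d' (T : measurableType d) (O : measurableType d') (R : realType).
(* The chain moves from [b] to [F b o], with [o] drawn from [P]. *)
Variable P : {sigma_finite_measure set O -> \bar R}.
Hypothesis P1 : P setT = 1%E.
Variable F : T -> O -> T.
Hypothesis mF : measurable_fun setT (fun z : T * O => F z.1 z.2).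
Variable K : T -> set T -> \bar R.
Hypothesis KE : forall b A, measurable A -> K b A = P (F b @^-1` A).

Lemma measurable_random_map b : measurable_fun setT (F b).
Proof. exact: (measurableT_comp mF (pair1_measurable b)). Qed.

Lemma integral_kernel b (g : T -> \bar R) :
  measurable_fun setT g -> (forall x, 0 <= g x)%E ->
  (\int[K b]_x g x = \int[P]_o g (F b o))%E.
Proof.
move=> mg g0; rewrite (integral_eq_sets _ _ (nu := pushforward P (F b))).
  by rewrite (ge0_integral_pushforward (measurable_random_map b)).
by move=> A mA; rewrite KE.
Qed.

Lemma kernel_iterS m b A : measurable_fun setT (kernel_iter K m ^~ A) ->
  (forall x, 0 <= kernel_iter K m x A)%E ->
  kernel_iter K m.+1 b A = (\int[P]_o kernel_iter K m (F b o) A)%E.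
Proof. by move=> mK K0; exact: integral_kernel. Qed.

Lemma integral_const1 d0 (T0 : measurableType d0)
    (mu : {measure set T0 -> \bar R}) (c : \bar R) :
  mu setT = 1%E -> (\int[mu]_x c = c)%E.
Proof. by move=> mu1; rewrite integral_cst// mu1 mule1. Qed.

Lemma measurable_kernel_iter m A : measurable A ->
  measurable_fun setT (kernel_iter K m ^~ A) /\
  forall b, (0 <= kernel_iter K m b A <= 1)%E.
Proof.
move=> mA; elim: m => [|m [mK K01]].
  split=> [|b]; last by rewrite /= diracE lee_fin lee_fin ler0n lern1 leq_b1.
  by apply/measurable_EFinP; exact: measurable_indic.
have K0 x : (0 <= kernel_iter K m x A)%E by case/andP: (K01 x).
have E b := kernel_iterS b mK K0.
split=> [|b].
  under eq_fun do rewrite E.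
  apply: (measurable_fun_fubini_tonelli_F (m2 := P)
    (fun z => kernel_iter K m (F z.1 z.2) A)) => //.
  exact: (measurableT_comp mK mF).
rewrite E integral_ge0//=.
rewrite -[leRHS](@integral_const1 _ _ P)//; apply: ge0_le_integral => //.
- by apply: (measurableT_comp mK); exact: measurable_random_map.
- by move=> o _; case/andP: (K01 (F b o)).
Qed.

Definition joint_map (z : (T * T) * O) : T * T := (F z.1.1 z.2, F z.1.2 z.2).

Lemma measurable_joint_map : measurable_fun setT joint_map.
Proof.
have m1 : measurable_fun setT (fun z : (T * T) * O => (z.1.1, z.2)).
  apply: measurable_fun_pair => //.
  exact: (measurableT_comp measurable_fst measurable_fst).
have m2 : measurable_fun setT (fun z : (T * T) * O => (z.1.2, z.2)).
  apply: measurable_fun_pair => //.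
  exact: (measurableT_comp measurable_snd measurable_fst).
by apply: measurable_fun_pair; [exact: (measurableT_comp mF m1)|exact: (measurableT_comp mF m2)].
Qed.

Variable psi2 : T -> T -> R.
Hypothesis mpsi2 : measurable_fun setT (fun z : T * T => psi2 z.1 z.2).
Hypothesis psi2_ge0 : forall x y, 0 <= psi2 x y.
Hypothesis psi2C : forall x y, psi2 x y = psi2 y x.
Variable rho : R.
Hypothesis rho01 : 0 < rho <= 1.
Hypothesis contraction : forall x y,
  (\int[P]_o (psi2 (F x o) (F y o))%:E <= (rho ^+ 2 * psi2 x y)%:E)%E.

(** Both coordinates move with the same noise. The new pair couples the
    [m]-step laws of the two marginals, and its expected squared distance
    contracts [m] times. *)
Lemma coupling_iter m (u : probability (T * T)%type R) :
  exists u' : probability (T * T)%type R,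
    (forall A, measurable A ->
      u' (A `*` setT) = (\int[u]_z kernel_iter K m z.1 A)%E /\
      u' (setT `*` A) = (\int[u]_z kernel_iter K m z.2 A)%E) /\
    (\int[u']_z (psi2 z.1 z.2)%:E <=
      ((rho ^+ 2) ^+ m)%:E * \int[u]_z (psi2 z.1 z.2)%:E)%E.
Proof.
elim: m u => [|m IHm] u.
  exists u; split; last by rewrite expr0 mul1e.
  move=> A mA; split.
    rewrite -[in LHS](setIT (A `*` setT)) -integral_indic//; last exact: measurableX.
    apply: eq_integral => z _; rewrite /= diracE indicE; congr (_%:R%:E).
    by congr nat_of_bool; apply/idP/idP; rewrite !inE//= => -[].
  rewrite -[in LHS](setIT (setT `*` A)) -integral_indic//; last exact: measurableX.
  apply: eq_integral => z _; rewrite /= diracE indicE; congr (_%:R%:E).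
  by congr nat_of_bool; apply/idP/idP; rewrite !inE//= => -[].
have uP1 : (u \x P)%E setT = 1%E.
  rewrite -setXTT product_measure1E//; rewrite P1 mule1; exact: probability_setT.
have [u1 [_ u1E]] := image_probability uP1 measurable_joint_map.
have [u' [u'm u'psi]] := IHm u1.
have u1F (g : T * T -> \bar R) : measurable_fun setT g -> (forall z, 0 <= g z)%E ->
    (\int[u1]_z g z = \int[u]_z \int[P]_o g (F z.1 o, F z.2 o))%E.
  move=> mg g0; rewrite u1E// (fubini_tonelli1 (g \o joint_map))//; last first.
    by move=> z; exact: g0.
  by apply: measurableT_comp => //; exact: measurable_joint_map.
have mp : measurable_fun setT (fun z : T * T => (psi2 z.1 z.2)%:E).
  exact/measurable_EFinP.
exists u'; split=> [A mA|].
  have [mK K01] := measurable_kernel_iter m mA.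
  have K0 x : (0 <= kernel_iter K m x A)%E by case/andP: (K01 x).
  have [-> ->] := u'm A mA; rewrite !u1F//; first last.
  - exact: (measurableT_comp mK).
  - exact: (measurableT_comp mK).
  by split; apply: eq_integral => z _; rewrite kernel_iterS.
apply: (le_trans u'psi); rewrite u1F//; last first.
  by move=> z; rewrite lee_fin.
have r2 : 0 <= rho ^+ 2 := sqr_ge0 rho.
rewrite [in leRHS]exprSr EFinM -muleA lee_wpmul2l ?lee_fin ?(exprn_ge0 _ r2)//=.
rewrite -[leRHS]ge0_integralZl_EFin//.
apply: ge0_le_integral => //.
- by move=> z _; apply: integral_ge0 => o _; rewrite lee_fin.
- apply: (measurable_fun_fubini_tonelli_F (m2 := P)
    (fun z => (psi2 (F z.1.1 z.2) (F z.1.2 z.2))%:E)) => //.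
    exact: (measurableT_comp mp measurable_joint_map).
  by move=> z; rewrite lee_fin.
- by apply: emeasurable_funM.
by move=> z _; rewrite lee_fin.
Qed.

Section stationary.
Variable Pi : probability T R.
Hypothesis stationary : forall A, measurable A -> (\int[Pi]_b K b A = Pi A)%E.

Lemma stationary_iter m A : measurable A ->
  (\int[Pi]_b kernel_iter K m b A = Pi A)%E.
Proof.
move=> mA; elim: m => [|m IHm].
  rewrite -[in RHS](setIT A) -integral_indic//; exact: eq_integral.
have [mK K01] := measurable_kernel_iter m mA.
have K0 x : (0 <= kernel_iter K m x A)%E by case/andP: (K01 x).
pose PK := pushforward (Pi \x P)%E (fun z => F z.1 z.2).
rewrite -IHm; under eq_integral do rewrite kernel_iterS//.
rewrite -(fubini_tonelli1 (fun z => kernel_iter K m (F z.1 z.2) A))//; last first.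
  exact: (measurableT_comp mK mF).
transitivity (\int[PK]_b kernel_iter K m b A)%E.
  by rewrite /PK (ge0_integral_pushforward mF).
apply: integral_eq_sets => B mB; rewrite -stationary// /PK /pushforward.
by apply: eq_integral => b _; rewrite KE// /xsection/=; congr (P _);
  apply/seteqP; split => o; rewrite /= inE.
Qed.

Hypothesis psi2_Pi : forall b, (\int[Pi]_b' (psi2 b b')%:E < +oo)%E.

Lemma mpsi2r b : measurable_fun setT (fun b' => (psi2 b b')%:E).
Proof.
apply/measurable_EFinP; exact: (measurableT_comp mpsi2 (pair1_measurable b)).
Qed.

Definition moment b := fine (\int[Pi]_b' (psi2 b b')%:E)%E.

Lemma momentE b : (\int[Pi]_b' (psi2 b b')%:E = (moment b)%:E)%E.
Proof.
rewrite fineK// ge0_fin_numE//; apply: integral_ge0 => b' _.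
by rewrite lee_fin.
Qed.

Lemma moment_ge0 b : 0 <= moment b.
Proof. by rewrite fine_ge0// integral_ge0// => b' _; rewrite lee_fin. Qed.

(** The coupling starts from [b] and a stationary point, whose expected
    squared distance is finite. *)
Lemma wasserstein_geometric :
  geometric_rates (wasserstein (fun x y => Num.sqrt (psi2 x y))) K Pi rho.
Proof.
have [r0 r1] := andP rho01.
split; first by rewrite ltW.
exists (fun b => (moment b + 1) / 2); split.
  by move=> b; rewrite divr_ge0// addr_ge0// moment_ge0.
move=> m b _; set rm := rho ^+ m.
have rm0 : 0 < rm by rewrite exprn_gt0.
have mp : measurable_fun setT (fun z : T * T => (psi2 z.1 z.2)%:E).
  exact/measurable_EFinP.
have [u [_ uE]] := image_probability (@probability_setT _ _ _ Pi) (pair1_measurable b).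
have [u' [u'm u'psi]] := coupling_iter m u.
apply: ereal_inf_le; exists (\int[u']_z (Num.sqrt (psi2 z.1 z.2))%:E)%E.
  exists u' => // A mA; have [-> ->] := u'm A mA.
  have [mK K01] := measurable_kernel_iter m mA.
  have K0 x : (0 <= kernel_iter K m x A)%E by case/andP: (K01 x).
  rewrite !uE//=; first last.
  - exact: (measurableT_comp mK).
  - exact: (measurableT_comp mK).
  by rewrite stationary_iter// integral_const1//; exact: probability_setT.
move: u'psi; rewrite uE//=; last by move=> z; rewrite lee_fin.
rewrite momentE -EFinM => u'psi.
have msq : measurable_fun setT (fun z : T * T => Num.sqrt (psi2 z.1 z.2)).
  exact: (measurableT_comp (continuous_measurable_fun (@sqrt_continuous R)) mpsi2).
(* [sqrt s <= (s / rm + rm) / 2] trades the first moment for the second. *)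
apply: (@le_trans _ _ (\int[u']_z ((2 * rm)^-1%:E * (psi2 z.1 z.2)%:E + (rm / 2)%:E))%E).
  apply: ge0_le_integral => //.
  - exact/measurable_EFinP.
  - by apply: emeasurable_funD => //; exact: emeasurable_funM.
  move=> z _; rewrite -EFinM -EFinD lee_fin.
  set s := psi2 _ _; have s0 : 0 <= s := psi2_ge0 _ _.
  rewrite -[in leRHS](sqr_sqrtr s0); set t := Num.sqrt s.
  have : 0 <= (t - rm) ^+ 2 / (2 * rm) by rewrite divr_ge0 ?sqr_ge0// mulr_ge0// ltW.
  have -> : (t - rm) ^+ 2 / (2 * rm) = (2 * rm)^-1 * t ^+ 2 + rm / 2 - t.
    by field; rewrite gt_eqF.
  lra.
have i0 : 0 <= (2 * rm)^-1 by rewrite invr_ge0 mulr_ge0// ltW.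
rewrite ge0_integralD//; first last.
- by move=> z _; rewrite lee_fin divr_ge0// ltW.
- exact: emeasurable_funM.
- by move=> z _; rewrite mule_ge0// lee_fin.
rewrite ge0_integralZl_EFin//; last by move=> z _; rewrite lee_fin.
rewrite integral_const1; last exact: probability_setT.
apply: le_trans (leeD2r _ (lee_wpmul2l _ u'psi)) _; first by rewrite lee_fin.
rewrite -EFinM -EFinD lee_fin le_eqVlt; apply/orP; left; apply/eqP.
rewrite -exprM mulnC exprM -/rm.
by field; rewrite gt_eqF.
Qed.

Variable C : R.
Hypothesis C_ge0 : 0 <= C.
Hypothesis smoothing : forall A x y e, measurable A -> 0 < e <= 1 ->
  (K x A <= K y A + (C * (rho ^+ 2 * psi2 x y / e + e))%:E)%E.

(** The first [m] steps bring the two chains close to each other, the last one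
    turns closeness into overlap of the laws; with [e] fixed throughout, the
    induction takes expectations over the first step. *)
Lemma smoothing_iter m A x y e : measurable A -> 0 < e <= 1 ->
  (kernel_iter K m.+1 x A <=
   kernel_iter K m.+1 y A + (C * ((rho ^+ 2) ^+ m.+1 * psi2 x y / e + e))%:E)%E.
Proof.
move=> mA e01; have [e0 e1] := andP e01.
have r2 : 0 <= rho ^+ 2 := sqr_ge0 rho.
elim: m x y => [|m IHm] x y.
  have KE1 b : kernel_iter K 1 b A = K b A.
    have [mK K01] := measurable_kernel_iter 0 mA.
    have K0 z : (0 <= kernel_iter K 0 z A)%E by case/andP: (K01 z).
    rewrite kernel_iterS// KE// -[in RHS](setIT (F b @^-1` A)) -integral_indic//.
    by rewrite -[X in measurable X]setTI; exact: measurable_random_map.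
  by rewrite !KE1 expr1; exact: smoothing.
have [mK K01] := measurable_kernel_iter m.+1 mA.
have K0 z : (0 <= kernel_iter K m.+1 z A)%E by case/andP: (K01 z).
rewrite (kernel_iterS x mK K0) (kernel_iterS y mK K0).
set c := (rho ^+ 2) ^+ m.+1 in IHm *.
have c0 : 0 <= c by rewrite exprn_ge0.
pose pF o : R := psi2 (F x o) (F y o).
have mpF : measurable_fun setT pF.
  have mxy : measurable_fun setT (fun o => (F x o, F y o)).
    by apply: measurable_fun_pair; exact: measurable_random_map.
  exact: (measurableT_comp mpsi2 mxy).
have mKF b : measurable_fun setT (fun o => kernel_iter K m.+1 (F b o) A).
  exact: (measurableT_comp mK (measurable_random_map b)).
apply: (@le_trans _ _ (\int[P]_o (kernel_iter K m.+1 (F y o) A +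
    ((C * c / e)%:E * (pF o)%:E + (C * e)%:E)))%E).
  apply: ge0_le_integral => //.
  - apply: emeasurable_funD => //; apply: emeasurable_funD => //.
    by apply: emeasurable_funM => //; exact/measurable_EFinP.
  - move=> o _; apply: le_trans (IHm (F x o) (F y o)) _.
    rewrite -EFinM -EFinD leeD2l// lee_fin le_eqVlt; apply/orP; left; apply/eqP.
    by rewrite /pF; field; rewrite gt_eqF.
have k0 : 0 <= C * c / e by rewrite divr_ge0 ?(ltW e0)// mulr_ge0.
have ke0 : 0 <= C * e by rewrite mulr_ge0// ltW.
rewrite ge0_integralD//; first last.
- by apply: emeasurable_funD => //; apply: emeasurable_funM => //; exact/measurable_EFinP.
- by move=> o _; rewrite -EFinM -EFinD lee_fin addr_ge0// mulr_ge0//; exact: psi2_ge0.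
rewrite leeD2l// ge0_integralD//; first last.
- by apply: emeasurable_funM => //; exact/measurable_EFinP.
- by move=> o _; rewrite -EFinM lee_fin mulr_ge0//; exact: psi2_ge0.
rewrite ge0_integralZl_EFin//; first last.
- exact/measurable_EFinP.
- by move=> o _; rewrite lee_fin; exact: psi2_ge0.
rewrite integral_const1//.
apply: le_trans (leeD2r _ (lee_wpmul2l _ (contraction x y))) _; first by rewrite lee_fin.
rewrite -EFinM -EFinD lee_fin [in leRHS]exprSr -/c le_eqVlt; apply/orP; left; apply/eqP.
by field; rewrite gt_eqF.
Qed.

(** The choice [e = rho ^+ m] in [smoothing_iter] balances the two terms. *)
Lemma total_variation_geometric :
  geometric_rates (@Defs.total_variation _ T R) K Pi rho.
Proof.
have [r0 r1] := andP rho01.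
split; first by rewrite ltW.
exists (fun b => C * (moment b + 1)); split.
  by move=> b; rewrite mulr_ge0// addr_ge0// moment_ge0.
case=> [//|m] b _; set rm := rho ^+ m.+1.
have rm0 : 0 < rm by rewrite exprn_gt0.
have rm1 : rm <= 1 by rewrite exprn_ile1// ltW.
have rm01 : 0 < rm <= 1 by rewrite rm0.
apply: ge_ereal_sup => _ [A mA <-].
have [mK K01] := measurable_kernel_iter m.+1 mA.
have K0 z : (0 <= kernel_iter K m.+1 z A)%E by case/andP: (K01 z).
pose D := C * (moment b + 1) * rm.
have cE : (rho ^+ 2) ^+ m.+1 = rm ^+ 2 by rewrite -exprM mulnC exprM.
pose h b' := ((C * rm)%:E * (psi2 b b')%:E + (C * rm)%:E)%E.
have Crm : 0 <= C * rm by rewrite mulr_ge0// ltW.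
have mh1 : measurable_fun setT (fun b' => (C * rm)%:E * (psi2 b b')%:E)%E.
  by apply: emeasurable_funM => //; exact: mpsi2r.
have mh : measurable_fun setT h by exact: emeasurable_funD.
have h0 b' : (0 <= h b')%E by rewrite /h -EFinM -EFinD lee_fin addr_ge0// mulr_ge0.
have hE x y : (kernel_iter K m.+1 x A <= kernel_iter K m.+1 y A +
    ((C * rm)%:E * (psi2 x y)%:E + (C * rm)%:E))%E.
  apply: le_trans (smoothing_iter m x y mA rm01) _.
  rewrite -EFinM -EFinD leeD2l// lee_fin cE le_eqVlt; apply/orP; left; apply/eqP.
  by field; rewrite gt_eqF.
have hI : (\int[Pi]_b' h b' = D%:E)%E.
  rewrite /h ge0_integralD//; last by move=> b' _; rewrite -EFinM lee_fin mulr_ge0.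
  rewrite ge0_integralZl_EFin//; first last.
  - exact: mpsi2r.
  - by move=> b' _; rewrite lee_fin.
  rewrite momentE integral_const1; last exact: probability_setT.
  rewrite -EFinM -EFinD; congr EFin.
  by rewrite /D; ring.
have Kfin z : kernel_iter K m.+1 z A \is a fin_num.
  by rewrite ge0_fin_numE// (le_lt_trans (proj2 (andP (K01 z))))// ltry.
have Pfin : Pi A \is a fin_num by exact: fin_num_measure.
have up : (kernel_iter K m.+1 b A <= Pi A + D%:E)%E.
  rewrite -[leLHS](@integral_const1 _ _ Pi); last exact: probability_setT.
  rewrite -(stationary_iter m.+1 mA) -hI -ge0_integralD//.
  by apply: ge0_le_integral => //; [exact: emeasurable_funD|move=> b' _; exact: hE].
have dn : (Pi A <= kernel_iter K m.+1 b A + D%:E)%E.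
  rewrite -(stationary_iter m.+1 mA).
  rewrite -[X in (_ <= X + _)%E](@integral_const1 _ _ Pi); last exact: probability_setT.
  rewrite -hI -ge0_integralD//.
  apply: ge0_le_integral => //; first exact: emeasurable_funD.
  by move=> b' _; rewrite /h psi2C; exact: hE.
move: up dn; rewrite -(fineK (Kfin b)) -(fineK Pfin) -!EFinD abse_EFin !lee_fin.
by rewrite ler_norml => up dn; apply/andP; split; rewrite -/D; lra.
Qed.

End stationary.
End random_maps.

(** * One step of the Albert-Chib chain *)

Section second_moment.
Variable R : realType.
Local Notation N01 := (normal_prob (0 : R) 1).

Lemma nrm2DZ p (u w : 'cV[R]_p) (t : R) :
  nrm2 (u + t *: w) = nrm2 u + 2 * t * bform 1%:M u w + t ^+ 2 * nrm2 w.
Proof. by rewrite -!bform1 -!qformE qformDZ// trmx1. Qed.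

(** The variance of a sum of independent terms is the sum of the variances; in
    this way the random matrix is only ever applied to one fixed vector. *)
Lemma second_moment n p (d : 'I_n -> R -> R) (e : 'I_n -> R)
    (a : 'I_n -> 'cV[R]_p) (c : 'cV[R]_p) :
  (forall i, measurable_fun setT (d i)) -> (forall i x, 0 <= d i x <= 1) ->
  (forall i, \int[N01]_x (d i x)%:E = (e i)%:E)%E ->
  (\int[std_normal R n]_u (nrm2 (c + \sum_i d i (tnth u i) *: a i))%:E <=
   (nrm2 (c + \sum_i e i *: a i) + \sum_i nrm2 (a i))%:E)%E.
Proof.
elim: n d e a c => [|n IHn] d e a c md d01 de.
  rewrite /std_normal integral_tuple0; last by move=> u; rewrite lee_fin nrm2_ge0.
  by rewrite !big_ord0 !addr0.
have msum m (d' : 'I_m -> R -> R) (a' : 'I_m -> 'cV[R]_p) c' :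
    (forall i, measurable_fun setT (d' i)) ->
    measurable_fun setT (fun u : m.-tuple (measurableTypeR R) =>
      nrm2 (c' + \sum_i d' i (tnth u i) *: a' i)).
  move=> md'; apply: measurable_nrm2; apply: measurable_vecD.
    exact: measurable_vec_cst.
  move=> k; under eq_fun do rewrite summxE.
  apply: measurable_sumr => i; under eq_fun do rewrite mxE.
  by apply: measurable_funM => //; apply: (measurableT_comp (md' i)); exact: measurable_tnth.
rewrite /std_normal [leLHS]integral_tcons; first last.
- by move=> u; rewrite lee_fin nrm2_ge0.
- by apply/measurable_EFinP; exact: msum.
set c' := c + \sum_(i < n) e (lift ord0 i) *: a (lift ord0 i).
set k := \sum_(i < n) nrm2 (a (lift ord0 i)).
have k0 : 0 <= k by apply: sumr_ge0 => i _; exact: nrm2_ge0.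
pose e0 := e ord0; pose a0 := a ord0; pose d0 := d ord0.
have d00 x : 0 <= d0 x by case/andP: (d01 ord0 x).
have d0B x : 0 <= 1 - d0 x by rewrite subr_ge0; case/andP: (d01 ord0 x).
have md0 : measurable_fun setT d0 by exact: md.
have md0B : measurable_fun setT (fun x => 1 - d0 x) by exact: measurable_funB.
have E1 : (\int[N01]_x (1 - d0 x)%:E = (1 - e0)%:E)%E.
  have h : (\int[N01]_x (1 - d0 x)%:E + \int[N01]_x (d0 x)%:E = 1)%E.
    rewrite -ge0_integralD//; first last.
    - exact/measurable_EFinP.
    - by move=> x _; rewrite lee_fin.
    - exact/measurable_EFinP.
    - by move=> x _; rewrite lee_fin.
    under eq_integral do rewrite -EFinD subrK.
    by rewrite integral_const1//; exact: probability_setT.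
  move: h; rewrite de -/e0; case: (integral _ _ _) => [r|//|//].
  by rewrite -EFinD => -[<-]; rewrite addrK.
have nE : nrm2 (c' + a0) = nrm2 c' + 2 * bform 1%:M c' a0 + nrm2 a0.
  by rewrite -[in LHS](scale1r a0) nrm2DZ expr1n mulr1 mul1r.
(* Convexity in the coefficient of [a ord0] bounds the square by an affine
   function with nonnegative coefficients. *)
apply: (@le_trans _ _ (\int[N01]_x ((nrm2 c')%:E * (1 - d0 x)%:E +
   ((nrm2 (c' + a0))%:E * (d0 x)%:E + k%:E)))%E).
  apply: ge0_le_integral => //.
  - by move=> x _; apply: integral_ge0 => u _; rewrite lee_fin nrm2_ge0.
  - apply: (measurable_fun_fubini_tonelli_F (m2 := std_normal R n)
      (fun z => (nrm2 (c + \sum_i d i (tnth (tcons z) i) *: a i))%:E)).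
      apply/measurable_EFinP.
      exact: (measurableT_comp (msum _ d a c md) (@measurable_tcons _ (measurableTypeR R) n)).
    by move=> z; rewrite lee_fin nrm2_ge0.
  - apply: emeasurable_funD; first by apply: emeasurable_funM => //; exact/measurable_EFinP.
    by apply: emeasurable_funD => //; apply: emeasurable_funM => //; exact/measurable_EFinP.
  move=> x _; apply: le_trans.
    rewrite (_ : (\int[_]_t _)%E = (\int[std_normal R n]_t
        (nrm2 ((c + d0 x *: a0) + \sum_i d (lift ord0 i) (tnth t i) *: a (lift ord0 i)))%:E)%E).
      apply: (IHn (fun i => d (lift ord0 i)) (fun i => e (lift ord0 i))) => //.
    apply: eq_integral => t _; rewrite big_ord_recl addrA tnth_tcons0.
    by congr (nrm2 (_ + _))%:E; apply: eq_bigr => i _; rewrite tnth_tconsS.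
  rewrite -!EFinM -!EFinD lee_fin -/k addrA lerD2r.
  have -> : c + d0 x *: a0 + \sum_(i < n) e (lift ord0 i) *: a (lift ord0 i) =
      c' + d0 x *: a0 by rewrite addrAC.
  rewrite nE nrm2DZ.
  have := nrm2_ge0 a0; have := d00 x; have := d0B x; set s := d0 x => h1 h2 h3.
  have : 0 <= s * (1 - s) * nrm2 a0 by rewrite !mulr_ge0.
  nra.
have n1 := nrm2_ge0 c'; have n2 := nrm2_ge0 (c' + a0).
have mE1 : measurable_fun setT (fun x => (nrm2 (c' + a0))%:E * (d0 x)%:E)%E.
  by apply: emeasurable_funM => //; exact/measurable_EFinP.
have mE2 : measurable_fun setT (fun x => (nrm2 c')%:E * (1 - d0 x)%:E)%E.
  by apply: emeasurable_funM => //; exact/measurable_EFinP.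
rewrite ge0_integralD//; first last.
- exact: emeasurable_funD.
- by move=> x _; rewrite -EFinM -EFinD lee_fin addr_ge0// mulr_ge0.
- by move=> x _; rewrite -EFinM lee_fin mulr_ge0.
rewrite ge0_integralD//; last by move=> x _; rewrite -EFinM lee_fin mulr_ge0.
rewrite !ge0_integralZl_EFin//; first last.
- exact/measurable_EFinP.
- by move=> x _; rewrite lee_fin.
- exact/measurable_EFinP.
- by move=> x _; rewrite lee_fin.
rewrite E1 de integral_const1//; last exact: probability_setT.
rewrite -/e0 -!EFinM -!EFinD lee_fin !big_ord_recl -/k -/a0 -/e0.
have -> : c + (e0 *: a0 + \sum_(i < n) e (lift ord0 i) *: a (lift ord0 i)) =
  c' + e0 *: a0 by rewrite addrCA addrC.
rewrite nE nrm2DZ.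
have := nrm2_ge0 a0; set s := nrm2 a0 => s0.
have : 0 <= e0 ^+ 2 - e0 + 1.
  by have := sqr_ge0 (e0 - 2^-1); rewrite !expr2; lra.
by move=> /(mulr_ge0 s0); nra.
Qed.

End second_moment.

Section albert_chib_step.
Variables (R : realType) (n p : nat).
Variables (X : 'M[R]_(n, p)) (y : n.-tuple bool) (Q : 'M[R]_p) (v : 'cV[R]_p).
Local Notation RM := (measurableTypeR R).
Local Notation state := (p.-tuple RM).
Local Notation noise := (n.-tuple RM * p.-tuple RM)%type.
Local Notation Sigma := (precision X Q).
Local Notation V := (invmx (precision X Q)).
Local Notation S := (sqrtmx V).
Local Notation mu := (linpred X).

Hypothesis Q0 : possemidefmx Q.
Hypothesis uSigma : Sigma \in unitmx.

Lemma mxEB m1 m2 (A B : 'M[R]_(m1, m2)) i j : (A - B) i j = A i j - B i j.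
Proof. by rewrite !mxE. Qed.

Lemma subDDr (M : zmodType) (s t r : M) : s + r - (t + r) = s - t.
Proof. by rewrite opprD addrACA subrr addr0. Qed.

Lemma qform_gram (u : 'cV[R]_p) : qform (X^T *m X) u = nrm2 (X *m u).
Proof. by rewrite nrm2E trmx_mul /qform !mulmxA. Qed.

Lemma possemidef_precision : possemidefmx Sigma.
Proof.
have [QT Qge] := Q0; split=> [|u].
  by rewrite linearD/= trmx_mul trmxK QT.
by rewrite qformE bformDm -!qformE qform_gram addr_ge0 ?nrm2_ge0.
Qed.

Let V0 : possemidefmx V.
Proof. exact: possemidef_inv possemidef_precision uSigma. Qed.

Let uV : V \in unitmx. Proof. by rewrite unitmx_inv. Qed.

Let ST : S^T = S. Proof. by have [[]] := sqrtmxP V0. Qed.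

Let SS : S *m S = V. Proof. by have [] := sqrtmxP V0. Qed.

Let uS : S \in unitmx. Proof. exact: sqrtmx_unit V0 uV. Qed.

(** The latent variables and the chain as deterministic functions of the current
    state and of standard normal noise that does not depend on it. *)
Definition latent_map (b : state) (u : n.-tuple RM) : n.-tuple RM :=
  [tuple trunc_map (mu b i) (tnth y i) (tnth u i) | i < n].

Definition update_mean (z : n.-tuple RM) : 'cV[R]_p := V *m (X^T *m colv z + Q *m v).

Definition chain_map (b : state) (o : noise) : state :=
  tupv (update_mean (latent_map b o.1) + S *m colv o.2).

Definition noise_law : set noise -> \bar R := (std_normal R n \x std_normal R p)%E.

HB.instance Definition _ := Measure.on noise_law.

Lemma noise_lawT : noise_law setT = 1%E.
Proof.
rewrite -setXTT /noise_law/= product_measure1E//.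
transitivity (1 * 1 : \bar R)%E; last by rewrite mule1.
by congr (_ * _)%E; exact: std_normalT.
Qed.

HB.instance Definition _ := Measure_isProbability.Build _ _ _ noise_law noise_lawT.

Lemma measurable_linpred d (T : measurableType d) (b : T -> state) i :
  measurable_fun setT b -> measurable_fun setT (fun x => mu (b x) i).
Proof.
move=> mb; rewrite /linpred; apply: measurable_vec_mul.
exact: measurable_vec_colv.
Qed.

Lemma measurable_latent_map d (T : measurableType d) (b : T -> state)
    (u : T -> n.-tuple RM) : measurable_fun setT b -> measurable_fun setT u ->
  measurable_fun setT (fun x => latent_map (b x) (u x)).
Proof.
move=> mb mu'; apply/measurable_fun_tnthP => i.
rewrite (_ : _ \o _ = fun x => trunc_map (mu (b x) i) (tnth y i) (tnth (u x) i)).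
  apply: measurable_trunc_map; first exact: measurable_linpred.
  exact: (measurableT_comp (measurable_tnth i)).
by apply/funext => x /=; rewrite tnth_mktuple.
Qed.

Lemma measurable_center d (T : measurableType d) (z : T -> n.-tuple RM) :
  measurable_fun setT z -> measurable_vec (fun x => update_mean (z x)).
Proof.
move=> mz; apply: measurable_vec_mul; apply: measurable_vecD.
  by apply: measurable_vec_mul; exact: measurable_vec_colv.
exact: measurable_vec_cst.
Qed.

Lemma measurable_chain_map :
  measurable_fun setT (fun z : state * noise => chain_map z.1 z.2).
Proof.
apply: measurable_tupv; apply: measurable_vecD.
  apply: measurable_center; apply: measurable_latent_map => //.
  exact: (measurableT_comp measurable_fst measurable_snd).
apply: measurable_vec_mul; apply: measurable_vec_colv.
exact: (measurableT_comp measurable_snd measurable_snd).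
Qed.

Lemma latent_law_map b : transports (std_normal R n) (latent_law X y b)
  (latent_map b) (fun _ => 1).
Proof.
have := @transports_prod _ _ RM RM R n (fun _ => normal_prob (0 : R) 1)
  (fun i => trunc_normal (mu b i) (tnth y i))
  (fun i => trunc_map (mu b i) (tnth y i)) (fun _ _ => 1)
  (fun i => measurable_trunc_map (tnth y i) (@measurable_cst _ _ _ _ setT (mu b i)) (@measurable_id _ _ setT))
  (fun i => @measurable_cst _ _ _ _ _ _) (fun i _ => ler01)
  (fun i => trunc_normal_law (mu b i) (tnth y i)).
move=> H g mg g0; rewrite (H g mg g0); apply: eq_integral => u _.
by rewrite big1.
Qed.

Lemma measurable_mvnormal A : measurable A ->
  measurable_fun setT (fun z : n.-tuple RM => mvnormal (update_mean z) V A).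
Proof.
move=> mA; pose B := [set zw : noise | A (tupv (update_mean zw.1 + S *m colv zw.2))].
have mB : measurable B.
  rewrite -[X in measurable X]setTI; apply: (measurable_tupv _ measurableT mA).
  apply: measurable_vecD; first exact: measurable_center.
  by apply: measurable_vec_mul; apply: measurable_vec_colv.
rewrite (_ : (fun z => _) = std_normal R p \o xsection B).
  exact: measurable_fun_xsection.
apply/funext => z; rewrite /mvnormal /pushforward/= /xsection; congr (std_normal _ _ _).
by apply/seteqP; split => w; rewrite /= inE.
Qed.

Lemma albert_chibE b A : measurable A -> albert_chib X y Q v b A =
  (\int[std_normal R n]_u mvnormal (update_mean (latent_map b u)) V A)%E.
Proof.
move=> mA; rewrite /albert_chib (latent_law_map b (g := fun z => mvnormal (update_mean z) V A)).
- by under eq_integral do rewrite mule1.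
- exact: measurable_mvnormal.
- by move=> z; exact: (measure_ge0 (std_normal R p)).
Qed.

Lemma albert_chib_random_map b A : measurable A ->
  albert_chib X y Q v b A = noise_law (chain_map b @^-1` A).
Proof.
move=> mA; rewrite albert_chibE//; apply: eq_integral => u _.
rewrite /mvnormal /pushforward/= /xsection; congr (std_normal _ _ _).
by apply/seteqP; split => w; rewrite /= inE.
Qed.

Lemma qform_precision_V r : qform Sigma (V *m r) = nrm2 (S *m r).
Proof.
have [VT _] := V0.
rewrite nrm2E trmx_mul ST /qform trmx_mul VT mulmxA mulmxKV//.
by rewrite -[in LHS]SS !mulmxA.
Qed.

Lemma nrm2_sqrt_precision u : nrm2 (invmx S *m u) = qform Sigma u.
Proof. by rewrite nrm2_sqrt_inv// invmxK. Qed.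

Lemma nrm2_design_le w : nrm2 (X *m (S *m w)) <= nrm2 w.
Proof.
have [_ Qge] := Q0.
have -> : nrm2 w = qform Sigma (S *m w).
  by rewrite -nrm2_sqrt_precision mulKmx.
by rewrite [leRHS]qformE bformDm -!qformE qform_gram lerDl.
Qed.

(** The gap between two chains driven by the same noise is a random linear
    combination, with independent coefficients in [0, 1], of the vectors
    [gap_term b b' i]. *)
Definition gap_term (b b' : state) i : 'cV[R]_p :=
  (mu b i - mu b' i) *: (S *m (row i X)^T).

Lemma update_mean_sub z z' :
  update_mean z - update_mean z' = V *m (X^T *m (colv z - colv z')).
Proof. by rewrite /update_mean -mulmxBr subDDr -mulmxBr. Qed.

Lemma latent_gap b b' u i : (colv (latent_map b u) - colv (latent_map b' u)) i 0 =
  trunc_slope (mu b i) (mu b' i) (tnth y i) (tnth u i) * (mu b i - mu b' i).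
Proof.
have E c : colv (latent_map c u) i 0 = trunc_map (mu c i) (tnth y i) (tnth u i).
  by rewrite mxE tnth_mktuple.
transitivity (trunc_map (mu b i) (tnth y i) (tnth u i) -
  trunc_map (mu b' i) (tnth y i) (tnth u i)); last exact: trunc_slopeE.
rewrite mxEB; apply: (f_equal2 (fun s t => s - t)); exact: E.
Qed.

Lemma update_mean_gap b b' u :
  qform Sigma (update_mean (latent_map b u) - update_mean (latent_map b' u)) =
  nrm2 (\sum_i trunc_slope (mu b i) (mu b' i) (tnth y i) (tnth u i) *: gap_term b b' i).
Proof.
rewrite update_mean_sub qform_precision_V; congr (nrm2 _).
have XE (t : 'cV[R]_n) : X^T *m t = \sum_i t i 0 *: (row i X)^T.
  apply/matrixP => j k; rewrite ord1 mxE summxE; apply: eq_bigr => i _.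
  by rewrite !mxE mulrC.
rewrite XE mulmx_sumr; apply: eq_bigr => i _.
by rewrite latent_gap -scalemxAr scalerA.
Qed.

Variables (k rho : R).
Hypothesis k_ge0 : 0 <= k.
(* [k] is the factor by which the mean of the random matrix contracts. *)
Hypothesis balanced : forall (b b' : state) (w : 'cV[R]_p),
  \sum_i mean_slope (mu b i) (mu b' i) (tnth y i) * (row i X *m w) 0 0 ^+ 2 <=
  k * \sum_i (row i X *m w) 0 0 ^+ 2.
Hypothesis k_rho : k ^+ 2 + sigma_design X Q ^+ 2 <= rho ^+ 2.

Let W i := S *m (row i X)^T *m row i X *m S.

Let WT i : (W i)^T = W i.
Proof. by rewrite /W !trmx_mul trmxK ST !mulmxA. Qed.

Let W_mul i w : W i *m w = (row i X *m (S *m w)) 0 0 *: (S *m (row i X)^T).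
Proof.
rewrite /W -!mulmxA [row i X *m _]mx11_scalar.
by rewrite mul_mx_scalar -scalemxAr !mxE.
Qed.

Let qformW i w : qform (W i) w = (row i X *m (S *m w)) 0 0 ^+ 2.
Proof.
rewrite /qform -mulmxA W_mul -scalemxAr mxE expr2; congr (_ * _).
have -> : w^T *m (S *m (row i X)^T) = (row i X *m (S *m w))^T.
  by rewrite !trmx_mul ST mulmxA.
by rewrite mxE.
Qed.

(** The quadratic form of [sum_i W_i ^+ 2], whose largest eigenvalue is the
    square of [sigma_design]. *)
Lemma sigma_design_bound w :
  \sum_i nrm2 (W i *m w) <= sigma_design X Q ^+ 2 * nrm2 w.
Proof.
pose M := \sum_i W i *m W i.
have MT : M^T = M.
  by rewrite /M linear_sum/=; apply: eq_bigr => i _; rewrite trmx_mul WT.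
have -> : \sum_i nrm2 (W i *m w) = qform M w.
  rewrite /qform /M mulmx_sumr mulmx_suml summxE; apply: eq_bigr => i _.
  by rewrite nrm2E trmx_mul WT !mulmxA.
apply: le_trans (qform_le_lambda_max w MT) _; rewrite ler_wpM2r ?nrm2_ge0//.
rewrite /sigma_design -/M.
have [l0|/ltW l0] := leP 0 (lambda_max M); first by rewrite sqr_sqrtr.
by rewrite (le_trans l0)// sqr_ge0.
Qed.

(** The mean of the random matrix contracts by [k], and its fluctuations along
    a fixed direction are controlled by [sigma_design] directly. *)
Lemma update_mean_contraction b b' :
  (\int[std_normal R n]_u
     (qform Sigma (update_mean (latent_map b u) - update_mean (latent_map b' u)))%:E <=
   (rho ^+ 2 * qform Sigma (colv b - colv b'))%:E)%E.
Proof.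
under eq_integral do rewrite update_mean_gap -[\sum_i _]add0r.
have := @second_moment R n p
  (fun i => trunc_slope (mu b i) (mu b' i) (tnth y i))
  (fun i => mean_slope (mu b i) (mu b' i) (tnth y i)) (gap_term b b') 0
  (fun i => measurable_trunc_slope _ _ _) (fun i x => trunc_slope01 _ _ _ x)
  (fun i => mean_slopeE _ _ _).
move=> /le_trans; apply; rewrite lee_fin add0r.
pose w := invmx S *m (colv b - colv b').
have -> : qform Sigma (colv b - colv b') = nrm2 w by rewrite nrm2_sqrt_precision.
have gE i : gap_term b b' i = W i *m w.
  rewrite W_mul /w mulKVmx// /gap_term; congr (_ *: _).
  by rewrite mulmxBr mxEB.
under eq_bigr do rewrite gE scalemxAl.
under [X in _ + X]eq_bigr do rewrite gE.
rewrite -mulmx_suml.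
set M := \sum_i _ *: _.
have qM w' : qform M w' = \sum_i mean_slope (mu b i) (mu b' i) (tnth y i) *
    (row i X *m (S *m w')) 0 0 ^+ 2.
  rewrite /qform /M mulmx_sumr mulmx_suml summxE; apply: eq_bigr => i _.
  by rewrite -scalemxAr -scalemxAl mxE -qformW.
have M0 : possemidefmx M.
  split=> [|w']; first by rewrite /M linear_sum/=; apply: eq_bigr => i _; rewrite linearZ/= WT.
  rewrite qM; apply: sumr_ge0 => i _; rewrite mulr_ge0 ?sqr_ge0//.
  by case/andP: (mean_slope01 (mu b i) (mu b' i) (tnth y i)).
have Mk w' : qform M w' <= k * nrm2 w'.
  rewrite qM (le_trans (balanced b b' (S *m w')))// ler_wpM2l//.
  apply: le_trans (nrm2_design_le w'); rewrite le_eqVlt; apply/orP; left; apply/eqP.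
  by apply: eq_bigr => i _; rewrite -row_mul mxE.
apply: le_trans (lerD (possemidef_le_nrm2 w M0 k_ge0 Mk) (sigma_design_bound w)) _.
by rewrite -mulrDl ler_wpM2r ?nrm2_ge0.
Qed.

Definition psi2 (b b' : state) : R := qform Sigma (colv b - colv b').

Lemma psi2_tupv (a c : 'cV[R]_p) : psi2 (tupv a) (tupv c) = qform Sigma (a - c).
Proof. by rewrite /psi2 !tupvK. Qed.

Lemma psi2_ge0 b b' : 0 <= psi2 b b'.
Proof. by have [_] := possemidef_precision; apply. Qed.

Lemma psi2C b b' : psi2 b b' = psi2 b' b.
Proof.
rewrite /psi2; have -> : colv b' - colv b = -1 *: (colv b - colv b').
  by rewrite scaleN1r opprB.
by rewrite !qformE bformZl bformZr mulrA mulrNN !mul1r.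
Qed.

Lemma measurable_psi2 : measurable_fun setT (fun z : state * state => psi2 z.1 z.2).
Proof.
apply: measurable_qform; apply: measurable_vecD; first exact: measurable_vec_colv.
by apply: measurable_vecN; exact: measurable_vec_colv.
Qed.

Lemma chain_contraction b b' :
  (\int[noise_law]_o (psi2 (chain_map b o) (chain_map b' o))%:E <=
   (rho ^+ 2 * psi2 b b')%:E)%E.
Proof.
have E o : psi2 (chain_map b o) (chain_map b' o) =
    qform Sigma (update_mean (latent_map b o.1) - update_mean (latent_map b' o.1)).
  by rewrite /chain_map psi2_tupv subDDr.
under eq_integral do rewrite E.
rewrite /noise_law (fubini_tonelli1 (fun o : noise =>
  (qform Sigma (update_mean (latent_map b o.1) - update_mean (latent_map b' o.1)))%:E)); first last.
- by move=> o; rewrite lee_fin; have [_] := possemidef_precision; apply.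
- apply/measurable_EFinP; apply: measurable_qform; apply: measurable_vecD.
    by apply: measurable_center; apply: measurable_latent_map.
  by apply: measurable_vecN; apply: measurable_center; apply: measurable_latent_map.
apply: le_trans (update_mean_contraction b b'); rewrite le_eqVlt; apply/orP; left.
apply/eqP; apply: eq_integral => u _.
by rewrite /fubini_F /= integral_const1//; exact: std_normalT.
Qed.

(** Given the same latent noise, the two chains make normal draws with equal
    covariance from means that are close by [update_mean_contraction]. *)
Lemma chain_smoothing A b b' e : measurable A -> 0 < e <= 1 ->
  (albert_chib X y Q v b A <= albert_chib X y Q v b' A +
    (shift_cst R p * (rho ^+ 2 * psi2 b b' / e + e))%:E)%E.
Proof.
move=> mA e01; have [e0 e1] := andP e01; rewrite !albert_chibE//.
have C0 := shift_cst_ge0 R p; set C := shift_cst R p in C0 *.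
pose h u := qform Sigma (update_mean (latent_map b u) - update_mean (latent_map b' u)).
have h0 u : 0 <= h u by have [_] := possemidef_precision; apply.
have ml c : measurable_fun setT (latent_map c) by apply: measurable_latent_map.
have mh : measurable_fun setT h.
  apply: measurable_qform; apply: measurable_vecD; first exact: measurable_center.
  by apply: measurable_vecN; exact: measurable_center.
have mK c : measurable_fun setT (fun u => mvnormal (update_mean (latent_map c u)) V A).
  exact: (measurableT_comp (measurable_mvnormal mA) (ml c)).
have K0 z : (0 <= mvnormal z V A)%E by exact: (measure_ge0 (std_normal R p)).
have Ce : 0 <= C / e by rewrite divr_ge0// ltW.
have Ce' : 0 <= C * e by rewrite mulr_ge0// ltW.
have mCh : measurable_fun setT (fun u => (C / e)%:E * (h u)%:E)%E.
  by apply: emeasurable_funM => //; exact/measurable_EFinP.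
apply: (@le_trans _ _ (\int[std_normal R n]_u (mvnormal (update_mean (latent_map b' u)) V A +
   ((C / e)%:E * (h u)%:E + (C * e)%:E)))%E).
  apply: ge0_le_integral => //.
  - by apply: emeasurable_funD => //; exact: emeasurable_funD.
  - move=> u _; apply: le_trans (mvnormal_shift (update_mean (latent_map b u))
      (update_mean (latent_map b' u)) V0 uV mA e01) _.
    rewrite invmxK -/(h u) -/C leeD2l// -EFinM -EFinD lee_fin le_eqVlt.
    by apply/orP; left; apply/eqP; field; rewrite gt_eqF.
rewrite ge0_integralD//; first last.
- exact: emeasurable_funD.
- by move=> u _; rewrite -EFinM -EFinD lee_fin addr_ge0// mulr_ge0.
rewrite leeD2l// ge0_integralD//; last by move=> u _; rewrite -EFinM lee_fin mulr_ge0.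
rewrite ge0_integralZl_EFin//; first last.
- exact/measurable_EFinP.
- by move=> u _; rewrite lee_fin.
rewrite integral_const1; last exact: std_normalT.
apply: le_trans (leeD2r _ (lee_wpmul2l _ (update_mean_contraction b b'))) _.
  by rewrite lee_fin.
rewrite -EFinM -EFinD lee_fin le_eqVlt; apply/orP; left; apply/eqP.
by rewrite /psi2; field; rewrite gt_eqF.
Qed.

End albert_chib_step.

(** * The posterior distribution *)

Section tails.
Variable R : realType.

Definition sum_abs n (u : 'cV[R]_n) : R := \sum_i `|u i 0|.

Lemma sum_abs_ge0 n (u : 'cV[R]_n) : 0 <= sum_abs u.
Proof. exact: sumr_ge0. Qed.

Lemma sum_abs_mul m n (M : 'M[R]_(m, n)) (t : 'cV[R]_n) B :
  (forall i, `|t i 0| <= B) -> sum_abs (M *m t) <= (\sum_j \sum_i `|M j i|) * B.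
Proof.
move=> tB; rewrite mulr_suml; apply: ler_sum => j _.
rewrite mxE (le_trans (ler_norm_sum _ _ _))// mulr_suml; apply: ler_sum => i _.
by rewrite normrM ler_wpM2l.
Qed.

Lemma qform_le_sum_abs n (A : 'M[R]_n) (u : 'cV[R]_n) :
  qform A u <= (\sum_j \sum_i `|A j i|) * sum_abs u ^+ 2.
Proof.
have uB i : `|u i 0| <= sum_abs u.
  by rewrite /sum_abs (bigD1 i)//= lerDl sumr_ge0.
have := sum_abs_mul A uB; set K := \sum_j _ => h.
rewrite expr2 mulrA; apply: le_trans (ler_wpM2r (sum_abs_ge0 u) h).
rewrite /qform -mulmxA mxE (le_trans (ler_norm _))// (le_trans (ler_norm_sum _ _ _))//.
rewrite [leRHS]mulr_suml; apply: ler_sum => j _; rewrite mxE normrM mulrC.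
by rewrite ler_wpM2l.
Qed.

Lemma normal_cdf_tail_exp (t : R) : 0 <= t ->
  normal_cdf (- t) <= 2 * normal_peak 1 * expR 2^-1 * expR (- t).
Proof.
move=> t0; apply: le_trans (normal_mills t0) _.
have k0 := normal_peak_ge0 (1 : R).
apply: (@le_trans _ _ (normal_pdf 0 1 t * 2)).
  rewrite ler_wpM2l ?normal_pdf_ge0// ler_pdivrMr ?exprn_gt0 ?ltr_wpDl//; nra.
rewrite normal_pdf01E mulrC -!mulrA ler_wpM2l// ler_wpM2l// -expRD ler_expR.
by have := sqr_ge0 (t - 1); rewrite !expr2; lra.
Qed.

Lemma posdefmx_unit n (A : 'M[R]_n) : posdefmx A -> A \in unitmx.
Proof.
move=> [AT A0]; rewrite -row_free_unit; apply: inj_row_free => w wA.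
apply/eqP/negPn/negP => w0; have wT0 : w^T != 0 by rewrite trmx_eq0.
by have := A0 _ wT0; rewrite /qform trmxK wA mul0mx mxE ltxx.
Qed.

Lemma posdefmx_semi n (A : 'M[R]_n) : posdefmx A -> possemidefmx A.
Proof.
move=> [AT A0]; split=> // u; have [->|/A0/ltW//] := eqVneq u 0.
by rewrite /qform mulmx0 mxE.
Qed.

End tails.

Section posterior_tails.
Variables (R : realType) (n p : nat).
Variables (X : 'M[R]_(n, p)) (y : n.-tuple bool) (Q : 'M[R]_p) (v : 'cV[R]_p).
Local Notation RM := (measurableTypeR R).
Local Notation state := (p.-tuple RM).
Local Notation mu := (linpred X).
Local Notation dens := (posterior_density X y Q v).
Local Notation Phi := (@normal_cdf R).

Lemma likelihood_factor (t : R) (a : bool) :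
  Phi t ^+ a * (1 - Phi t) ^+ (1 - a)%N = Phi (bsign R a * t).
Proof.
case: a; rewrite /= ?mul1r ?mulN1r ?expr1 ?expr0 ?mulr1 ?mul1r//.
by rewrite normal_cdfN.
Qed.

Lemma posterior_densityE b : dens b =
  (\prod_i Phi (bsign R (tnth y i) * mu b i)) *
  expR (- (2^-1 * qform Q (colv b - v))).
Proof.
by congr (_ * _); apply: eq_bigr => i _; exact: likelihood_factor.
Qed.

Lemma posterior_density_gt0 b : 0 < dens b.
Proof.
rewrite posterior_densityE mulr_gt0 ?expR_gt0//.
by apply: prodr_gt0 => i _; exact: normal_cdf_gt0.
Qed.

Lemma measurable_posterior_density : measurable_fun setT dens.
Proof.
rewrite (_ : dens = (fun b => (\prod_i Phi (bsign R (tnth y i) * mu b i)) *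
    expR (- (2^-1 * qform Q (colv b - v))))); last first.
  by apply/funext => b; exact: posterior_densityE.
apply: measurable_funM.
  apply: measurable_prodr => i; apply: (measurableT_comp (@measurable_normal_cdf R)).
  by apply: measurable_funM => //; exact: measurable_linpred.
apply: measurableT_comp => //; apply: measurableT_comp => //.
apply: measurable_funM => //; apply: measurable_qform; apply: measurable_vecD.
  exact: measurable_colv_id.
exact: measurable_vec_cst.
Qed.

Definition overlap := forall i, exists2 j, row j X = row i X & tnth y j = ~~ tnth y i.

Lemma likelihood_le_factor b i :
  \prod_i Phi (bsign R (tnth y i) * mu b i) <= Phi (bsign R (tnth y i) * mu b i).
Proof.
rewrite (bigD1 i)//= ler_piMr ?normal_cdf_ge0//.
by apply: Num.Theory.prodr_ile1 => j _; rewrite normal_cdf_ge0 normal_cdf_le1.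
Qed.

Lemma likelihood_le1 b : \prod_i Phi (bsign R (tnth y i) * mu b i) <= 1.
Proof. by apply: Num.Theory.prodr_ile1 => j _; rewrite normal_cdf_ge0 normal_cdf_le1. Qed.

(** Two observations with equal covariates and opposite responses contribute
    [Phi m * Phi (- m)]. *)
Lemma overlap_likelihood b i : overlap ->
  \prod_i Phi (bsign R (tnth y i) * mu b i) <= Phi (- `|mu b i|).
Proof.
move=> ov; have [j ji yj] := ov i.
have mj : mu b j = mu b i by rewrite /linpred ji.
have := likelihood_le_factor b i; have := likelihood_le_factor b j.
rewrite mj yj; case: (tnth y i); rewrite /bsign /= !mul1r !mulN1r => h1 h2.
  by have [m0|/ltW m0] := lerP 0 (mu b i); rewrite ?(ger0_norm m0) ?(ler0_norm m0) ?opprK.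
by have [m0|/ltW m0] := lerP 0 (mu b i); rewrite ?(ger0_norm m0) ?(ler0_norm m0) ?opprK.
Qed.

(** A positive definite prior is Gaussian. With [Q = 0] the map [X] is
    injective, hence some linear predictor is comparable to the size of [b],
    and [overlap_likelihood] applies to it. *)
Lemma posterior_tail : posdefmx Q \/ Q = 0 /\ precision X Q \in unitmx /\ overlap ->
  exists c C : R, [/\ 0 < c, 0 <= C &
    forall b, dens b <= C * expR (- (c * sum_abs (colv b)))].
Proof.
have L0 b : 0 <= \prod_i Phi (bsign R (tnth y i) * mu b i).
  by apply: prodr_ge0 => i _; exact: normal_cdf_ge0.
case=> [Q0|[Q0 [uS ov]]].
  have Q1 := posdefmx_semi Q0; have uQ := posdefmx_unit Q0.
  have uR := sqrtmx_unit Q1 uQ; have [[RT _] RR] := sqrtmxP Q1.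
  set K := \sum_j \sum_i `|invmx (sqrtmx Q) j i|.
  have K0 : 0 <= K by apply: sumr_ge0 => j _; exact: sumr_ge0.
  have K1 : 0 < K + 1 by rewrite ltr_wpDl.
  exists (K + 1)^-1, (expR (2^-1 + (K + 1)^-1 * sum_abs v)); split.
  - by rewrite invr_gt0.
  - exact: expR_ge0.
  move=> b; rewrite posterior_densityE.
  apply: le_trans (ler_wpM2r (expR_ge0 _) (likelihood_le1 b)) _.
  rewrite mul1r -expRD ler_expR.
  set q := qform Q (colv b - v).
  have qE : q = nrm2 (sqrtmx Q *m (colv b - v)).
    by rewrite nrm2E trmx_mul RT /q -[in LHS]RR /qform !mulmxA.
  have q0 : 0 <= q by rewrite qE nrm2_ge0.
  have h : sum_abs (colv b - v) <= K * Num.sqrt q.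
    rewrite -[colv b - v](mulKmx uR); apply: sum_abs_mul => i.
    rewrite -(@ler_pXn2r _ 2) ?nnegrE ?sqrtr_ge0// sqr_sqrtr// real_normK ?num_real//.
    by rewrite qE /nrm2 (bigD1 i)//= lerDl sumr_ge0// => j _; exact: sqr_ge0.
  have s3 : sum_abs (colv b) <= sum_abs (colv b - v) + sum_abs v.
    rewrite /sum_abs -big_split/=; apply: ler_sum => i _.
    by rewrite -{1}[colv b](subrK v) mxE ler_normD.
  move: q0 h; set t := Num.sqrt q => q0 h; have t0 : 0 <= t by exact: sqrtr_ge0.
  have qt : q = t ^+ 2 by rewrite sqr_sqrtr.
  have h2 : (K + 1)^-1 * sum_abs (colv b) <= t + (K + 1)^-1 * sum_abs v.
    rewrite -(ler_pM2l K1) mulrA divff ?gt_eqF// mul1r mulrDr mulrA divff ?gt_eqF// mul1r.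
    by apply: le_trans s3 _; rewrite lerD2r (le_trans h)// mulrDl lerDl mul1r.
  rewrite qt; have := sqr_ge0 (t - 1); move: h2.
  move: (_ * sum_abs (colv b)) (_ * sum_abs v) => A B; rewrite !expr2; lra.
set K := \sum_j \sum_i `|(invmx (precision X Q) *m X^T) j i|.
have K0 : 0 <= K by apply: sumr_ge0 => j _; exact: sumr_ge0.
have K1 : 0 < K + 1 by rewrite ltr_wpDl.
pose C1 : R := 2 * normal_peak 1 * expR 2^-1.
have C10 : 0 <= C1 by rewrite mulr_ge0 ?expR_ge0// mulr_ge0// normal_peak_ge0.
exists (K + 1)^-1, (C1 + 1); split.
- by rewrite invr_gt0.
- by rewrite addr_ge0.
move=> b; rewrite posterior_densityE Q0.
have -> : qform 0 (colv b - v) = 0 by rewrite /qform mulmx0 mul0mx mxE.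
rewrite !mulr0 oppr0 expR0 mulr1.
set s := sum_abs (colv b).
have s0 : 0 <= s := sum_abs_ge0 _.
have [|/forallPn[i]] := boolP [forall i, `|mu b i| <= (K + 1)^-1 * s].
  move=> /forallP h.
  have : s <= K * ((K + 1)^-1 * s).
    have bE : colv b = (invmx (precision X Q) *m X^T) *m (X *m colv b).
      rewrite -mulmxA (mulmxA X^T) [X in _ *m (X *m _)](_ : _ = precision X Q) ?mulKmx//.
      by rewrite /precision Q0 addr0.
    rewrite {1}/s [X in sum_abs X]bE; apply: sum_abs_mul => i.
    apply: le_trans (h i); rewrite le_eqVlt; apply/orP; left; apply/eqP.
    by rewrite /linpred -row_mul [in RHS]mxE.
  rewrite mulrA -subr_ge0 -[X in _ - X]mul1r -mulrBl => hs.
  have sE : s = 0.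
    have e : K / (K + 1) - 1 = - (K + 1)^-1 by field; rewrite gt_eqF.
    move: hs; rewrite e mulNr oppr_ge0 pmulr_rle0 ?invr_gt0// => s1.
    by apply/eqP; rewrite eq_le s1.
  rewrite sE mulr0 oppr0 expR0 mulr1.
  by apply: le_trans (likelihood_le1 b) _; rewrite lerDr.
rewrite -ltNge => h.
apply: le_trans (overlap_likelihood b i ov) _.
apply: le_trans (normal_cdf_tail_exp (normr_ge0 _)) _; rewrite -/C1.
apply: (@le_trans _ _ (C1 * expR (- ((K + 1)^-1 * s)))).
  by rewrite ler_wpM2l// ler_expR lerN2 ltW.
by rewrite ler_wpM2r ?expR_ge0// lerDl.
Qed.

End posterior_tails.

(** * Stationarity of the posterior *)

Section density_probability.
Context d (T : measurableType d) (R : realType).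
Variables (mu : {measure set T -> \bar R}) (f : T -> R).
Hypotheses (mf : measurable_fun setT f) (f_ge0 : forall x, 0 <= f x).
Let mass := fine (\int[mu]_x (f x)%:E)%E.
Hypotheses (mass_lty : (\int[mu]_x (f x)%:E < +oo)%E)
  (mass_gt0 : (0 < \int[mu]_x (f x)%:E)%E).

Lemma density_massE : (\int[mu]_x (f x)%:E = mass%:E)%E.
Proof. by rewrite fineK// ge0_fin_numE// ltW. Qed.

Lemma density_mass_gt0 : 0 < mass.
Proof. by rewrite -lte_fin -density_massE. Qed.

Let law (A : set T) : \bar R := ((\int[mu]_(x in A) (f x)%:E) * (mass^-1)%:E)%E.

Let mf' : measurable_fun setT (EFin \o f). Proof. exact/measurable_EFinP. Qed.

Let law0 : law set0 = 0%E. Proof. by rewrite /law integral_set0 mul0e. Qed.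

Let inv_mass_ge0 : (0 <= (mass^-1)%:E)%E.
Proof. by rewrite lee_fin invr_ge0 ltW// density_mass_gt0. Qed.

Let law_ge0 A : (0 <= law A)%E.
Proof. by rewrite /law mule_ge0// integral_ge0// => x _; rewrite lee_fin. Qed.

Let law_sigma_additive : semi_sigma_additive law.
Proof.
move=> F mF tF mUF; rewrite /law.
have S := @semi_sigma_additive_nng_induced _ T R mu (EFin \o f) mf'
  (fun x => ltac:(rewrite /= lee_fin; exact: f_ge0)) F mF tF mUF.
rewrite (_ : (fun n => _) = (fun n => (\sum_(0 <= i < n) \int[mu]_(x in F i) (f x)%:E) * (mass^-1)%:E)%E).
  by apply: cvgeZr.
apply/funext => n; rewrite ge0_sume_distrl// => i _.
by apply: integral_ge0 => x _; rewrite lee_fin.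
Qed.

HB.instance Definition _ := isMeasure.Build _ _ _ law
  law0 law_ge0 law_sigma_additive.

Let law1 : law setT = 1%E.
Proof.
by rewrite /law density_massE -EFinM divff// gt_eqF// density_mass_gt0.
Qed.

HB.instance Definition _ := Measure_isProbability.Build _ _ _ law law1.

Lemma density_probability : exists Pi : probability T R,
  (Pi : set T -> \bar R) =
    (fun A => (\int[mu]_(x in A) (f x)%:E) *
              ((fine (\int[mu]_x (f x)%:E))^-1)%:E)%E /\
  transports mu Pi idfun (fun x => f x / mass).
Proof.
exists law; split => //; apply: transports_sets.
- exact: measurable_id.
- by apply: (measurable_funM mf); exact: measurable_cst.
- by move=> x; rewrite divr_ge0// ltW// density_mass_gt0.
move=> A mA; rewrite -[LHS]/((\int[mu]_(x in A) (f x)%:E) * (mass^-1)%:E)%E.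
rewrite integral_indicE// -ge0_integralZr//.
- by apply: eq_integral => x _; rewrite -EFinM mulrA.
- by apply/measurable_EFinP; apply: measurable_funM => //; exact: measurable_indic.
- by move=> x _; rewrite lee_fin mulr_ge0.
Qed.

End density_probability.

Section null_density.
Context d (T : measurableType d) (R : realType).

Lemma integral_gt0 (mu : {measure set T -> \bar R}) (f g : T -> R) :
  measurable_fun setT f -> (forall x, 0 < f x) ->
  measurable_fun setT g -> (forall x, 0 <= g x) ->
  (\int[mu]_x (g x)%:E != 0)%E -> (0 < \int[mu]_x (f x)%:E)%E.
Proof.
move=> mf f0 mg g0; apply: contraNT; rewrite -leNgt => If.
have absE (h : T -> R) : (forall x, 0 <= h x) ->
    (\int[mu]_x (h x)%:E = \int[mu]_x `|(EFin \o h) x|)%E.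
  by move=> h0; apply: eq_integral => x _ /=; rewrite ger0_norm.
have /ae_eq_integral_abs : (\int[mu]_x `|(EFin \o f) x| = 0)%E.
  rewrite -absE => [|x]; last exact: ltW.
  by apply/eqP; rewrite eq_le If integral_ge0// => x _; rewrite lee_fin ltW.
move=> /(_ measurableT ((measurable_EFinP _ _).2 mf)) f_ae0.
rewrite absE//; apply/eqP; apply/ae_eq_integral_abs => //; first exact/measurable_EFinP.
apply: filterS f_ae0 => x /= fx0 _; have [fx] := fx0 I.
by have := f0 x; rewrite fx ltxx.
Qed.

End null_density.

Section posterior_law.
Variables (R : realType) (n p : nat).
Variables (X : 'M[R]_(n, p)) (y : n.-tuple bool) (Q : 'M[R]_p) (v : 'cV[R]_p).
Local Notation RM := (measurableTypeR R).
Local Notation state := (p.-tuple RM).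
Local Notation latent := (n.-tuple RM).
Local Notation mu := (linpred X).
Local Notation dens := (posterior_density X y Q v).
Local Notation Sigma := (precision X Q).
Local Notation lebp := (lebesgue_vect R p).
Local Notation lebn := (lebesgue_vect R n).
Local Notation Phi := (@normal_cdf R).
Local Notation phi := (@normal_pdf R 0 1).
Local Notation m := (update_mean X Q v).

Hypothesis Q0 : possemidefmx Q.
Hypothesis uSigma : Sigma \in unitmx.

(** Completing the square in [b]: for fixed latent variables the joint density
    is a multiple of the normal density that the chain draws from. *)
Lemma complete_square (z : latent) (b' : 'cV[R]_p) :
  nrm2 (colv z - X *m b') + qform Q (b' - v) =
  qform Sigma (b' - m z) + (nrm2 (colv z) + qform Q v - qform Sigma (m z)).
Proof.
have [QT _] := Q0; have [ST _] := possemidef_precision X Q0.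
have E1 k (A : 'M[R]_k) (u w : 'cV[R]_k) : A^T = A ->
    qform A (u - w) = qform A u - 2 * bform A u w + qform A w.
  by move=> AT; rewrite -scaleN1r qformDZ//; ring.
rewrite -!bform1 -!qformE !E1//; last exact: trmx1.
have E2 : bform Sigma b' (m z) = bform 1%:M (colv z) (X *m b') + bform Q b' v.
  rewrite -[X in bform X]mul1mx bform_mulr mulKVmx// bformDr -bform_mulr mul1mx.
  congr (_ + _); rewrite /bform !mulmx1.
  have tr11 (A : 'M[R]_1) : A 0 0 = A^T 0 0 by rewrite mxE.
  by rewrite [RHS]tr11 trmx_mul trmxK trmx_mul mulmxA.
rewrite E2 (_ : qform 1%:M (X *m b') = qform (X^T *m X) b'); last first.
  by rewrite qform_gram qformE bform1.
by rewrite [qform Sigma b']qformE bformDm -!qformE; ring.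
Qed.

Definition joint_density (b : state) (z : latent) : R :=
  (\prod_i (\1_[set` halfline R (tnth y i)] (tnth z i) * phi (tnth z i - mu b i))) *
  expR (- (2^-1 * qform Q (colv b - v))).

Local Notation half z := (\prod_i \1_[set` halfline R (tnth y i)] (tnth z i)).

Let weight (z : latent) : R :=
  half z * normal_peak 1 ^+ n *
  expR (- (2^-1 * (nrm2 (colv z) + qform Q v - qform Sigma (m z)))).

Lemma joint_densityE b z : joint_density b z =
  weight z * expR (- (2^-1 * qform Sigma (colv b - m z))).
Proof.
rewrite /joint_density /weight big_split/= -!mulrA; congr (_ * _).
have -> : \prod_i phi (tnth z i - mu b i) =
    normal_peak 1 ^+ n * expR (- (2^-1 * nrm2 (colv z - X *m colv b))).
  under eq_bigr do rewrite normal_pdf01E.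
  rewrite big_split/= prodr_const card_ord -expR_sum; congr (_ * expR _).
  rewrite /nrm2 mulr_sumr -sumrN; apply: eq_bigr => i _.
  rewrite mxEB [_ / 2]mulrC; congr (- (_ * (_ - _) ^+ 2)); first by rewrite mxE.
  by rewrite /linpred -row_mul mxE.
rewrite -!mulrA; congr (_ * _); rewrite -!expRD; congr expR.
have := complete_square z (colv b).
move: (nrm2 (_ - _)) (qform Q (_ - _)) (qform Sigma (_ - _)) (nrm2 _ + _ - _).
by move=> A B C D h; rewrite -!opprD -!mulrDr h [D + C]addrC.
Qed.

Let latent_density b z := \prod_i (\1_[set` halfline R (tnth y i)] (tnth z i) *
  phi (tnth z i - mu b i) / Phi (bsign R (tnth y i) * mu b i)).

Lemma measurable_halfline i d (T : measurableType d) (z : T -> latent) :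
  measurable_fun setT z ->
  measurable_fun setT (fun x => \1_[set` halfline R (tnth y i)] (tnth (z x) i) : R).
Proof.
move=> mz.
have m1 : measurable_fun [set: RM] (\1_[set` halfline R (tnth y i)] : RM -> R).
  by apply: measurable_indic; exact: measurable_itv.
apply: (measurableT_comp m1); exact: (measurableT_comp (measurable_tnth i)).
Qed.

Lemma measurable_joint_density d (T : measurableType d) (b : T -> state) (z : T -> latent) :
  measurable_fun setT b -> measurable_fun setT z ->
  measurable_fun setT (fun x => joint_density (b x) (z x)).
Proof.
move=> mb mz; apply: measurable_funM.
  apply: measurable_prodr => i; apply: measurable_funM.
    exact: measurable_halfline.
  apply: (measurableT_comp (@measurable_normal_pdf R 0 1)); apply: measurable_funB.
    exact: (measurableT_comp (measurable_tnth i)).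
  exact: measurable_linpred.
apply: measurableT_comp => //; apply: measurableT_comp => //.
apply: measurable_funM => //; apply: measurable_qform; apply: measurable_vecD.
  exact: measurable_vec_colv.
exact: measurable_vec_cst.
Qed.

Lemma joint_density_ge0 b z : 0 <= joint_density b z.
Proof.
rewrite mulr_ge0 ?expR_ge0//; apply: prodr_ge0 => i _.
by rewrite mulr_ge0 ?normal_pdf_ge0.
Qed.

Lemma latent_density_ge0 b z : 0 <= latent_density b z.
Proof.
apply: prodr_ge0 => i _.
by rewrite divr_ge0 ?normal_cdf_ge0// mulr_ge0 ?normal_pdf_ge0.
Qed.

Lemma measurable_latent_density b : measurable_fun setT (latent_density b).
Proof.
apply: measurable_prodr => i; apply: measurable_funM => //; apply: measurable_funM.
  by apply: measurable_halfline; exact: measurable_id.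
apply: (measurableT_comp (@measurable_normal_pdf R 0 1)); apply: measurable_funB => //.
exact: measurable_tnth.
Qed.

Lemma latent_densityP b :
  transports lebn (latent_law X y b) idfun (latent_density b).
Proof.
pose f i (x : RM) := \1_[set` halfline R (tnth y i)] x *
  phi (x - mu b i) / Phi (bsign R (tnth y i) * mu b i).
have mf i : measurable_fun setT (f i).
  apply: measurable_funM => //; apply: measurable_funM.
    by apply: measurable_indic; exact: measurable_itv.
  by apply: (measurableT_comp (@measurable_normal_pdf R 0 1)); apply: measurable_funB.
have f0 i x : 0 <= f i x.
  by rewrite divr_ge0 ?normal_cdf_ge0// mulr_ge0 ?normal_pdf_ge0.
have := @transports_prod _ _ RM RM R n (fun _ => @lebesgue_measure R)
  (fun i => trunc_normal (mu b i) (tnth y i)) (fun _ => idfun) f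
  (fun i => @measurable_id _ _ setT) mf f0
  (fun i => trunc_normal_density (mu b i) (tnth y i)).
move=> H g mg g0; rewrite (H g mg g0); apply: eq_integral => z _.
by congr (g _ * _)%E; apply/eq_from_tnth => i; rewrite tnth_mktuple.
Qed.

Lemma latent_density_joint b z : dens b * latent_density b z = joint_density b z.
Proof.
rewrite posterior_densityE /latent_density big_split/= -!mulrA [_ * (_ * _)]mulrCA.
rewrite mulrA prodfV /joint_density; field.
by rewrite prodf_seq_neq0; apply/allP => i _; rewrite gt_eqF// normal_cdf_gt0.
Qed.

Let V := invmx Sigma.

Lemma mvnormal_indic (mm : 'cV[R]_p) A : measurable A ->
  (\int[mvnormal mm V]_t (\1_A t)%:E = mvnormal mm V A)%E.
Proof.
move=> mA; rewrite (integral_mvnormal mm V (g := EFin \o \1_A)); first last.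
- by move=> t; rewrite /= lee_fin.
- by apply/measurable_EFinP; exact: measurable_indic.
rewrite /mvnormal /pushforward -[in RHS](setIT (_ @^-1` A)) -integral_indic//.
rewrite -[X in measurable X]setTI; exact: (measurable_affine mm (sqrtmx V)).
Qed.

Lemma joint_density_kernel : exists2 c : R, 0 < c & forall z A, measurable A ->
  (\int[lebp]_b (\1_A b * joint_density b z)%:E =
   (weight z / c)%:E * mvnormal (m z) V A)%E.
Proof.
have S0 := possemidef_precision X Q0; have V0 := possemidef_inv S0 uSigma.
have uV : V \in unitmx by rewrite unitmx_inv.
have [c c0 H] := mvnormal_density V0 uV; exists c => // z A mA.
have w0 : 0 <= weight z / c.
  rewrite divr_ge0 ?(ltW c0)// mulr_ge0 ?expR_ge0// mulr_ge0 ?exprn_ge0 ?normal_peak_ge0//.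
  by apply: prodr_ge0 => i _.
rewrite -mvnormal_indic// (H (m z) (EFin \o \1_A)); first last.
- by move=> t; rewrite /= lee_fin.
- by apply/measurable_EFinP; exact: measurable_indic.
rewrite -ge0_integralZl//; first last.
- by move=> t _; rewrite /= -EFinM lee_fin mulr_ge0// mulr_ge0 ?expR_ge0// ltW.
- apply: emeasurable_funM; first by apply/measurable_EFinP; exact: measurable_indic.
  apply/measurable_EFinP; apply: measurable_funM => //.
  apply: measurableT_comp => //; apply: measurableT_comp => //.
  apply: measurable_funM => //; apply: measurable_qform; apply: measurable_vecD.
    exact: measurable_colv_id.
  exact: measurable_vec_cst.
apply: eq_integral => b _ /=; rewrite -!EFinM; congr EFin.
rewrite joint_densityE /V invmxK; field; by rewrite gt_eqF.
Qed.

Lemma latent_density_mass b : (\int[lebn]_z (latent_density b z)%:E = 1)%E.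
Proof.
transitivity (\int[latent_law X y b]_z cst 1%E z)%E.
  rewrite (latent_densityP b (g := cst 1%E))//.
  by apply: eq_integral => z _; rewrite mul1e.
rewrite (latent_law_map X y b (g := cst 1%E))//.
under eq_integral do rewrite mule1.
by rewrite integral_const1//; exact: std_normalT.
Qed.

Lemma measurable_albert_chib A : measurable A ->
  measurable_fun setT (fun b => albert_chib X y Q v b A).
Proof.
move=> mA; pose B := [set z : state * (latent * state) | A (chain_map X y Q v z.1 z.2)].
have mB : measurable B.
  rewrite -[X in measurable X]setTI.
  exact: (measurable_chain_map X y Q v measurableT mA).
rewrite (_ : (fun b => _) = @noise_law R n p \o xsection B).
  exact: measurable_fun_xsection.
apply/funext => b; rewrite albert_chib_random_map//= /xsection.
by congr noise_law; apply/seteqP; split => o; rewrite /= inE.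
Qed.

Variables (Pi : probability state R) (Z : R).
Hypothesis Z0 : 0 < Z.
Hypothesis PiE : transports lebp Pi idfun (fun b => dens b / Z).

(** Both sides integrate the joint density of coefficients and latent variables,
    once through the latent law given [b] and once through the normal law of [b]
    given [z]. *)
Lemma posterior_stationary A : measurable A ->
  (\int[Pi]_b albert_chib X y Q v b A = Pi A)%E.
Proof.
move=> mA; have [c c0 jK] := joint_density_kernel.
have mN := measurable_mvnormal X Q v mA.
have N0 z : (0 <= mvnormal (m z) V A)%E by exact: (measure_ge0 (std_normal R p)).
have J0 := joint_density_ge0.
pose f (b : state) := (\int[lebn]_z (mvnormal (m z) V A * (joint_density b z)%:E))%E.
have KE b : (albert_chib X y Q v b A * (dens b / Z)%:E = Z^-1%:E * f b)%E.
  rewrite /albert_chib (latent_densityP b (g := fun z => mvnormal (m z) V A))//.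
  rewrite -ge0_integralZr//; first last.
  - by rewrite lee_fin divr_ge0// ltW// posterior_density_gt0.
  - by move=> z _; rewrite mule_ge0// lee_fin latent_density_ge0.
  - apply: emeasurable_funM => //; apply/measurable_EFinP.
    exact: measurable_latent_density.
  rewrite /f -ge0_integralZl//; first last.
  - by rewrite lee_fin invr_ge0 ltW.
  - by move=> z _; rewrite mule_ge0// lee_fin.
  - apply: emeasurable_funM => //; apply/measurable_EFinP.
    by apply: measurable_joint_density => //; exact: measurable_cst.
  apply: eq_integral => z _; rewrite -latent_density_joint muleCA -muleA; congr (_ * _)%E.
  by rewrite -!EFinM; congr EFin; ring.
have mJ : measurable_fun setT (fun z : state * latent => (joint_density z.1 z.2)%:E).
  by apply/measurable_EFinP; exact: measurable_joint_density.
have mNJ : measurable_fun setT (fun z : state * latent =>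
    (mvnormal (m z.2) V A * (joint_density z.1 z.2)%:E)%E).
  by apply: emeasurable_funM => //; exact: (measurableT_comp mN measurable_snd).
have mAJ : measurable_fun setT (fun z : state * latent =>
    (\1_A z.1 * joint_density z.1 z.2)%:E).
  apply/measurable_EFinP; apply: measurable_funM; last exact/measurable_EFinP.
  by apply: (measurableT_comp (measurable_indic mA)); exact: measurable_fst.
have NJ0 (z : state * latent) : (0 <= mvnormal (m z.2) V A * (joint_density z.1 z.2)%:E)%E.
  by rewrite mule_ge0// lee_fin.
have AJ0 (z : state * latent) : (0 <= (\1_A z.1 * joint_density z.1 z.2)%:E)%E.
  by rewrite lee_fin mulr_ge0.
have f0 b : (0 <= f b)%E by apply: integral_ge0 => z _; exact: (NJ0 (b, z)).
rewrite (PiE (g := fun b => albert_chib X y Q v b A)); first last.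
- by move=> b; rewrite albert_chibE// integral_ge0.
- exact: measurable_albert_chib.
rewrite (transports_sub PiE mA).
rewrite [LHS](eq_integral (fun b => Z^-1%:E * f b)%E); last by move=> b _; exact: KE.
rewrite ge0_integralZl//; first last.
- by rewrite lee_fin invr_ge0 ltW.
- exact: (measurable_fun_fubini_tonelli_F (m2 := lebn) _ mNJ NJ0).
rewrite /f (fubini_tonelli (m1 := lebp) (m2 := lebn) (fun z : state * latent =>
  mvnormal (m z.2) V A * (joint_density z.1 z.2)%:E)%E mNJ NJ0)/=.
transitivity (Z^-1%:E * \int[lebn]_z \int[lebp]_b (\1_A b * joint_density b z)%:E)%E.
  congr (_ * _)%E; apply: eq_integral => z _; rewrite jK// muleC.
  rewrite ge0_integralZl//; first last.
  - by move=> b _; rewrite lee_fin.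
  - apply/measurable_EFinP; apply: measurable_joint_density => //.
  congr (_ * _)%E; transitivity (\int[lebp]_b (\1_setT b * joint_density b z)%:E)%E.
    by apply: eq_integral => b _; rewrite indicT mul1r.
  rewrite jK// /mvnormal /pushforward preimage_setT.
  by rewrite [X in (_ * X)%E](_ : _ = 1%E) ?mule1//; exact: std_normalT.
rewrite -(fubini_tonelli (m1 := lebp) (m2 := lebn) (fun z : state * latent =>
  (\1_A z.1 * joint_density z.1 z.2)%:E)%E mAJ AJ0)/=.
rewrite -ge0_integralZl//; first last.
- by rewrite lee_fin invr_ge0 ltW.
- by move=> b _; apply: integral_ge0 => z _; exact: (AJ0 (b, z)).
- exact: (measurable_fun_fubini_tonelli_F (m2 := lebn) _ mAJ AJ0).
apply: eq_integral => b _.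
transitivity (Z^-1%:E * ((\1_A b * dens b)%:E * \int[lebn]_z (latent_density b z)%:E))%E.
  congr (_ * _)%E; rewrite -ge0_integralZl//; first last.
  - by rewrite lee_fin mulr_ge0// ltW// posterior_density_gt0.
  - by move=> z _; rewrite lee_fin latent_density_ge0.
  - by apply/measurable_EFinP; exact: measurable_latent_density.
  by apply: eq_integral => z _; rewrite -EFinM -mulrA latent_density_joint.
by rewrite latent_density_mass mule1 -EFinM; congr EFin; ring.
Qed.

End posterior_law.

(** * Convergence rates for a given design and given responses *)

Section fixed_design.
Variables (R : realType) (n p : nat).
Variables (X : 'M[R]_(n, p)) (y : n.-tuple bool) (Q : 'M[R]_p) (v : 'cV[R]_p).
Local Notation RM := (measurableTypeR R).
Local Notation state := (p.-tuple RM).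
Local Notation dens := (posterior_density X y Q v).
Local Notation lebp := (lebesgue_vect R p).

Lemma integral_expR_sum_abs (a : R) : 0 < a ->
  (\int[lebp]_b (expR (- (a * sum_abs (colv b))))%:E < +oo)%E.
Proof. by move=> a0; rewrite integral_expR_sum// ltry. Qed.

Lemma measurable_expR_sum_abs (a : R) :
  measurable_fun setT (fun b : state => expR (- (a * sum_abs (colv b)))).
Proof.
apply: measurableT_comp => //; apply: measurableT_comp => //.
apply: measurable_funM => //; apply: measurable_sumr => i.
apply: measurableT_comp => //; exact: measurable_colv_id.
Qed.

Lemma sqr_le_expR (x : R) : 0 <= x -> x ^+ 2 <= 4 * expR x.
Proof.
move=> x0; have h : x / 2 <= expR (x / 2) by apply: le_trans (expR_ge1Dx _); lra.
have -> : expR x = expR (x / 2) ^+ 2 by rewrite -expRM_natl; congr expR; field.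
have e0 := expR_ge0 (x / 2); move: h e0; move: (expR _) => e h e0; nra.
Qed.

Lemma exponential_tail_lty (f : state -> R) (D a : R) : 0 <= D -> 0 < a ->
  measurable_fun setT f -> (forall b, 0 <= f b) ->
  (forall b, f b <= D * expR (- (a * sum_abs (colv b)))) ->
  (\int[lebp]_b (f b)%:E < +oo)%E.
Proof.
move=> D0 a0 mf f0 fD; have me := measurable_expR_sum_abs a.
apply: (@le_lt_trans _ _ (D%:E * \int[lebp]_b (expR (- (a * sum_abs (colv b))))%:E)%E).
  rewrite -ge0_integralZl//; last exact/measurable_EFinP.
  apply: ge0_le_integral => //.
  - by move=> b _; rewrite lee_fin.
  - exact/measurable_EFinP.
  - by apply: emeasurable_funM => //; exact/measurable_EFinP.
  - by move=> b _; rewrite -EFinM lee_fin.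
by rewrite lte_mul_pinfty// integral_expR_sum_abs.
Qed.

Section tail.
Hypothesis Q0 : possemidefmx Q.
Variables c C : R.
Hypotheses (c0 : 0 < c) (C0 : 0 <= C).
Hypothesis tail : forall b, dens b <= C * expR (- (c * sum_abs (colv b))).

Lemma posterior_mass_lty : (\int[lebp]_b (dens b)%:E < +oo)%E.
Proof.
apply: exponential_tail_lty C0 c0 _ _ tail; first exact: measurable_posterior_density.
by move=> b; rewrite ltW// posterior_density_gt0.
Qed.

Lemma posterior_mass_gt0 : (0 < \int[lebp]_b (dens b)%:E)%E.
Proof.
apply: (integral_gt0 (g := fun b => std_density (colv b))).
- exact: measurable_posterior_density.
- exact: posterior_density_gt0.
- by apply: measurable_std_density; exact: measurable_colv_id.
- by move=> b; exact: std_density_ge0.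
- by rewrite integral_std_density oner_neq0.
Qed.

Lemma posterior_properP : posterior_proper X y Q v.
Proof.
apply/integrableP; split.
  by apply/measurable_EFinP; exact: measurable_posterior_density.
rewrite (eq_integral (fun b => (dens b)%:E)); first exact: posterior_mass_lty.
by move=> b _; rewrite /= ger0_norm// ltW// posterior_density_gt0.
Qed.

(** Half of the exponential decay absorbs the quadratic growth of [psi2 b]. *)
Lemma psi2_posterior_tail (b : state) : exists2 D : R, 0 <= D & forall b',
  psi2 X Q b b' * dens b' <= D * expR (- (c / 2 * sum_abs (colv b'))).
Proof.
set K := \sum_j \sum_i `|precision X Q j i|.
have K0 : 0 <= K by apply: sumr_ge0 => j _; exact: sumr_ge0.
set s := sum_abs (colv b); have s0 : 0 <= s := sum_abs_ge0 _.
pose L := 2 * s ^+ 2 + 32 / c ^+ 2.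
have L0 : 0 <= L by rewrite addr_ge0 ?mulr_ge0 ?sqr_ge0// invr_ge0 sqr_ge0.
exists (K * L * C); first by rewrite !mulr_ge0.
move=> b'; set t := sum_abs (colv b'); have t0 : 0 <= t := sum_abs_ge0 _.
have h1 : psi2 X Q b b' <= K * (s + t) ^+ 2.
  apply: le_trans (qform_le_sum_abs _ _) _; rewrite ler_wpM2l//.
  rewrite ler_pXn2r ?nnegrE ?addr_ge0 ?sum_abs_ge0//.
  rewrite /s /t /sum_abs -big_split/=; apply: ler_sum => i _.
  by rewrite mxEB ler_normB.
set x := c / 2 * t; have x0 : 0 <= x by rewrite mulr_ge0// divr_ge0// ltW.
have h2 : (s + t) ^+ 2 <= L * expR x.
  have e1 : 1 <= expR x by rewrite -expR0 ler_expR.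
  have tx : t = x * 2 / c by rewrite /x; field; rewrite gt_eqF.
  have h3 : t ^+ 2 <= 16 / c ^+ 2 * expR x.
    have -> : t ^+ 2 = 4 / c ^+ 2 * x ^+ 2 by rewrite tx; field; rewrite gt_eqF.
    have -> : 16 / c ^+ 2 * expR x = 4 / c ^+ 2 * (4 * expR x) by field; rewrite gt_eqF.
    by rewrite ler_wpM2l ?sqr_le_expR// divr_ge0 ?sqr_ge0.
  apply: (@le_trans _ _ (2 * s ^+ 2 + 2 * t ^+ 2)).
    by have := sqr_ge0 (s - t); rewrite !expr2; lra.
  rewrite /L [leRHS]mulrDl; apply: lerD.
    by rewrite ler_peMr// mulr_ge0 ?sqr_ge0.
  have -> : 32 / c ^+ 2 * expR x = 2 * (16 / c ^+ 2 * expR x) by field; rewrite gt_eqF.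
  by rewrite ler_wpM2l.
apply: le_trans (ler_pM (psi2_ge0 X Q0 _ _) _ (le_trans h1 (ler_wpM2l K0 h2)) (tail b')) _.
  by rewrite ltW// posterior_density_gt0.
have -> : K * (L * expR x) * (C * expR (- (c * sum_abs (colv b')))) =
    K * L * C * (expR x * expR (- (c * t))) by rewrite -/t; ring.
rewrite -expRD ler_wpM2l// ?mulr_ge0// ler_expR /x -/t; lra.
Qed.

Section posterior_moment.
Variables (Pi : probability state R) (Z : R).
Hypothesis Z0 : 0 < Z.
Hypothesis PiE : transports lebp Pi idfun (fun b => dens b / Z).

Lemma psi2_posterior_lty b : (\int[Pi]_b' (psi2 X Q b b')%:E < +oo)%E.
Proof.
have [D D0 hD] := psi2_posterior_tail b.
rewrite (PiE (g := fun b' => (psi2 X Q b b')%:E)); first last.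
- by move=> b'; rewrite lee_fin; exact: (psi2_ge0 X Q0).
- apply/measurable_EFinP.
  exact: (measurableT_comp (measurable_psi2 X Q) (pair1_measurable b)).
under eq_integral do rewrite -EFinM.
apply: (@exponential_tail_lty _ (D / Z) (c / 2)).
- by rewrite divr_ge0// ltW.
- by rewrite divr_gt0.
- apply: measurable_funM.
    exact: (measurableT_comp (measurable_psi2 X Q) (pair1_measurable b)).
  by apply: measurable_funM => //; exact: measurable_posterior_density.
- move=> b'; rewrite mulr_ge0 ?(psi2_ge0 X Q0)// divr_ge0 ?(ltW Z0)//.
  by rewrite ltW// posterior_density_gt0.
- by move=> b'; rewrite mulrA [leRHS]mulrAC ler_pM2r ?invr_gt0.
Qed.

End posterior_moment.

End tail.

Lemma convergence_rate_le (D : (set state -> \bar R) -> (set state -> \bar R) -> \bar R)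
    K Pi (rho : R) : geometric_rates D K Pi rho -> convergence_rate D K Pi <= rho.
Proof.
move=> h; rewrite /convergence_rate; case: asboolP => [_|[]]; last by exists rho.
by apply: ge_inf => //; exists 0 => x [/andP[]].
Qed.

Lemma convergence_rate_le1 (D : (set state -> \bar R) -> (set state -> \bar R) -> \bar R)
    K Pi : convergence_rate D K Pi <= 1.
Proof.
rewrite /convergence_rate; case: asboolP => // -[r hr].
have [/andP[_ r1] _] := hr; apply: le_trans r1; apply: ge_inf hr.
by exists 0 => x [/andP[]].
Qed.

Lemma rates_le1 : rate_psi X y Q v <= 1 /\ rate_TV X y Q v <= 1.
Proof.
by rewrite /rate_psi /rate_TV; case: asboolP => // _; split; exact: convergence_rate_le1.
Qed.

Hypothesis Q_prior : posdefmx Q \/ Q = 0.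
Hypothesis uSigma : precision X Q \in unitmx.
Variables k rho : R.
Hypothesis k_ge0 : 0 <= k.
Hypothesis balanced : forall (b b' : state) (w : 'cV[R]_p),
  \sum_i mean_slope (linpred X b i) (linpred X b' i) (tnth y i) *
    (row i X *m w) 0 0 ^+ 2 <= k * \sum_i (row i X *m w) 0 0 ^+ 2.
Hypothesis k_rho : k ^+ 2 + sigma_design X Q ^+ 2 <= rho ^+ 2.
Hypothesis rho01 : 0 < rho <= 1.

Lemma rates_le : overlap X y -> rate_psi X y Q v <= rho /\ rate_TV X y Q v <= rho.
Proof.
move=> ov.
have Q0 : possemidefmx Q.
  case: Q_prior => [/posdefmx_semi//|->]; split=> [|u]; first by rewrite trmx0.
  by rewrite /qform mulmx0 mul0mx mxE.
have [c [C [c0 C0 tail]]] : exists c C : R, [/\ 0 < c, 0 <= C &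
    forall b, dens b <= C * expR (- (c * sum_abs (colv b)))].
  by apply: posterior_tail; case: Q_prior => ?; [left|right].
have lty := posterior_mass_lty c0 C0 tail.
have [Pi [PiE PiD]] := density_probability (measurable_posterior_density X y Q v)
  (fun b => ltW (posterior_density_gt0 X y Q v b)) lty posterior_mass_gt0.
have Z0 := density_mass_gt0 lty posterior_mass_gt0.
have mF := measurable_chain_map X y Q v.
have PE : (fun A => posterior X y Q v A) = Pi by rewrite PiE.
have KE b A (mA : measurable A) := albert_chib_random_map X y Q v b mA.
have mpsi2 := measurable_psi2 X Q.
have psi2_0 := psi2_ge0 X Q0.
have ctr := chain_contraction v Q0 uSigma k_ge0 balanced k_rho.
have stat := posterior_stationary Q0 uSigma Z0 PiD.
have mom := psi2_posterior_lty Q0 c0 C0 tail Z0 PiD.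
have prop : `[< posterior_proper X y Q v >] by apply/asboolP; exact: posterior_properP c0 C0 tail.
have r2 := fun A b b' e mA e01 =>
  @chain_smoothing R n p X y Q v Q0 uSigma k rho k_ge0 balanced k_rho A b b' e mA e01.
rewrite /rate_psi /rate_TV prop -/(posterior X y Q v).
have -> : posterior X y Q v = Pi by rewrite -PE.
split; apply: convergence_rate_le.
  exact: (wasserstein_geometric (@noise_lawT R n p) mF KE mpsi2 psi2_0 rho01 ctr stat mom).
exact: (total_variation_geometric (@noise_lawT R n p) mF KE mpsi2 psi2_0 (psi2C X Q)
  rho01 ctr stat mom (shift_cst_ge0 R p) r2).
Qed.
End fixed_design.

(** * Designs with repeated rows *)

Section repeated_design.
Variables (R : realType) (n p q : nat) (lab : 'I_n -> 'I_q).
Implicit Types (y : n.-tuple bool) (i : 'I_q) (a : bool).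

Definition count_response y i a : R :=
  \sum_(j < n | lab j == i) (tnth y j == a)%:R.

Lemma nrepE i : (nrep lab i)%:R = \sum_(j < n | lab j == i) 1 :> R.
Proof. by rewrite /nrep sumr_const; congr (_ *+ _); apply: eq_card => j; rewrite inE. Qed.

Definition both_responses (delta : R) y :=
  forall i a, delta * (nrep lab i)%:R <= count_response y i a.

Lemma count_response_sum y i :
  count_response y i true + count_response y i false = (nrep lab i)%:R.
Proof.
rewrite nrepE /count_response -big_split/=; apply: eq_bigr => j _.
by case: (tnth y j); rewrite /= ?addr0 ?add0r.
Qed.

Variables (X : 'M[R]_(n, p)) (xt : 'M[R]_(q, p)).
Hypothesis rowsE : forall j, row j X = row (lab j) xt.
Variables (delta : R) (y : n.-tuple bool).
Hypothesis delta_gt0 : 0 < delta.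
Hypothesis good : both_responses delta y.

Lemma overlap_both_responses : overlap X y.
Proof.
move=> j; have := good (lab j) (~~ tnth y j).
have r0 : 0 < (nrep lab (lab j))%:R :> R.
  by rewrite ltr0n /nrep card_gt0; apply/set0Pn; exists j; rewrite inE.
move=> /(lt_le_trans (mulr_gt0 delta_gt0 r0)) h.
have [/existsP[j' /andP[/eqP jj /eqP yj]]|/existsPn none] :=
    boolP [exists j', (lab j' == lab j) && (tnth y j' == ~~ tnth y j)].
  by exists j' => //; rewrite !rowsE jj.
move: h; rewrite /count_response big1 ?ltxx// => j' jj.
by have := none j'; rewrite jj/= => /negbTE ->.
Qed.

(** Each distinct row carries a fraction [delta] of either response, and the mean
    slopes for the two responses add up to at most [7 / 4]. *)
Lemma balanced_both_responses (b b' : p.-tuple (measurableTypeR R)) (w : 'cV[R]_p) :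
  \sum_i mean_slope (linpred X b i) (linpred X b' i) (tnth y i) *
    (row i X *m w) 0 0 ^+ 2 <=
  (1 - delta / 4) * \sum_i (row i X *m w) 0 0 ^+ 2.
Proof.
rewrite (partition_big lab xpredT)//= [leRHS](_ : _ = \sum_i \sum_(j < n | lab j == i)
  (1 - delta / 4) * (row j X *m w) 0 0 ^+ 2); last first.
  by rewrite mulr_sumr (partition_big lab xpredT).
apply: ler_sum => i _.
set c := (row i xt *m w) 0 0 ^+ 2.
pose e a := mean_slope ((row i xt *m colv b) 0 0) ((row i xt *m colv b') 0 0) a.
have c0 : 0 <= c by exact: sqr_ge0.
rewrite (eq_bigr (fun j => e (tnth y j) * c)); last first.
  by move=> j /eqP ji; rewrite /e /linpred rowsE ji.
rewrite [leRHS](eq_bigr (fun j => (1 - delta / 4) * c)); last first.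
  by move=> j /eqP ji; rewrite rowsE ji.
rewrite -!mulr_suml ler_wpM2r//.
have -> : \sum_(j < n | lab j == i) (1 - delta / 4) = (1 - delta / 4) * (nrep lab i)%:R.
  by rewrite nrepE mulr_sumr; apply: eq_bigr => j _; rewrite mulr1.
have -> : \sum_(j < n | lab j == i) e (tnth y j) =
    count_response y i true * e true + count_response y i false * e false.
  rewrite /count_response !mulr_suml -big_split/=; apply: eq_bigr => j _.
  by case: (tnth y j); rewrite /= mul1r mul0r ?addr0 ?add0r.
have := good i true; have := good i false; rewrite -(count_response_sum y i).
have := mean_slope_pair ((row i xt *m colv b) 0 0) ((row i xt *m colv b') 0 0).
have /andP[_] := mean_slope01 ((row i xt *m colv b) 0 0) ((row i xt *m colv b') 0 0) true.
have /andP[_] := mean_slope01 ((row i xt *m colv b) 0 0) ((row i xt *m colv b') 0 0) false.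
have : 0 <= (nrep lab i)%:R :> R by [].
rewrite -/(e true) -/(e false) -(count_response_sum y i).
move: (e true) (e false) (count_response _ _ _) (count_response _ _ _).
move=> e1 e0 N1 N0 N_ge0 h0 h1 h2 g0 g1.
have k1 := ler_wpM2r (_ : 0 <= 1 - e1) g1.
have k0 := ler_wpM2r (_ : 0 <= 1 - e0) g0.
have {}k1 := k1 ltac:(lra); have {}k0 := k0 ltac:(lra).
have := ler_wpM2l (mulr_ge0 (ltW delta_gt0) N_ge0) (_ : 4^-1 <= 2 - e1 - e0).
by move=> /(_ ltac:(lra)); nra.
Qed.

End repeated_design.

(** * Concentration of the responses *)

Section response_probability.
Variables (R : realType) (n q : nat) (lab : 'I_n -> 'I_q) (g : 'I_q -> R).
Hypothesis g01 : forall i, 0 < g i < 1.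
Local Notation law := (prod_measure (fun j : 'I_n => bernoulli_prob (g (lab j)))).

Lemma measurable_responses (A : set (n.-tuple bool)) : measurable A.
Proof.
rewrite -(image_id A) -bigcup_imset1.
apply: fin_bigcup_measurable; first exact: finite_finset.
move=> t _; rewrite (_ : [set t] = \bigcap_(i in [set: 'I_n])
  ((@tnth _ bool ^~ i) @^-1` [set tnth t i])).
  apply: fin_bigcap_measurable; first exact: finite_finset.
  by move=> i _; rewrite -[X in measurable X]setTI; exact: measurable_tnth.
apply/seteqP; split=> [u -> //|u tu]; apply/eq_from_tnth => i.
exact: (tu i I).
Qed.

Lemma measurable_response_fun (f : n.-tuple bool -> R) : measurable_fun setT f.
Proof. by move=> _ A mA; exact: measurable_responses. Qed.

Variable eta : R.
Hypothesis eta_g : forall i, eta <= Num.min (g i) (1 - g i).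
Hypothesis eta_gt0 : 0 < eta.

Lemma expR1_ge2 : 2 <= expR 1 :> R.
Proof. by have := @expR_ge1Dx R 1; lra. Qed.

(** Each observation of row [i] has response [a] with probability at least
    [eta], so that its factor is at most [1 - eta * (1 - expR (-1))], and
    [expR (-1) <= 1 / 2]. *)
Lemma count_response_expectation i a :
  (\int[law]_y (expR (- count_response R lab y i a))%:E <=
   (expR (- (eta / 2 * (nrep lab i)%:R)))%:E)%E.
Proof.
pose f (j : 'I_n) (b : bool) : R := if lab j == i then expR (- (b == a)%:R) else 1.
pose c (j : 'I_n) : R := if lab j == i
  then (if a then g i else 1 - g i) * expR (-1) + (if a then 1 - g i else g i) else 1.
have fE y : expR (- count_response R lab y i a) = \prod_j f j (tnth y j).
  rewrite /count_response -sumrN expR_sum big_mkcond/=.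
  by apply: eq_bigr => j _; rewrite /f.
under eq_integral do rewrite fE.
rewrite (integral_prod_fun (c := c))//; first last.
- move=> j; have /andP[/ltW g0 /ltW g1] := g01 (lab j).
  rewrite integral_bernoulli_prob ?g0//; last first.
    by move=> b; rewrite lee_fin /f; case: ifP => // _; exact: expR_ge0.
  rewrite -!EFinM -EFinD /f /c /unstable.onem; congr EFin; case: ifP => [/eqP ji|_]; last by lra.
  by rewrite ji; case: (a); rewrite /= ?oppr0 ?expR0 ?mulr1// addrC.
- by move=> j b; rewrite /f; case: ifP => // _; exact: expR_ge0.
rewrite lee_fin nrepE mulr_sumr -sumrN expR_sum [leRHS]big_mkcond/=.
apply: ler_prod => j _; rewrite /c; case: ifP => [/eqP ji|_]; last by rewrite ler01 lexx.
have /andP[/ltW g0 /ltW g1] := g01 i.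
have h2 : expR (-1) <= 2^-1 :> R by rewrite expRN lef_pV2 ?posrE ?expR_gt0// expR1_ge2.
have h0 := expR_ge0 (-1 : R).
have he : 1 - eta / 2 <= expR (- (eta / 2 * 1)) by rewrite mulr1 expR_ge1Dx.
have := eta_g i; rewrite le_min => /andP[e1 e2].
move: h2 h0 he; set E := expR (-1) => h2 h0 he.
case: (a); apply/andP; split; nra.
Qed.

(** Markov's inequality for [expR (- count)], at half of the exponent that
    [count_response_expectation] provides. *)
Lemma few_responses i a :
  (law [set y | (count_response R lab y i a < eta / 4 * (nrep lab i)%:R)%R] <=
   (expR (- (eta / 4 * (nrep lab i)%:R)))%:E)%E.
Proof.
set B := [set y | _]; set N := (nrep lab i)%:R.
have mB : measurable B by exact: measurable_responses.
pose f y := expR (eta / 4 * N) * expR (- count_response R lab y i a).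
have f0 y : 0 <= f y by rewrite mulr_ge0 ?expR_ge0.
rewrite -(setIT B) -integral_indic//.
apply: (@le_trans _ _ (\int[law]_y (f y)%:E)%E).
  apply: ge0_le_integral => //.
  - by apply/measurable_EFinP; exact: measurable_indic.
  - by apply/measurable_EFinP; exact: measurable_response_fun.
  - move=> y _; rewrite lee_fin indicE; have [|_] := boolP (y \in B); last exact: f0.
    rewrite inE => yB.
    by rewrite /f -expRD -[X in X <= _]expR0 ler_expR subr_ge0 ltW.
under eq_integral do rewrite EFinM.
rewrite ge0_integralZl//; first last.
  by apply/measurable_EFinP; exact: measurable_response_fun.
apply: le_trans (lee_wpmul2l _ (count_response_expectation i a)) _.
  by rewrite lee_fin expR_ge0.
rewrite -EFinM -expRD lee_fin ler_expR -/N; lra.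
Qed.

Lemma responses_failure (s : R) : (forall i, s <= (nrep lab i)%:R) ->
  (law [set y | ~ both_responses lab (eta / 4)%R y] <=
   (2 * q%:R * expR (- (eta / 4 * s)))%:E)%E.
Proof.
move=> s_le.
pose B (x : 'I_q * bool) := [set y |
  count_response R lab y x.1 x.2 < eta / 4 * (nrep lab x.1)%:R].
have union_le (l : seq ('I_q * bool)) :
    (law (\big[setU/set0]_(x <- l) B x) <= ((size l)%:R * expR (- (eta / 4 * s)))%:E)%E.
  elim: l => [|x l IH]; first by rewrite big_nil measure0 mul0r.
  rewrite big_cons; apply: (le_trans (measureU2 _ _ _)); try exact: measurable_responses.
  rewrite /= -natr1 mulrDl mul1r addrC EFinD leeD//.
  apply: le_trans (few_responses x.1 x.2) _.
  by rewrite lee_fin ler_expR lerN2 ler_wpM2l// divr_ge0// ltW.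
apply: (@le_trans _ _ (law (\big[setU/set0]_(x : 'I_q * bool) B x))).
  apply: le_measure; rewrite ?inE; try exact: measurable_responses.
  move=> y bad; apply: contrapT => none; apply: bad => i a.
  rewrite leNgt; apply/negP => yB; apply: none.
  by rewrite (bigD1 (i, a))//=; left.
apply: le_trans (union_le _) _; rewrite lee_fin ler_wpM2r ?expR_ge0//.
by rewrite [index_enum _]unlock -enumT -cardT card_prod card_ord card_bool natrM mulrC.
Qed.

End response_probability.

Section limits.
Variable R : realType.

(** If [q k >= 2], the assumption on [ln (q k) / r k] forces both
    [q k * expR (- (c * r k)) <= expR (- (c / 2 * r k))] and [r k -> +oo]; if
    [q k = 1], the single row is repeated [n k] times. *)
Lemma failure_cvg0 (n q r : nat -> nat) (c : R) : 0 < c ->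
  n k @[k --> \oo] --> \oo -> (forall k, (0 < r k)%N) ->
  ln (q k)%:R / (r k)%:R @[k --> \oo] --> (0 : R) ->
  2 * (q k)%:R * expR (- (c * (if q k == 1 then n k else r k)%:R)) @[k --> \oo]
    --> (0 : R).
Proof.
move=> c0 n_infty r_gt0 q_r; apply/cvgr0Pnorm_le => e e0.
have [M [M0 Me]] : exists M : nat, (0 < M)%N /\ 2 * expR (- (c / 2 * M%:R)) <= e.
  pose x := 2 / c * (2 / e); have x0 : 0 <= x by rewrite mulr_ge0 ?divr_ge0// ltW.
  exists (Num.bound x).+1; split => //.
  have hM : x <= (Num.bound x).+1%:R.
    by rewrite (le_trans (ltW (archi_boundP x0)))// ler_nat.
  rewrite expRN -ler_pdivlMl// -[leRHS]invrK lef_pV2 ?posrE ?invr_gt0 ?mulr_gt0 ?invr_gt0//.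
    apply: le_trans (expR_ge1Dx _); rewrite invfM invrK.
    apply: (@le_trans _ _ (c / 2 * x)); last first.
      by rewrite (le_trans (ler_wpM2l _ hM)) ?lerDr// divr_ge0// ltW.
    have -> : c / 2 * x = 2 / e by rewrite /x; field; rewrite !gt_eqF.
    by [].
  by rewrite expR_gt0.
have M0' : 0 < M%:R :> R by rewrite ltr0n.
have ln2 : 0 < ln (2 : R) by rewrite ln_gt0// ltr1n.
pose d := Num.min (c / 2) (ln 2 / M%:R).
have d0 : 0 < d by rewrite lt_min !divr_gt0.
near=> k.
have nM : (M <= n k)%N by near: k; move/cvgnyPge : n_infty; exact.
have qd : ln (q k)%:R / (r k)%:R < d.
  have : `|ln (q k)%:R / (r k)%:R : R| < d by near: k; exact: cvgr0_norm_lt.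
  exact: le_lt_trans (ler_norm _).
have rk0 : 0 < (r k)%:R :> R by rewrite ltr0n.
rewrite ger0_norm ?mulr_ge0 ?expR_ge0//; apply: le_trans Me.
rewrite -mulrA ler_pM2l//.
have [q1|q1] := eqVneq (q k) 1%N.
  rewrite q1 mul1r ler_expR lerN2 (@le_trans _ _ (c / 2 * (n k)%:R))//.
    by rewrite ler_pM2l ?divr_gt0// ler_nat.
  by rewrite ler_wpM2r// ler_pdivrMr//; move: c0; lra.
have [q0|q0] := eqVneq (q k) 0%N; first by rewrite q0 mul0r expR_ge0.
have q2 : (2 <= q k)%N by case: (q k) q1 q0 => [|[|]].
have q0' : 0 < (q k)%:R :> R by rewrite ltr0n (leq_trans _ q2).
have lnq : ln (q k)%:R < d * (r k)%:R by rewrite -ltr_pdivrMr.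
have rM : M%:R <= (r k)%:R :> R.
  have : ln 2 <= ln 2 / M%:R * (r k)%:R :> R.
    apply: (@le_trans _ _ (ln (q k)%:R)); first by rewrite ler_ln ?posrE// ler_nat.
    apply: le_trans (ltW lnq) _; rewrite ler_pM2r//.
    by rewrite /d ge_min lexx orbT.
  by rewrite -mulrA ler_pMr// ler_pdivlMl// mulr1.
have lnqc : ln (q k)%:R <= c / 2 * (r k)%:R.
  by apply: le_trans (ltW lnq) _; rewrite ler_pM2r// /d ge_min lexx.
rewrite -[X in X * _](@lnK R) ?posrE// -expRD ler_expR.
have : c / 2 * M%:R <= c / 2 * (r k)%:R by rewrite ler_pM2l ?divr_gt0.
move: lnqc; lra.
Unshelve. all: by end_near. Qed.

End limits.

Lemma nrep_single n q (lab : 'I_n -> 'I_q) i : q = 1%N -> nrep lab i = n.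
Proof.
move=> q1; rewrite /nrep (_ : [set j | _]%SET = [set: 'I_n]%SET) ?cardsT ?card_ord//.
apply/setP => j; rewrite !inE; apply/eqP/val_inj => /=.
have := ltn_ord i; have := ltn_ord (lab j); move: (val (lab j)) (val i) => a b.
by rewrite q1 !ltnS !leqn0 => /eqP -> /eqP ->.
Qed.

Lemma sigma_design_ge0 (R : realType) n p (X : 'M[R]_(n, p)) Q : 0 <= sigma_design X Q.
Proof. exact: sqrtr_ge0. Qed.

Theorem proposition23 (R : realType)
  (n p q r : nat -> nat)
  (X : forall k, 'M[R]_(n k, p k))
  (xt : forall k, 'M[R]_(q k, p k))
  (lab : forall k, 'I_(n k) -> 'I_(q k))
  (G : R -> R)
  (betastar : forall k, 'cV[R]_(p k))
  (v : forall k, 'cV[R]_(p k))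
  (Q : forall k, 'M[R]_(p k))
  (n_infty : n k @[k --> \oo] --> \oo)
  (p_infty : p k @[k --> \oo] --> \oo)
  (rows : forall k, repeated_rows (X k) (xt k) (@lab k))
  (r_gt0 : forall k, (0 < r k)%N)
  (r_le : forall k i, (r k <= nrep (@lab k) i)%N)
  (G01 : forall t, 0 < G t < 1)
  (Q_prior : forall k, posdefmx (Q k) \/ Q k = 0)
  (D1 : forall k, precision (X k) (Q k) \in unitmx)
  (D2 : limn_esup (fun k =>
     (sigma_design (X k) (Q k) * Num.sqrt (2 * ln (p k)%:R))%:E) = 0%E)
  (D3 : ln (q k)%:R / (r k)%:R @[k --> \oo] --> (0 : R))
  (ell : R)
  (D4 : forall k,
     \big[Num.max/0]_(i < q k) `|(row i (xt k) *m betastar k) 0 0| < ell)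
  (D4G : 0 < inf [set Num.min (G t) (1 - G t) | t in [set t | `|t| < ell]]) :
  (exists rho : R, rho < 1 /\ forall eps : R, 0 < eps ->
     response_law G (xt k) (@lab k) (betastar k)
       [set y | rho + eps < rate_psi (X k) y (Q k) (v k)]
     @[k --> \oo] --> 0%E) /\
  (exists rho : R, rho < 1 /\ forall eps : R, 0 < eps ->
     response_law G (xt k) (@lab k) (betastar k)
       [set y | rho + eps < rate_TV (X k) y (Q k) (v k)]
     @[k --> \oo] --> 0%E).
Proof.
have ell0 : 0 < ell by apply: le_lt_trans (D4 0%N); exact: bigmax_ge_id.
move: D4G; set eta := inf _ => eta0.
have etaG t : `|t| < ell -> eta <= Num.min (G t) (1 - G t).
  move=> tl; apply: ge_inf; last by exists t.
  exists 0 => _ [u _ <-]; have /andP[/ltW g0 /ltW g1] := G01 u.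
  by rewrite le_min g0 subr_ge0.
pose g k i := G ((row i (xt k) *m betastar k) 0 0).
have eta_g k i : eta <= Num.min (g k i) (1 - g k i).
  apply: etaG; apply: le_lt_trans (D4 k).
  exact: (le_bigmax_cond 0 (fun i => `|(row i (xt k) *m betastar k) 0 0|)).
have eta1 : eta <= 1.
  have /andP[_ /ltW g1] := G01 0; apply: le_trans g1.
  by apply: le_trans (etaG 0 _) _; rewrite ?normr0// ge_min lexx.
pose good k := both_responses (@lab k) (eta / 4).
have failure (A : forall k, set ((n k).-tuple bool)) :
    (\forall k \near \oo, forall y, good k y -> ~ A k y) ->
    response_law G (xt k) (@lab k) (betastar k) (A k) @[k --> \oo] --> 0%E.
  move=> Agood.
  pose bound k := 2 * (q k)%:R * expR (- (eta / 4 * (if q k == 1%N then n k else r k)%:R)).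
  apply: (@squeeze_cvge _ _ _ _ (fun=> 0%E) _ (fun k => (bound k)%:E)); last 2 first.
  - exact: cvg_cst.
  - by apply: cvg_EFin; [exact: nearW|apply: failure_cvg0 => //; rewrite divr_gt0].
  near=> k; apply/andP; split; first exact: measure_ge0.
  have gk : forall y, good k y -> ~ A k y by near: k.
  have s_le i : (if q k == 1%N then n k else r k)%:R <= (nrep (@lab k) i)%:R :> R.
    by rewrite ler_nat; case: eqP => [/nrep_single ->//|_].
  apply: le_trans (responses_failure (fun i => G01 _) (eta_g k) eta0 s_le).
  apply: le_measure; rewrite ?inE; try exact: measurable_responses.
  by move=> y Ay; apply: contrapT => /contrapT /gk.
have sigma0 : sigma_design (X k) (Q k) * Num.sqrt (2 * ln (p k)%:R) @[k --> \oo]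
    --> (0 : R).
  have := limn_esup_le_cvg (l := 0%E) (u := fun k =>
    (sigma_design (X k) (Q k) * Num.sqrt (2 * ln (p k)%:R))%:E).
  rewrite D2 lexx => /(_ isT) h.
  have /fine_cvgP[_ //] := h (fun k => ltac:(rewrite lee_fin mulr_ge0 ?sqrtr_ge0//)).
have sigma_small e : 0 < e -> \forall k \near \oo, sigma_design (X k) (Q k) <= e.
  move=> e0; near=> k.
  (* As [p k] grows, the logarithmic factor in the assumption exceeds 1. *)
  have pk : (Num.bound (expR 2^-1 : R) <= p k)%N.
    by near: k; move/cvgnyPge : p_infty; exact.
  have pk' : expR 2^-1 <= (p k)%:R :> R.
    by rewrite (le_trans (ltW (archi_boundP (expR_ge0 _))))// ler_nat.
  have lnp : 1 <= Num.sqrt (2 * ln (p k)%:R) :> R.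
    rewrite -[leLHS]sqrtr1 ler_wsqrtr// -ler_pdivrMl// mulr1 -[leLHS]expRK.
    by rewrite ler_ln ?posrE ?expR_gt0// (lt_le_trans (expR_gt0 _) pk').
  have : `|sigma_design (X k) (Q k) * Num.sqrt (2 * ln (p k)%:R)| <= e.
    by near: k; exact: cvgr0_norm_le.
  apply: le_trans; apply: le_trans (ler_norm _).
  by rewrite ler_peMr// sigma_design_ge0.
(* The factor [1 - delta / 4] for the fraction [delta = eta / 4]. *)
pose rho : R := 1 - eta / 4 / 4.
have rates eps : 0 < eps -> \forall k \near \oo, forall y, good k y ->
    rate_psi (X k) y (Q k) (v k) <= rho + eps /\
    rate_TV (X k) y (Q k) (v k) <= rho + eps.
  move=> e0; near=> k => y yk.
  have [le1|/ltW ge1] := lerP 1 (rho + eps).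
    by have [h1 h2] := rates_le1 (X k) y (Q k) (v k); split; exact: le_trans le1.
  have [_ rowsE] := rows k; have delta0 : 0 < eta / 4 by rewrite divr_gt0.
  have rho0 : 0 <= rho by rewrite /rho; lra.
  have sk : sigma_design (X k) (Q k) <= eps by near: k; exact: sigma_small.
  have sk0 := sigma_design_ge0 (X k) (Q k).
  apply: (rates_le (v k) (Q_prior k) (D1 k) rho0
    (balanced_both_responses rowsE delta0 yk)).
  - rewrite [leRHS]sqrrD -[leRHS]addrA lerD2l (@le_trans _ _ (eps ^+ 2))//.
      by rewrite ler_pXn2r ?nnegrE// ltW.
    by rewrite lerDr mulrn_wge0// mulr_ge0// ltW.
  - by rewrite ge1 andbT ltr_wpDl.
  - exact (overlap_both_responses rowsE delta0 yk).
have rho1 : rho < 1 by rewrite /rho; lra.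
split; exists rho; split => // eps e0; apply: failure.
  by apply: filterS (rates eps e0) => k h y /h[h1 _] /=; rewrite ltNge h1.
by apply: filterS (rates eps e0) => k h y /h[_ h1] /=; rewrite ltNge h1.
Unshelve. all: by end_near. Qed.
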